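(* Let $N>2$ and assume $f_1$, $\alpha_*$ and $f_2$ satisfy $(H_1)$–$(H_5)$ below with $\gamma=\infty$. Let $\epsilon$, $A$ be constants as in the conclusion of the following result: there exist $\bar\epsilon,\bar A>0$ such that for $0<\epsilon<\bar\epsilon$, $A>\bar A$ the problem with the nonlinearity $f$ below has at least two ground states. If, in addition, $f$ satisfies condition (GST) below, then the problem $$\Delta u+f(u)=0\ \text{in }\mathbb R^N,\qquad \lim_{|x|\to\infty}u(x)=0,$$ with $$f(s)=\begin{cases}f_1(s), & 0\le s\le\alpha_*+\epsilon,\\ L(s), & \alpha_*+\epsilon\le s\le\alpha_*+2\epsilon,\\ A^2f_2(s), & s\ge\alpha_*+2\epsilon,\end{cases}$$ (extended oddly) has at least three ground state solutions.
   Context: $L$ denotes the affine function whose graph is the segment from $(\alpha_*+\epsilon,f_1(\alpha_*+\epsilon))$ to $(\alpha_*+2\epsilon,A^2f_2(\alpha_*+2\epsilon))$. A ground state is a nonnegative, nontrivial solution (compactly supported ones allowed). Hypotheses: $(H_1)$ $f_1\in C[0,\infty)\cap C^1(0,\infty)$, $f_1(0)=0$, there is $b\ge0$ with $f_1(s)>0$ for $s>b$, $f_1(s)\le0$ on $[0,b]$, and $f_1<0$ on $(0,\epsilon_0)$ for some $\epsilon_0>0$; with $F_1(s)=\int_0^sf_1$, there is a unique finite $\beta\ge b$ with $F_1(\beta)=0$. $(H_2)$ $(F_1/f_1)'(s)>(N-2)/(2N)$ for all $s>\beta$. $(H_3)$ $f_1(s)/(s-b)$ is increasing for $s>b$. $(H_4)$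 the solution of $u''+\frac{N-1}{r}u'+f_1(u)=0$, $u(0)=\alpha_*$, $u'(0)=0$ is a ground state. $(H_5)$ $f_2$ is a positive continuous function on $[\alpha_*,\gamma)$. Condition (GST) (with $\gamma=\infty$): with $F(s)=\int_0^sf$ and $Q(s)=2NF(s)-(N-2)sf(s)$, $Q$ is bounded below near $s=0$, and there exist $\bar b>\beta$ and $\theta\in(0,1)$ such that $Q(s)>0$ for all $s>\bar b$ and $\limsup_{s\to\infty}\inf_{s_1,s_2\in[\theta s,s]}Q(s_2)\bigl(s/f(s_1)\bigr)^{N/2}=\infty$. *)

(* Defs.v *)
From Stdlib Require Import Reals Lra.
From Coquelicot Require Import Coquelicot.
Open Scope R_scope.

Definition cont_on_ge (a : R) (g : R -> R) : Prop :=
  forall s, a <= s -> filterlim g (within (fun t => a <= t) (locally s)) (locally (g s)).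

Definition C1_pos (g : R -> R) : Prop :=
  forall s, 0 < s -> ex_derive g s /\ continuous (Derive g) s.

Definition prim (g : R -> R) (s : R) : R := RInt g 0 s.

Definition radial_sol (N : nat) (f : R -> R) (alpha : R) (u : R -> R) : Prop :=
  u 0 = alpha /\
  (forall r, 0 < r ->
     ex_derive u r /\ ex_derive (Derive u) r /\
     Derive (Derive u) r + (INR N - 1) / r * Derive u r + f (u r) = 0) /\
  filterlim u (at_right 0) (locally (u 0)) /\
  filterlim (Derive u) (at_right 0) (locally 0).

(* Radial ground state: nonnegative, nontrivial radial solution tending to 0
   at infinity (compactly supported ones allowed). *)
Definition ground_state (N : nat) (f : R -> R) (u : R -> R) : Prop :=
  radial_sol N f (u 0) u /\
  (forall r, 0 <= r -> 0 <= u r) /\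
  (exists r, 0 <= r /\ u r <> 0) /\
  filterlim u (Rbar_locally p_infty) (locally 0).

Definition distinct_prof (u v : R -> R) : Prop := exists r, 0 <= r /\ u r <> v r.

Definition at_least_three_GS (N : nat) (f : R -> R) : Prop :=
  exists u1 u2 u3,
    ground_state N f u1 /\ ground_state N f u2 /\ ground_state N f u3 /\
    distinct_prof u1 u2 /\ distinct_prof u1 u3 /\ distinct_prof u2 u3.

Definition H1 (f1 : R -> R) (b beta : R) : Prop :=
  cont_on_ge 0 f1 /\ C1_pos f1 /\ f1 0 = 0 /\ 0 <= b /\
  (forall s, b < s -> 0 < f1 s) /\
  (forall s, 0 <= s <= b -> f1 s <= 0) /\
  (exists eps0, 0 < eps0 /\ forall s, 0 < s < eps0 -> f1 s < 0) /\
  (b <= beta /\ prim f1 beta = 0 /\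
   forall beta', b <= beta' -> prim f1 beta' = 0 -> beta' = beta).

Definition H2 (N : nat) (f1 : R -> R) (beta : R) : Prop :=
  forall s, beta < s ->
    ex_derive (fun t => prim f1 t / f1 t) s /\
    Derive (fun t => prim f1 t / f1 t) s > (INR N - 2) / (2 * INR N).

Definition H3 (f1 : R -> R) (b : R) : Prop :=
  forall s t, b < s -> s < t -> f1 s / (s - b) < f1 t / (t - b).

Definition H4 (N : nat) (f1 : R -> R) (alpha : R) : Prop :=
  exists u, radial_sol N f1 alpha u /\ ground_state N f1 u.

Definition H5 (f2 : R -> R) (alpha : R) : Prop :=
  cont_on_ge alpha f2 /\ forall s, alpha <= s -> 0 < f2 s.

Definition f_pos (f1 f2 : R -> R) (alpha eps A s : R) : R :=
  let a := alpha + eps in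
  if Rle_dec s a then f1 s
  else if Rle_dec s (alpha + 2 * eps) then
    f1 a + (s - a) / eps * (A ^ 2 * f2 (alpha + 2 * eps) - f1 a)
  else A ^ 2 * f2 s.

Definition f_odd (f1 f2 : R -> R) (alpha eps A s : R) : R :=
  if Rle_dec 0 s then f_pos f1 f2 alpha eps A s
  else - f_pos f1 f2 alpha eps A (- s).

Definition Qfun (N : nat) (f : R -> R) (s : R) : R :=
  2 * INR N * prim f s - (INR N - 2) * s * f s.

Definition GST (N : nat) (f : R -> R) (beta : R) : Prop :=
  (exists delta M, 0 < delta /\ forall s, 0 <= s < delta -> M <= Qfun N f s) /\
  exists bbar theta, beta < bbar /\ 0 < theta < 1 /\
    (forall s, bbar < s -> 0 < Qfun N f s) /\
    (forall M S, exists s, S < s /\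
       forall s1 s2, theta * s <= s1 <= s -> theta * s <= s2 <= s ->
         M <= Qfun N f s2 * Rpower (s / f s1) (INR N / 2)).

(* Main.v *)
(**
  Write [n = N - 1] and [E = u'^2/2 + F(u)].  A radial trajectory started above [beta] decreases until it
  turns ([E < 0] while [u > 0]) or crosses zero (with [E > 0]); these events are open and exclude each
  other, and a trajectory doing neither is, cut off at its first zero, a ground state.  Besides the ground
  state started at [alpha], it suffices to find heights [alpha + eps/2 < alpha + D < alpha2] from which
  all solutions cross, turn, cross: each gap then contains a ground state.

  Two solutions are compared at equal heights, with [rho] the radius and [w = |u'|]: by
  [(F/f)' > (N-2)/(2N)], the Erbe-Tang functionals [T = rho (w + 2 F / w)] above [beta] and
  [W = rho sqrt (w^2 + 2 F)] below [beta] show that a solution which is once steeper with larger [T] stays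
  steeper, and that its [W] stays away from [0], which forces a crossing.  Compared with the ground state,
  a solution from [alpha + eps/2] thus crosses.  A solution from [alpha + D], with [A] large, spends
  a radius of order [1/A] above [alpha] and continues almost like a solution of the [f1]-problem started
  slightly below [alpha]; if it did not turn, the comparison would make the ground state cross.  At
  [alpha2], condition (GST) makes the Pohozaev integral so large that energy is left when [u = 0].

  As [f2] is only continuous, initial value problems may have several solutions; shooting is done
  with Tonelli's delayed approximations, which depend continuously on the height, and ground states
  are obtained as limits along an ultrafilter.
*)
Require Import Defs.
From Stdlib Require Import Reals Lra Lia Psatz Classical ClassicalEpsilon.
From Coquelicot Require Import Coquelicot.
From mathcomp.classical Require filter.
Open Scope R_scope.

(** * Calculus on the line *)

(** Every comparison starts in the same way. Near a center the speed tends to [0] and [T] to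
    [2N F/f], whereas the Erbe-Tang inequality gives [T > 2N F/f] away from the center. So, of two
    solutions at a common height, one very close to its center is the slower one and has the smaller
    [T]. The ground state plays this role against the solution from [alpha + eps/2]; against the
    solution from [alpha + D] the roles are exchanged.

    The layer above [alpha] acts on the outside as a point source of flux. The descent it causes is
    proportional to [D]: small against [alpha - beta], yet bounded below independently of [eps] and
    [A]. The slope it leaves at a fixed radius vanishes as [A] grows because its flux is of order
    [ra^(n-1)], with [ra] of order [1/A] and [n >= 2]; here [N > 2] enters. Hence [D] and the
    comparison margins are fixed first, then the bounds on [eps] and [A], and [alpha2] only after
    [eps] and [A]. *)

Lemma c_plus (f g : R -> R) x :
  continuous f x -> continuous g x -> continuous (fun t => f t + g t) x.
Proof. exact (@continuous_plus _ _ _ f g x). Qed.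

Lemma c_minus (f g : R -> R) x :
  continuous f x -> continuous g x -> continuous (fun t => f t - g t) x.
Proof. exact (@continuous_minus _ _ _ f g x). Qed.

Lemma c_opp (f : R -> R) x : continuous f x -> continuous (fun t => - f t) x.
Proof. exact (@continuous_opp _ _ _ f x). Qed.

Lemma c_mult (f g : R -> R) x :
  continuous f x -> continuous g x -> continuous (fun t => f t * g t) x.
Proof. exact (@continuous_mult _ _ f g x). Qed.

Lemma c_const (a x : R) : continuous (fun _ : R => a) x.
Proof. apply continuous_const. Qed.

Lemma c_id (x : R) : continuous (fun t : R => t) x.
Proof. apply continuous_id. Qed.

Lemma c_inv (f : R -> R) x :
  continuous f x -> f x <> 0 -> continuous (fun t => / f t) x.
Proof. intros H H0. now apply continuous_Rinv_comp. Qed.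

Lemma c_div (f g : R -> R) x :
  continuous f x -> continuous g x -> g x <> 0 -> continuous (fun t => f t / g t) x.
Proof. intros Hf Hg H0. apply c_mult; [exact Hf | now apply c_inv]. Qed.

Lemma c_pow (f : R -> R) k x : continuous f x -> continuous (fun t => f t ^ k) x.
Proof.
intros H. induction k as [ | k IH]; simpl; [apply c_const | now apply c_mult].
Qed.

Lemma c_comp (f u : R -> R) x :
  continuous f (u x) -> continuous u x -> continuous (fun t => f (u t)) x.
Proof. intros Hf Hu. now apply (continuous_comp u f). Qed.

Lemma c_sqrt (f : R -> R) x : continuous f x -> continuous (fun t => sqrt (f t)) x.
Proof. intros H. apply (c_comp sqrt f); [apply continuous_sqrt | exact H]. Qed.

Lemma d_c (f : R -> R) (x l : R) : is_derive f x l -> continuous f x.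
Proof. intros H. apply (@ex_derive_continuous R_AbsRing R_NormedModule). now exists l. Qed.

Lemma d_eq (f : R -> R) (x a b : R) : is_derive f x a -> a = b -> is_derive f x b.
Proof. now intros H <-. Qed.

Lemma d_plus (f g : R -> R) (x a b : R) :
  is_derive f x a -> is_derive g x b -> is_derive (fun t => f t + g t) x (a + b).
Proof. exact (@is_derive_plus _ _ f g x a b). Qed.

Lemma d_minus (f g : R -> R) (x a b : R) :
  is_derive f x a -> is_derive g x b -> is_derive (fun t => f t - g t) x (a - b).
Proof. exact (@is_derive_minus _ _ f g x a b). Qed.

Lemma d_opp (f : R -> R) (x a : R) : is_derive f x a -> is_derive (fun t => - f t) x (- a).
Proof. exact (@is_derive_opp _ _ f x a). Qed.

Lemma d_mult (f g : R -> R) (x a b : R) :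
  is_derive f x a -> is_derive g x b ->
  is_derive (fun t => f t * g t) x (a * g x + f x * b).
Proof. intros Hf Hg. apply (is_derive_mult f g x a b Hf Hg). intros; apply Rmult_comm. Qed.

Lemma d_const (a x : R) : is_derive (fun _ : R => a) x 0.
Proof. apply (@is_derive_const R_AbsRing R_NormedModule). Qed.

Lemma d_id (x : R) : is_derive (fun t : R => t) x 1.
Proof. apply (@is_derive_id R_AbsRing). Qed.

Lemma d_inv (f : R -> R) (x a : R) :
  is_derive f x a -> f x <> 0 -> is_derive (fun t => / f t) x (- a / f x ^ 2).
Proof. intros H H0. exact (is_derive_inv f x a H H0). Qed.

Lemma d_div (f g : R -> R) (x a b : R) :
  is_derive f x a -> is_derive g x b -> g x <> 0 ->
  is_derive (fun t => f t / g t) x ((a * g x - f x * b) / g x ^ 2).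
Proof.
intros Hf Hg H0. eapply d_eq; [apply (d_mult f (fun t => / g t)); [exact Hf | exact (d_inv g x b Hg H0)] | ].
now field.
Qed.

Lemma d_pow (f : R -> R) k (x a : R) :
  is_derive f x a -> is_derive (fun t => f t ^ k) x (INR k * a * f x ^ pred k).
Proof. intros H. exact (is_derive_pow f k x a H). Qed.

Lemma d_comp (f u : R -> R) (x a b : R) :
  is_derive f (u x) a -> is_derive u x b -> is_derive (fun t => f (u t)) x (a * b).
Proof.
intros Hf Hu. eapply d_eq; [exact (is_derive_comp f u x a b Hf Hu) | ].
apply Rmult_comm.
Qed.

Lemma d_sqrt (f : R -> R) (x a : R) :
  is_derive f x a -> 0 < f x -> is_derive (fun t => sqrt (f t)) x (a / (2 * sqrt (f x))).
Proof.
intros H H0. eapply d_eq; [apply (d_comp sqrt f); [ | exact H] | ].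
- apply is_derive_Reals, derivable_pt_lim_sqrt, H0.
- field. apply Rgt_not_eq, sqrt_lt_R0, H0.
Qed.

Lemma d_scal_id (a x : R) : is_derive (Rmult a) x a.
Proof. eapply d_eq; [apply (d_mult (fun _ => a) (fun t => t)); [apply d_const | apply d_id] | ]. ring. Qed.

Lemma c_scal_id (a x : R) : continuous (Rmult a) x.
Proof. eapply d_c, d_scal_id. Qed.

(** * Tactics for continuity, derivatives and signs *)

Ltac cont :=
  lazymatch goal with
  | |- continuous (fun _ => ?a) _ => apply c_const
  | |- continuous (fun t => t) _ => apply c_id
  | |- continuous (Rmult _) _ => apply c_scal_id
  | |- continuous (fun t => _ + _) _ => apply c_plus; cont
  | |- continuous (fun t => _ - _) _ => apply c_minus; cont
  | |- continuous (fun t => - _) _ => apply c_opp; cont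
  | |- continuous (fun t => _ * _) _ => apply c_mult; cont
  | |- continuous (fun t => _ / _) _ => apply c_div; [cont | cont | ]
  | |- continuous (fun t => / _) _ => apply c_inv; [cont | ]
  | |- continuous (fun t => _ ^ _) _ => apply c_pow; cont
  | |- continuous (fun t => sqrt _) _ => apply c_sqrt; cont
  | _ => try (solve [eauto 4])
  end.

Ltac deriv :=
  first [ eassumption |
  lazymatch goal with
  | |- is_derive (fun _ => ?a) _ _ => apply d_const
  | |- is_derive (fun t => t) _ _ => apply d_id
  | |- is_derive (Rmult _) _ _ => apply d_scal_id
  | |- is_derive (fun t => _ + _) _ _ => eapply d_plus; deriv
  | |- is_derive (fun t => _ - _) _ _ => eapply d_minus; deriv
  | |- is_derive (fun t => - _) _ _ => eapply d_opp; deriv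
  | |- is_derive (fun t => _ * _) _ _ => eapply d_mult; deriv
  | |- is_derive (fun t => _ / _) _ _ => eapply d_div; [deriv | deriv | ]
  | |- is_derive (fun t => _ ^ _) _ _ => eapply d_pow; deriv
  | |- is_derive (fun t => sqrt _) _ _ => eapply d_sqrt; [deriv | ]
  | _ => idtac
  end ].

Ltac pos :=
  first [ lra | assumption |
  lazymatch goal with
  | |- 0 < _ / _ => apply Rdiv_lt_0_compat; pos
  | |- 0 < / _ => apply Rinv_0_lt_compat; pos
  | |- 0 < _ * _ => apply Rmult_lt_0_compat; pos
  | |- 0 < _ ^ _ => apply pow_lt; pos
  | |- 0 < sqrt _ => apply sqrt_lt_R0; pos
  | |- 0 < Rmin _ _ => apply Rmin_glb_lt; pos
  | |- 0 < Rpower _ _ => apply exp_pos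
  | |- 0 < INR _ => apply lt_0_INR; lia
  | |- 0 <= INR _ => apply pos_INR
  | |- 0 <= Rabs _ => apply Rabs_pos
  | |- 0 <= _ ^ 2 => apply pow2_ge_0
  | |- 0 <= _ ^ _ => apply pow_le; pos
  | |- 0 <= / _ => left; pos
  | |- 0 <= _ / _ => apply Rmult_le_pos; pos
  | |- 0 <= _ * _ => apply Rmult_le_pos; pos
  | |- 0 < ?x => is_var x; unfold x; pos
  | |- 0 <= ?x => is_var x; unfold x; pos
  end | nra ].

(* The derivative is only prescribed on the open interval, so that functions which are merely
   continuous at the endpoints are covered. *)
Lemma mvt_open (f df : R -> R) a b :
  a < b -> (forall x, a < x < b -> is_derive f x (df x)) ->
  (forall x, a <= x <= b -> continuous f x) ->
  exists c, a < c < b /\ f b - f a = df c * (b - a).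
Proof.
intros Hab Hd Hc.
assert (D : forall x, a < x < b -> derivable_pt f x).
{ intros x Hx. exists (df x). now apply is_derive_Reals, Hd. }
destruct (MVT f id a b D (fun x _ => derivable_pt_id x) Hab) as [c [Hx H]].
- intros x Hx. now apply continuity_pt_filterlim, Hc.
- intros x _. apply derivable_continuous_pt, derivable_pt_id.
- exists c. split; [exact Hx | ]. rewrite derive_pt_id in H. unfold id in H.
  assert (E : derive_pt f c (D c Hx) = df c) by (apply derive_pt_eq, is_derive_Reals, Hd, Hx).
  rewrite E in H. lra.
Qed.

Lemma deriv_nonneg_le (f df : R -> R) a b :
  a <= b -> (forall x, a < x < b -> is_derive f x (df x)) ->
  (forall x, a <= x <= b -> continuous f x) ->
  (forall x, a < x < b -> 0 <= df x) -> f a <= f b.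
Proof.
intros [Hab | ->] Hd Hc Hp; [ | lra].
destruct (mvt_open f df a b Hab Hd Hc) as [c [Hx H]]. specialize (Hp c Hx). nra.
Qed.

Lemma deriv_pos_lt (f df : R -> R) a b :
  a < b -> (forall x, a < x < b -> is_derive f x (df x)) ->
  (forall x, a <= x <= b -> continuous f x) ->
  (forall x, a < x < b -> 0 < df x) -> f a < f b.
Proof.
intros Hab Hd Hc Hp.
destruct (mvt_open f df a b Hab Hd Hc) as [c [Hx H]]. specialize (Hp c Hx). nra.
Qed.

Lemma continuous_pos_near (f : R -> R) x :
  continuous f x -> 0 < f x -> exists d, 0 < d /\ forall y, Rabs (y - x) < d -> 0 < f y.
Proof.
intros Hc Hp.
destruct (proj1 (filterlim_locally f (f x)) Hc (mkposreal _ Hp)) as [d Hd].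
exists d. split; [apply cond_pos | ]. intros y Hy.
specialize (Hd y Hy). change (Rabs (f y - f x) < f x) in Hd.
apply Rabs_lt_between in Hd. lra.
Qed.

Lemma div_mult a b : b <> 0 -> a / b * b = a.
Proof. intros H. now field. Qed.

(** The recurring choice of a small parameter under up to three linear constraints; an idle slot is
    filled with coefficient [0] and bound [1]. *)
Lemma exists_small c1 c2 c3 {e1 e2 e3} :
  0 < e1 -> 0 < e2 -> 0 < e3 -> exists x, 0 < x /\ c1 * x < e1 /\ c2 * x < e2 /\ c3 * x < e3.
Proof.
assert (H : forall c e x, 0 < e -> 0 < x -> 2 * x <= e / (Rabs c + 1) -> c * x < e).
{ intros c e x He Hx H. assert (0 <= Rabs c) by apply Rabs_pos.
  apply (Rmult_le_compat_r (Rabs c + 1)) in H; [ | lra].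
  replace (e / (Rabs c + 1) * (Rabs c + 1)) with e in H by (field; lra).
  generalize (Rle_abs c). nra. }
intros H1 H2 H3.
assert (P : forall c e, 0 < e -> 0 < e / (Rabs c + 1)).
{ intros c e He. assert (0 <= Rabs c) by apply Rabs_pos. pos. }
set (m := Rmin (e1 / (Rabs c1 + 1)) (Rmin (e2 / (Rabs c2 + 1)) (e3 / (Rabs c3 + 1)))).
assert (Hm : 0 < m) by (repeat apply Rmin_glb_lt; now apply P).
assert (m <= e1 / (Rabs c1 + 1)) by apply Rmin_l.
assert (m <= e2 / (Rabs c2 + 1)) by (eapply Rle_trans; [apply Rmin_r | apply Rmin_l]).
assert (m <= e3 / (Rabs c3 + 1)) by (eapply Rle_trans; [apply Rmin_r | apply Rmin_r]).
exists (m / 2). repeat split; [lra | apply H | apply H | apply H]; lra.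
Qed.

Lemma near_intro (x d : R) (P : R -> Prop) :
  0 < d -> (forall y, x - d < y < x + d -> P y) -> locally x P.
Proof.
intros Hd H. exists (mkposreal d Hd). intros y Hy. change (Rabs (y - x) < d) in Hy.
apply Rabs_def2 in Hy. apply H. lra.
Qed.

(** The supremum of the initial segments on which [Q] holds: if [Q] held near it before [b], the
    segment could be prolonged. It serves both for first zeros and for the connectedness of an
    interval. *)
Lemma prefix_sup (Q : R -> Prop) a b :
  a <= b -> Q a -> exists c, a <= c <= b /\ (forall x, a <= x < c -> Q x) /\ (locally c Q -> c = b).
Proof.
intros Hab Qa.
assert (Ha : a <= a <= b /\ forall y, a <= y <= a -> Q y).
{ split; [lra | ]. intros y Hy. now replace y with a by lra. }
destruct (completeness (fun x => a <= x <= b /\ forall y, a <= y <= x -> Q y)) as [c [Hub Hlub]].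
- exists b. intros x [Hx _]. lra.
- now exists a.
- assert (Hac : a <= c) by now apply Hub.
  assert (Hcb : c <= b) by (apply Hlub; intros x [Hx _]; lra).
  assert (Hbelow : forall x, a <= x < c -> Q x).
  { intros x Hx. apply NNPP. intros Hn. assert (c <= x); [ | lra]. apply Hlub. intros z [Hz Hz2].
    apply Rnot_lt_le. intros Hzx. apply Hn, Hz2. lra. }
  exists c. split; [lra | split; [exact Hbelow | ]]. intros [d Hd].
  apply NNPP. intros Hne. assert (H : 0 < b - c) by lra.
  destruct (exists_small 1 1 0 (cond_pos d) H Rlt_0_1) as [z [Hz [Hz1 [Hz2 _]]]].
  assert (c + z <= c); [ | lra]. apply Hub. split; [lra | ]. intros y Hy.
  destruct (Rlt_le_dec y c) as [Hyc | Hyc]; [apply Hbelow; lra | ].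
  apply Hd. change (Rabs (y - c) < d). rewrite Rabs_pos_eq; lra.
Qed.

Lemma first_zero (f : R -> R) a b :
  a <= b -> (forall x, a <= x <= b -> continuous f x) -> 0 < f a -> f b <= 0 ->
  exists c, a < c <= b /\ f c = 0 /\ forall x, a <= x < c -> 0 < f x.
Proof.
intros Hab Hc Ha Hb.
destruct (prefix_sup (fun x => 0 < f x) a b Hab Ha) as [c [Hcab [Hbelow Hloc]]].
assert (Hle : f c <= 0).
{ apply Rnot_lt_le. intros Hp.
  destruct (continuous_pos_near f c (Hc c Hcab) Hp) as [d [Hd Hd2]].
  assert (c = b) by (apply Hloc; exists (mkposreal d Hd); exact Hd2). subst. lra. }
assert (Hlt : a < c) by (destruct Hcab as [[H | H] _]; [exact H | subst; lra]).
exists c. split; [lra | split; [ | exact Hbelow]].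
apply Rle_antisym; [exact Hle | ]. apply Rnot_lt_le. intros Hneg.
destruct (continuous_pos_near (fun t => - f t) c) as [d [Hd Hd2]]; [apply c_opp, Hc; lra | lra | ].
destruct (exists_small 1 1 0 Hd (Rlt_Rminus _ _ Hlt) Rlt_0_1) as [z [Hz [Hz1 [Hz2 _]]]].
assert (0 < - f (c - z)) by (apply Hd2; rewrite Rabs_left; lra).
specialize (Hbelow (c - z)). lra.
Qed.

Lemma last_zero (f : R -> R) a b :
  a <= b -> (forall x, a <= x <= b -> continuous f x) -> f a <= 0 -> 0 < f b ->
  exists c, a <= c < b /\ f c = 0 /\ forall x, c < x <= b -> 0 < f x.
Proof.
intros Hab Hc Ha Hb.
destruct (first_zero (fun x => f (- x)) (- b) (- a)) as [c [Hc1 [Hc2 Hc3]]].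
- lra.
- intros x Hx. apply (c_comp f (fun t => - t)); [apply Hc; lra | cont].
- now rewrite Ropp_involutive.
- now rewrite Ropp_involutive.
- exists (- c). split; [lra | split; [exact Hc2 | ]].
  intros x Hx. rewrite <- (Ropp_involutive x). apply Hc3. lra.
Qed.

Lemma ivt_decr (f : R -> R) a b y :
  a <= b -> (forall x, a <= x <= b -> continuous f x) -> f b <= y < f a ->
  exists c, a < c <= b /\ f c = y.
Proof.
intros Hab Hc Hy.
destruct (first_zero (fun x => f x - y) a b) as [c [H1 [H2 _]]]; try lra.
- intros x Hx. cont.
- exists c. split; [exact H1 | lra].
Qed.

Lemma compact_min (f : R -> R) a b :
  a <= b -> (forall x, a <= x <= b -> continuous f x) ->
  exists m, a <= m <= b /\ forall x, a <= x <= b -> f m <= f x.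
Proof.
intros Hab Hc. destruct (continuity_ab_min f a b Hab) as [m [H1 H2]].
- intros c Hc'. now apply continuity_pt_filterlim, Hc.
- exists m. auto.
Qed.

Lemma compact_max (f : R -> R) a b :
  a <= b -> (forall x, a <= x <= b -> continuous f x) ->
  exists m, a <= m <= b /\ forall x, a <= x <= b -> f x <= f m.
Proof.
intros Hab Hc. destruct (continuity_ab_maj f a b Hab) as [m [H1 H2]].
- intros c Hc'. now apply continuity_pt_filterlim, Hc.
- exists m. auto.
Qed.

Lemma compact_pos_min (f : R -> R) a b :
  (forall x, a <= x <= b -> continuous f x) -> (forall x, a <= x <= b -> 0 < f x) ->
  exists m, 0 < m /\ forall x, a <= x <= b -> m <= f x.
Proof.
intros Hc Hp. destruct (Rle_lt_dec a b) as [Hab | Hab].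
- destruct (compact_min f a b Hab Hc) as [m [H1 H2]]. exists (f m). auto.
- exists 1. split; [lra | ]. intros x Hx. lra.
Qed.

Lemma compact_bound (f : R -> R) a b :
  a <= b -> (forall x, a <= x <= b -> continuous f x) ->
  exists M, 0 <= M /\ forall x, a <= x <= b -> Rabs (f x) <= M.
Proof.
intros Hab Hc. destruct (compact_max (fun x => Rabs (f x)) a b Hab) as [m [_ Hm]].
- intros x Hx. apply (c_comp Rabs); [apply continuous_Rabs | now apply Hc].
- exists (Rabs (f m)). split; [apply Rabs_pos | exact Hm].
Qed.

(** * Energy and flux along radial trajectories *)

(** Zero on the negative axis in place of the odd extension: ground states never go there, and a
    cut-off from above then suffices to make [g] bounded and uniformly continuous. *)
Record nonlin (g : R -> R) (b beta : R) : Prop := {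
  nl_cont : forall s, continuous g s;
  nl_neg : forall s, s <= 0 -> g s = 0;
  nl_b : 0 < b;
  nl_bbeta : b < beta;
  nl_pos : forall s, b < s -> 0 < g s;
  nl_beta : prim g beta = 0;
  nl_below : forall s, 0 < s < beta -> prim g s < 0 }.

(* [n] stands for [N - 1]; the profile is extended by its initial data to [r <= 0]. *)
Record sol (n : nat) (g : R -> R) (alpha : R) (u v : R -> R) : Prop := {
  sol_u0 : forall r, r <= 0 -> u r = alpha;
  sol_v0 : forall r, r <= 0 -> v r = 0;
  sol_uc : forall r, continuous u r;
  sol_vc : forall r, continuous v r;
  sol_du : forall r, 0 < r -> is_derive u r (v r);
  sol_dv : forall r, 0 < r -> is_derive v r (- (INR n / r * v r) - g (u r)) }.

Arguments nl_cont {g b beta}.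
Arguments nl_neg {g b beta}.
Arguments nl_b {g b beta}.
Arguments nl_bbeta {g b beta}.
Arguments nl_pos {g b beta}.
Arguments nl_beta {g b beta}.
Arguments nl_below {g b beta}.
Arguments sol_u0 {n g alpha u v}.
Arguments sol_v0 {n g alpha u v}.
Arguments sol_uc {n g alpha u v}.
Arguments sol_vc {n g alpha u v}.
Arguments sol_du {n g alpha u v}.
Arguments sol_dv {n g alpha u v}.

Definition energy (g u v : R -> R) (r : R) : R := v r ^ 2 / 2 + prim g (u r).

(** For a start above [beta], [u] decreases strictly as long as this holds ([alive_v]), so the
    height can serve as the independent variable. *)
Definition alive (g u v : R -> R) (r : R) : Prop :=
  0 <= r /\ forall t, 0 <= t <= r -> 0 < u t /\ 0 < energy g u v t.

Definition turns (g u v : R -> R) : Prop :=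
  exists r, 0 <= r /\ energy g u v r < 0 /\ forall t, 0 <= t <= r -> 0 < u t.

Definition crosses (g u v : R -> R) : Prop :=
  exists r, 0 <= r /\ u r < 0 /\ forall t, 0 <= t <= r -> 0 < energy g u v t.

Lemma d_prim (g : R -> R) (s : R) :
  (forall t, continuous g t) -> is_derive (prim g) s (g s).
Proof.
intros Hg. unfold prim. apply (is_derive_RInt g (fun s => RInt g 0 s) 0).
- exists (mkposreal 1 Rlt_0_1). intros y _. apply (@RInt_correct R_CompleteNormedModule).
  apply (@ex_RInt_continuous R_CompleteNormedModule). intros; apply Hg.
- apply Hg.
Qed.

Lemma c_prim (g : R -> R) (s : R) :
  (forall t, continuous g t) -> continuous (prim g) s.
Proof. intros Hg. eapply d_c, d_prim, Hg. Qed.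

Lemma prim_lt (g : R -> R) b beta s t :
  nonlin g b beta -> b <= s < t -> prim g s < prim g t.
Proof.
intros Hg Hst. apply (deriv_pos_lt (prim g) g); [lra | | | ].
- intros x _. apply d_prim, (nl_cont Hg).
- intros x _. apply c_prim, (nl_cont Hg).
- intros x Hx. apply (nl_pos Hg). lra.
Qed.

Lemma prim_pos (g : R -> R) b beta s : nonlin g b beta -> beta < s -> 0 < prim g s.
Proof.
intros Hg Hs. rewrite <- (nl_beta Hg). apply (prim_lt g b beta); [exact Hg | ].
generalize (nl_bbeta Hg). lra.
Qed.

Lemma prim_0 (g : R -> R) : prim g 0 = 0.
Proof. apply (@RInt_point R_CompleteNormedModule). Qed.

Lemma prim_nonpos (g : R -> R) b beta s :
  nonlin g b beta -> 0 <= s <= beta -> prim g s <= 0.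
Proof.
intros Hg Hs. destruct (Req_dec s 0) as [-> | H0]; [rewrite prim_0; lra | ].
destruct (Req_dec s beta) as [-> | H1]; [rewrite (nl_beta Hg); lra | ].
left. apply (nl_below Hg). lra.
Qed.

Lemma prim_nonneg_level (g : R -> R) b beta s :
  nonlin g b beta -> 0 < s -> 0 <= prim g s -> beta <= s.
Proof.
intros Hg Hs Hp. apply Rnot_lt_le. intros H.
generalize (nl_below Hg s (conj Hs H)). lra.
Qed.

Lemma d_flux {n g alpha u v} (r : R) :
  sol n g alpha u v -> 0 < r ->
  is_derive (fun t => t ^ n * v t) r (- (r ^ n * g (u r))).
Proof.
intros Hs Hr. eapply d_eq.
- generalize (sol_dv Hs r Hr). intros Hv. deriv.
- destruct n as [ | n]; [simpl; field; lra | ].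
  rewrite S_INR. simpl pow. simpl pred. cbv beta. field. lra.
Qed.

(** The sign [c], taken as [1] or [-1] below, gives the upper and the lower flux bound from one
    monotonicity argument. *)
Lemma flux_bound c n g alpha u v K r1 r2 :
  sol n g alpha u v -> 0 <= r1 <= r2 ->
  (forall t, r1 < t < r2 -> c * K <= c * g (u t)) ->
  c * (r2 ^ n * v r2) <= c * (r1 ^ n * v r1 - K * (r2 ^ S n - r1 ^ S n) / INR (S n)).
Proof.
intros Hs Hr HK.
assert (HN : 0 < INR (S n)) by pos.
assert (H : - c * (r1 ^ n * v r1) - c * K * r1 ^ S n / INR (S n)
            <= - c * (r2 ^ n * v r2) - c * K * r2 ^ S n / INR (S n)); [ | unfold Rdiv in *; nra].
apply (deriv_nonneg_le (fun t => - c * (t ^ n * v t) - c * K * t ^ S n / INR (S n))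
        (fun t => t ^ n * (c * g (u t) - c * K))); [lra | | | ].
- intros x Hx. generalize (d_flux x Hs ltac:(lra)). intros Hf.
  eapply d_eq; [deriv; lra | ]. simpl pred. cbv beta. field. lra.
- intros x Hx. cont; try lra. apply (sol_vc Hs).
- intros x Hx. generalize (HK x Hx). intros. pos.
Qed.

Lemma flux_upper {n g alpha u v} K r1 r2 :
  sol n g alpha u v -> 0 <= r1 <= r2 ->
  (forall t, r1 < t < r2 -> K <= g (u t)) ->
  r2 ^ n * v r2 <= r1 ^ n * v r1 - K * (r2 ^ S n - r1 ^ S n) / INR (S n).
Proof.
intros Hs Hr HK. cut (1 * (r2 ^ n * v r2) <= 1 * (r1 ^ n * v r1 - K * (r2 ^ S n - r1 ^ S n) / INR (S n))); [lra | ].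
apply (flux_bound _ n g alpha u v); try assumption. intros t Ht. specialize (HK t Ht). lra.
Qed.

Lemma flux_lower {n g alpha u v} K r1 r2 :
  sol n g alpha u v -> 0 <= r1 <= r2 ->
  (forall t, r1 < t < r2 -> g (u t) <= K) ->
  r1 ^ n * v r1 - K * (r2 ^ S n - r1 ^ S n) / INR (S n) <= r2 ^ n * v r2.
Proof.
intros Hs Hr HK. cut (-1 * (r2 ^ n * v r2) <= -1 * (r1 ^ n * v r1 - K * (r2 ^ S n - r1 ^ S n) / INR (S n))); [lra | ].
apply (flux_bound _ n g alpha u v); try assumption. intros t Ht. specialize (HK t Ht). lra.
Qed.

Lemma center_flux n K r y : 0 < r -> y = 0 ->
  r ^ n * - (K * r / INR (S n)) = 0 ^ n * y - K * (r ^ S n - 0 ^ S n) / INR (S n).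
Proof.
intros Hr ->. assert (HN : 0 < INR (S n)) by pos.
rewrite (pow_i (S n)) by lia. simpl pow. field. lra.
Qed.

Lemma slope_upper {n g alpha u v} K r :
  sol n g alpha u v -> 0 < r -> (forall t, 0 < t < r -> K <= g (u t)) ->
  v r <= - (K * r / INR (S n)).
Proof.
intros Hs Hr HK. apply (Rmult_le_reg_l (r ^ n)); [pos | ].
rewrite (center_flux n K r (v 0)) by (try apply (sol_v0 Hs); lra).
apply (flux_upper _ _ _ Hs); [lra | exact HK].
Qed.

Lemma slope_lower {n g alpha u v} K r :
  sol n g alpha u v -> 0 < r -> (forall t, 0 < t < r -> g (u t) <= K) ->
  - (K * r / INR (S n)) <= v r.
Proof.
intros Hs Hr HK. apply (Rmult_le_reg_l (r ^ n)); [pos | ].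
rewrite (center_flux n K r (v 0)) by (try apply (sol_v0 Hs); lra).
apply (flux_lower _ _ _ Hs); [lra | exact HK].
Qed.

Lemma d_energy {n g alpha u v} (r : R) :
  (forall s, continuous g s) -> sol n g alpha u v -> 0 < r ->
  is_derive (energy g u v) r (- (INR n / r) * v r ^ 2).
Proof.
intros Hg Hs Hr. unfold energy. eapply d_eq.
- deriv.
  + exact (sol_dv Hs r Hr).
  + lra.
  + apply (d_comp (prim g) u); [now apply d_prim | exact (sol_du Hs r Hr)].
- simpl pred. simpl (INR 2). cbv beta. field. lra.
Qed.

Lemma c_energy {n g alpha u v} (r : R) :
  (forall s, continuous g s) -> sol n g alpha u v -> continuous (energy g u v) r.
Proof.
intros Hg Hs. unfold energy. cont.
- apply (sol_vc Hs).
- lra.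
- apply (c_comp (prim g) u); [now apply c_prim | apply (sol_uc Hs)].
Qed.

Lemma energy_le {n g alpha u v} r1 r2 :
  (forall s, continuous g s) -> sol n g alpha u v -> 0 <= r1 <= r2 ->
  energy g u v r2 <= energy g u v r1.
Proof.
intros Hg Hs Hr. apply Ropp_le_cancel.
apply (deriv_nonneg_le (fun t => - energy g u v t) (fun t => INR n / t * v t ^ 2)); [lra | | | ].
- intros x Hx. eapply d_eq; [deriv; apply (d_energy _ Hg Hs); lra | ]. ring.
- intros x Hx. cont. exact (c_energy _ Hg Hs).
- intros x Hx. apply Rmult_le_pos; [ | apply pow2_ge_0].
  apply Rmult_le_pos; [apply pos_INR | ]. left. apply Rinv_0_lt_compat. lra.
Qed.

Lemma energy_lt n g alpha u v r1 r2 :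
  (0 < n)%nat -> (forall s, continuous g s) -> sol n g alpha u v -> 0 <= r1 < r2 ->
  (forall t, r1 < t < r2 -> v t < 0) -> energy g u v r2 < energy g u v r1.
Proof.
intros Hn Hg Hs Hr Hv. apply Ropp_lt_cancel.
apply (deriv_pos_lt (fun t => - energy g u v t) (fun t => INR n / t * v t ^ 2)); [lra | | | ].
- intros x Hx. eapply d_eq; [deriv; apply (d_energy _ Hg Hs); lra | ]. ring.
- intros x Hx. cont. exact (c_energy _ Hg Hs).
- intros x Hx. apply Rmult_lt_0_compat.
  + apply Rdiv_lt_0_compat; [now apply lt_0_INR | lra].
  + specialize (Hv x Hx). nra.
Qed.

Lemma energy_0 {n g alpha u v} :
  sol n g alpha u v -> energy g u v 0 = prim g alpha.
Proof.
intros Hs. unfold energy.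
rewrite (sol_u0 Hs 0), (sol_v0 Hs 0) by lra. lra.
Qed.

Lemma u_decr {n g alpha u v} r1 r2 :
  sol n g alpha u v -> 0 <= r1 < r2 -> (forall t, r1 < t < r2 -> v t < 0) -> u r2 < u r1.
Proof.
intros Hs Hr Hv. apply Ropp_lt_cancel.
apply (deriv_pos_lt (fun t => - u t) (fun t => - v t)); [lra | | | ].
- intros x Hx. deriv. apply (sol_du Hs). lra.
- intros x Hx. cont. apply (sol_uc Hs).
- intros x Hx. specialize (Hv x Hx). lra.
Qed.

Lemma u_slope {n g alpha u v} K r1 r2 :
  sol n g alpha u v -> 0 <= r1 <= r2 -> (forall t, r1 < t < r2 -> v t <= - K) ->
  u r2 <= u r1 - K * (r2 - r1).
Proof.
intros Hs Hr Hv.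
assert (H : - u r1 - K * r1 <= - u r2 - K * r2); [ | lra].
apply (deriv_nonneg_le (fun t => - u t - K * t) (fun t => - v t - K)); [lra | | | ].
- intros x Hx. eapply d_eq; [generalize (sol_du Hs x ltac:(lra)); intros Hu; deriv | ]. ring.
- intros x Hx. cont. apply (sol_uc Hs).
- intros x Hx. specialize (Hv x Hx). lra.
Qed.

Lemma u_slope_lower {n g alpha u v} K r1 r2 :
  sol n g alpha u v -> 0 <= r1 <= r2 -> (forall t, r1 < t < r2 -> - K <= v t) ->
  u r1 - K * (r2 - r1) <= u r2.
Proof.
intros Hs Hr Hv.
assert (H : u r1 + K * r1 <= u r2 + K * r2); [ | lra].
apply (deriv_nonneg_le (fun t => u t + K * t) (fun t => v t + K)); [lra | | | ].
- intros x Hx. eapply d_eq; [generalize (sol_du Hs x ltac:(lra)); intros Hu; deriv | ]. ring.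
- intros x Hx. cont. apply (sol_uc Hs).
- intros x Hx. specialize (Hv x Hx). lra.
Qed.

Lemma v_neg_start {n g b beta alpha u v} :
  nonlin g b beta -> sol n g alpha u v -> b < alpha ->
  exists d, 0 < d /\ forall t, 0 < t < d -> v t < 0.
Proof.
intros Hg Hs Ha.
destruct (continuous_pos_near (fun t => g (u t)) 0) as [d [Hd Hd2]].
- apply c_comp; [apply (nl_cont Hg) | apply (sol_uc Hs)].
- rewrite (sol_u0 Hs 0) by lra. now apply (nl_pos Hg).
- exists d. split; [exact Hd | ]. intros t Ht.
  destruct (compact_pos_min (fun t => g (u t)) 0 t) as [m [Hm Hm2]].
  + intros x _. apply c_comp; [apply (nl_cont Hg) | apply (sol_uc Hs)].
  + intros x Hx. apply Hd2. rewrite Rminus_0_r, Rabs_pos_eq; lra.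
  + assert (v t <= - (m * t / INR (S n))).
    { apply (slope_upper _ _ Hs); [lra | ]. intros x Hx. apply Hm2. lra. }
    assert (0 < m * t / INR (S n)); [ | lra].
    apply Rdiv_lt_0_compat; [nra | apply lt_0_INR; lia].
Qed.

(* A critical point at a positive height with nonnegative energy would lie above [beta], where [g]
   is positive and the flux has a sign. *)
Lemma v_neg {n g b beta alpha u v} r :
  nonlin g b beta -> sol n g alpha u v -> beta < alpha -> 0 < r ->
  (forall t, 0 <= t <= r -> 0 < u t /\ 0 <= energy g u v t) -> v r < 0.
Proof.
intros Hg Hs Ha Hr Hal. generalize (nl_b Hg) (nl_bbeta Hg). intros Hb Hbb.
destruct (v_neg_start Hg Hs ltac:(lra)) as [d [Hd Hd2]].
destruct (Rlt_le_dec r d) as [Hrd | Hrd]; [apply Hd2; lra | ].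
apply Rnot_le_lt. intros Hv.
destruct (first_zero (fun t => - v t) (d / 2) r) as [c [Hc1 [Hc2 Hc3]]].
- lra.
- intros x Hx. cont. apply (sol_vc Hs).
- specialize (Hd2 (d / 2)). lra.
- lra.
- assert (Hneg : forall t, 0 < t < c -> v t < 0).
  { intros t Ht. destruct (Rlt_le_dec t d) as [H | H]; [apply Hd2; lra | ].
    specialize (Hc3 t). lra. }
  assert (Huc : beta <= u c).
  { apply (prim_nonneg_level g b beta); [exact Hg | apply Hal; lra | ].
    destruct (Hal c ltac:(lra)) as [_ He]. unfold energy in He.
    replace (v c) with 0 in He by lra. lra. }
  destruct (compact_pos_min (fun t => g (u t)) 0 c) as [m [Hm Hm2]].
  + intros x _. apply c_comp; [apply (nl_cont Hg) | apply (sol_uc Hs)].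
  + intros x Hx. apply (nl_pos Hg).
    destruct (Req_dec x c) as [-> | Hxc]; [lra | ].
    assert (u c < u x); [ | lra].
    apply (u_decr _ _ Hs); [lra | ]. intros t Ht. apply Hneg. lra.
  + assert (v c <= - (m * c / INR (S n))).
    { apply (slope_upper _ _ Hs); [lra | ]. intros x Hx. apply Hm2. lra. }
    assert (0 < m * c / INR (S n)); [ | lra].
    apply Rdiv_lt_0_compat; [nra | apply lt_0_INR; lia].
Qed.

Lemma alive_down {g u v r} r' : alive g u v r -> 0 <= r' <= r -> alive g u v r'.
Proof. intros [H1 H2] H. split; [lra | ]. intros t Ht. apply H2. lra. Qed.

Lemma alive_0 {n g b beta alpha u v} :
  nonlin g b beta -> sol n g alpha u v -> beta < alpha -> alive g u v 0.
Proof.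
intros Hg Hs Ha. generalize (nl_b Hg) (nl_bbeta Hg). intros Hb Hbb.
split; [lra | ]. intros t Ht. replace t with 0 by lra. split.
- rewrite (sol_u0 Hs 0); lra.
- rewrite (energy_0 Hs). now apply (prim_pos g b beta).
Qed.

Lemma alive_v {n g b beta alpha u v} r :
  nonlin g b beta -> sol n g alpha u v -> beta < alpha -> alive g u v r -> 0 < r -> v r < 0.
Proof.
intros Hg Hs Ha [_ Hal] Hr. apply (v_neg r Hg Hs Ha Hr).
intros t Ht. destruct (Hal t Ht). lra.
Qed.

Lemma alive_decr {n g b beta alpha u v} r1 r2 :
  nonlin g b beta -> sol n g alpha u v -> beta < alpha -> alive g u v r2 ->
  0 <= r1 < r2 -> u r2 < u r1.
Proof.
intros Hg Hs Ha Hal Hr. apply (u_decr r1 r2 Hs Hr). intros t Ht.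
apply (alive_v t Hg Hs Ha); [ | lra].
apply (alive_down _ Hal); lra.
Qed.

Lemma alive_open {n g b beta alpha u v} r :
  nonlin g b beta -> sol n g alpha u v -> alive g u v r ->
  exists d, 0 < d /\ forall r', 0 <= r' < r + d -> alive g u v r'.
Proof.
intros Hg Hs [Hr Hal].
destruct (Hal r ltac:(lra)) as [H1 H2].
destruct (continuous_pos_near u r (sol_uc Hs r) H1) as [d1 [Hd1 Hd1']].
destruct (continuous_pos_near (energy g u v) r (c_energy r (nl_cont Hg) Hs) H2)
  as [d2 [Hd2 Hd2']].
exists (Rmin d1 d2). split; [now apply Rmin_glb_lt | ].
intros r' Hr'. split; [lra | ]. intros t Ht.
destruct (Rle_lt_dec t r) as [Htr | Htr]; [apply Hal; lra | ].
generalize (Rmin_l d1 d2) (Rmin_r d1 d2). intros H3 H4.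
split; [apply Hd1' | apply Hd2']; rewrite Rabs_pos_eq; lra.
Qed.

(** The end of the alive interval is the first zero of the continuous function [min(u, E)]. *)
Lemma alive_end {n g b beta alpha u v} :
  nonlin g b beta -> sol n g alpha u v -> beta < alpha ->
  (forall r, 0 <= r -> alive g u v r) \/
  exists e, 0 < e /\ (forall r, 0 <= r < e -> alive g u v r) /\ 0 <= u e /\
    0 <= energy g u v e /\ (u e = 0 \/ energy g u v e = 0).
Proof.
intros Hg Hs Ha.
set (h := fun t => Rmin (u t) (energy g u v t)).
assert (Hh : forall t, continuous h t).
{ intros t. unfold h.
  assert (Hm : forall x y, Rmin x y = (x + y - Rabs (x - y)) / 2).
  { intros x y. unfold Rmin, Rabs. destruct (Rle_dec x y); destruct (Rcase_abs (x - y)); lra. }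
  apply (continuous_ext (fun t => (u t + energy g u v t - Rabs (u t - energy g u v t)) / 2)).
  { intros x. now rewrite Hm. }
  assert (continuous (energy g u v) t) by (exact (c_energy _ (nl_cont Hg) Hs)).
  assert (continuous u t) by apply (sol_uc Hs).
  cont; [ | lra].
  apply (c_comp Rabs); [apply continuous_Rabs | ]. cont. }
destruct (classic (exists r, 0 <= r /\ h r <= 0)) as [[r [Hr Hr2]] | Hn].
- right. destruct (first_zero h 0 r) as [e [He1 [He2 He3]]]; try assumption.
  + intros; apply Hh.
  + destruct (alive_0 Hg Hs Ha) as [_ H].
    destruct (H 0 ltac:(lra)). unfold h. now apply Rmin_glb_lt.
  + exists e. split; [lra | ]. unfold h in He2. split; [ | split; [ | split]].
    * intros r' Hr'. split; [lra | ]. intros t Ht. specialize (He3 t ltac:(lra)). unfold h in He3.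
      generalize (Rmin_l (u t) (energy g u v t)) (Rmin_r (u t) (energy g u v t)). lra.
    * rewrite <- He2. apply Rmin_l.
    * rewrite <- He2. apply Rmin_r.
    * unfold Rmin in He2. destruct (Rle_dec (u e) (energy g u v e)); auto.
- left. intros r Hr. split; [exact Hr | ]. intros t Ht.
  assert (0 < h t). { apply Rnot_le_lt. intros H. apply Hn. exists t. split; [lra | exact H]. }
  unfold h in *. generalize (Rmin_l (u t) (energy g u v t)) (Rmin_r (u t) (energy g u v t)). lra.
Qed.

(** A trajectory that stayed above [s] forever would keep a slope bounded away from zero and end
    below [s]: under [beta], positive energy gives [v^2 > -2F], which is bounded below on a compact
    range of heights; if it never went under [beta], [g] would be bounded below and the flux would
    make the slope grow at least linearly. *)
Lemma alive_all_levels {n g b beta alpha u v} s :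
  nonlin g b beta -> sol n g alpha u v -> beta < alpha ->
  (forall r, 0 <= r -> alive g u v r) -> 0 < s < alpha -> exists r, 0 < r /\ u r = s.
Proof.
intros Hg Hs Ha Hal Hsa. generalize (nl_b Hg) (nl_bbeta Hg). intros Hb Hbb.
assert (Hu0 := sol_u0 Hs 0 (Rle_refl 0)).
apply NNPP. intros Hno.
assert (Habove : forall r, 0 <= r -> s < u r).
{ intros r Hr. apply Rnot_le_lt. intros H. apply Hno.
  destruct (ivt_decr u 0 r s Hr) as [c [Hc1 Hc2]].
  - intros x _. apply (sol_uc Hs).
  - lra.
  - exists c. split; [lra | exact Hc2]. }
assert (Hle : forall r1 r2, 0 <= r1 <= r2 -> u r2 <= u r1).
{ intros r1 r2 [H1 [H2 | H2]]; [ | subst; lra]. left.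
  apply (alive_decr _ _ Hg Hs Ha); try assumption; [apply Hal; lra | lra]. }
assert (Hend : forall k r0, 0 < k -> 0 <= r0 -> (forall r, r0 < r -> v r <= - k) -> False).
{ intros k r0 Hk Hr0 H.
  assert (Hx : 0 < u r0 / k) by (apply Rdiv_lt_0_compat; [apply (Hal r0 Hr0); lra | exact Hk]).
  generalize (u_slope k r0 (r0 + u r0 / k) Hs ltac:(lra)). intros H1.
  assert (u (r0 + u r0 / k) <= 0).
  { replace 0 with (u r0 - k * (r0 + u r0 / k - r0)) by (field; lra).
    apply H1. intros t Ht. apply H. lra. }
  specialize (Habove (r0 + u r0 / k)). lra. }
destruct (classic (exists r1, 0 <= r1 /\ u r1 < beta)) as [[r1 [Hr1 Hr1']] | Hnb].
- destruct (compact_pos_min (fun x => - prim g x) s (u r1)) as [m [Hm Hm2]].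
  + intros x _. cont. apply c_prim, (nl_cont Hg).
  + intros x Hx. generalize (nl_below Hg x). lra.
  + apply (Hend (sqrt m) r1 (sqrt_lt_R0 _ Hm) Hr1). intros r Hr.
    assert (Hv : v r < 0) by (apply (alive_v _ Hg Hs Ha); try assumption; [apply Hal | ]; lra).
    destruct (Hal r ltac:(lra)) as [_ H]. destruct (H r ltac:(lra)) as [_ He]. unfold energy in He.
    specialize (Hm2 (u r)). simpl in Hm2.
    specialize (Hle r1 r ltac:(lra)). specialize (Habove r ltac:(lra)).
    apply Ropp_le_cancel. rewrite Ropp_involutive.
    apply Rsqr_incr_0_var; [ | lra]. rewrite Rsqr_sqrt; [unfold Rsqr; nra | lra].
- assert (Hab : forall r, 0 <= r -> beta <= u r).
  { intros r Hr. apply Rnot_lt_le. intros H. apply Hnb. eauto. }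
  destruct (compact_pos_min g beta alpha) as [m [Hm Hm2]].
  + intros x _. apply (nl_cont Hg).
  + intros x Hx. apply (nl_pos Hg). lra.
  + assert (HN : 0 < INR (S n)) by pos.
    apply (Hend (m / INR (S n)) 1); [now apply Rdiv_lt_0_compat | lra | ]. intros r Hr.
    assert (v r <= - (m * r / INR (S n))).
    { apply (slope_upper _ _ Hs); [lra | ]. intros x Hx. apply Hm2.
      split; [apply Hab; lra | ]. rewrite <- Hu0. apply Hle. lra. }
    assert (m / INR (S n) <= m * r / INR (S n)); [ | lra].
    apply Rmult_le_compat_r; [pos | nra].
Qed.

(** At height zero the energy is purely kinetic, so the arrival is transversal and [u] becomes
    negative while the energy is still positive. *)
Lemma crossing_end n g b beta alpha u v e :
  nonlin g b beta -> sol n g alpha u v -> beta < alpha -> 0 < e ->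
  (forall r, 0 <= r < e -> alive g u v r) -> u e = 0 -> 0 < energy g u v e ->
  crosses g u v.
Proof.
intros Hg Hs Ha He Hal Hu HE.
assert (Hv : v e < 0).
{ assert (v e <= 0).
  { apply Rnot_lt_le. intros Hp.
    destruct (continuous_pos_near v e (sol_vc Hs e) Hp) as [d [Hd Hd2]].
    destruct (exists_small 1 1 0 Hd He Rlt_0_1) as [z [Hz [Hz1 [Hz2 _]]]].
    specialize (Hd2 (e - z)). rewrite Rabs_left in Hd2 by lra.
    assert (v (e - z) < 0); [ | lra].
    apply (alive_v _ Hg Hs Ha); try assumption; [apply Hal | ]; lra. }
  unfold energy in HE. rewrite Hu, prim_0 in HE. nra. }
destruct (continuous_pos_near (fun t => - v t) e) as [d1 [Hd1 Hd1']];
  [cont; apply (sol_vc Hs) | lra | ].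
destruct (continuous_pos_near (energy g u v) e (c_energy e (nl_cont Hg) Hs) HE)
  as [d2 [Hd2 Hd2']].
destruct (exists_small 1 1 0 Hd1 Hd2 Rlt_0_1) as [d [Hd [Hdd1 [Hdd2 _]]]].
exists (e + d). split; [lra | split].
- rewrite <- Hu. apply (u_decr _ _ Hs); [lra | ]. intros t Ht.
  specialize (Hd1' t). rewrite Rabs_pos_eq in Hd1' by lra. lra.
- intros t Ht. destruct (Rlt_le_dec t e) as [H | H].
  + destruct (Hal t ltac:(lra)) as [_ H']. apply H'. lra.
  + apply Hd2'. rewrite Rabs_pos_eq; lra.
Qed.

(* A slope of order [1/r] is not integrable, so an energy of order [r^-2] forces a crossing. *)
Lemma crosses_of_energy {n g b beta alpha u v} delta r0 :
  nonlin g b beta -> sol n g alpha u v -> beta < alpha -> 0 < delta -> 0 < r0 ->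
  alive g u v r0 ->
  (forall r, r0 <= r -> alive g u v r -> delta <= r ^ 2 * energy g u v r) ->
  crosses g u v.
Proof.
intros Hg Hs Ha Hd Hr0 Hal0 HE. generalize (nl_b Hg) (nl_bbeta Hg). intros Hb Hbb.
destruct (alive_end Hg Hs Ha) as [Hal | [e [He [Hal [He1 [He2 He3]]]]]].
- exfalso.
  destruct (alive_all_levels beta Hg Hs Ha Hal ltac:(lra)) as [r1 [Hr1 Hur1]].
  (* Beyond [r1] the height is at most [beta], where [F <= 0], so that [v^2 >= 2E]. *)
  set (q := Rmax r0 r1).
  assert (Hq : r0 <= q /\ r1 <= q) by (split; [apply Rmax_l | apply Rmax_r]).
  assert (Hk : 0 < sqrt delta) by pos.
  assert (Hv : forall r, q <= r -> v r <= - (sqrt delta / r)).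
  { intros r Hr.
    assert (Hneg : v r < 0) by (apply (alive_v _ Hg Hs Ha); try assumption; [apply Hal | ]; lra).
    assert (Hu : u r <= beta).
    { destruct (Req_dec r r1) as [-> | Hne]; [lra | ]. rewrite <- Hur1. left.
      apply (alive_decr _ _ Hg Hs Ha); try assumption; [apply Hal | ]; lra. }
    assert (HF : prim g (u r) <= 0).
    { apply (prim_nonpos g b beta); [exact Hg | ]. destruct (Hal r ltac:(lra)) as [_ H].
      destruct (H r ltac:(lra)). lra. }
    specialize (HE r ltac:(lra) (Hal r ltac:(lra))). unfold energy in HE.
    assert (sqrt delta <= r * - v r).
    { apply Rsqr_incr_0_var; [ | nra]. rewrite Rsqr_sqrt by lra. unfold Rsqr. nra. }
    apply (Rmult_le_reg_l r); [lra | ].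
    replace (r * - (sqrt delta / r)) with (- sqrt delta) by (field; lra). lra. }
  (* The radius at which the integral of [sqrt delta / t] from [q] on equals [u q], so that [u]
     should have reached zero. *)
  set (r := q * exp (u q / sqrt delta)).
  assert (Huq : 0 < u q). { destruct (Hal q ltac:(lra)) as [_ H]. apply H. lra. }
  assert (Hexp : 1 < exp (u q / sqrt delta)).
  { rewrite <- exp_0. apply exp_increasing. now apply Rdiv_lt_0_compat. }
  assert (Hqr : q < r) by (unfold r; nra).
  assert (H : - u q - sqrt delta * ln q <= - u r - sqrt delta * ln r).
  { apply (deriv_nonneg_le (fun t => - u t - sqrt delta * ln t) (fun t => - v t - sqrt delta / t)); [lra | | | ].
    - intros x Hx. eapply d_eq.
      + generalize (sol_du Hs x ltac:(lra)) (proj2 (is_derive_Reals ln x (/ x)) (derivable_pt_lim_ln x ltac:(lra))).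
        intros H1 H2. deriv.
      + unfold Rdiv. ring.
    - intros x Hx. cont; [apply (sol_uc Hs) | ].
      apply (d_c ln x (/ x)), is_derive_Reals, derivable_pt_lim_ln. lra.
    - intros x Hx. specialize (Hv x ltac:(lra)). lra. }
  assert (Hln : ln r = ln q + u q / sqrt delta).
  { unfold r. rewrite ln_mult, ln_exp; [reflexivity | lra | lra]. }
  assert (Hur : 0 < u r). { destruct (Hal r ltac:(lra)) as [_ H']. apply H'. lra. }
  rewrite Hln in H. replace (sqrt delta * (ln q + u q / sqrt delta)) with (sqrt delta * ln q + u q) in H by (field; lra).
  lra.
- assert (Hre : r0 < e).
  { apply Rnot_le_lt. intros H. destruct Hal0 as [_ Hal0]. destruct (Hal0 e ltac:(lra)). lra. }
  assert (Hpos : 0 < energy g u v e).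
  { apply Rnot_le_lt. intros Hn.
    destruct (continuous_pos_near (fun t => delta - t ^ 2 * energy g u v t) e) as [d [Hd1 Hd2]].
    - cont. exact (c_energy _ (nl_cont Hg) Hs).
    - replace (energy g u v e) with 0 by lra. lra.
    - destruct (exists_small 1 1 0 Hd1 (Rlt_Rminus _ _ Hre) Rlt_0_1) as [z [Hz [Hz1 [Hz2 _]]]].
      specialize (Hd2 (e - z)). rewrite Rabs_left in Hd2 by lra.
      specialize (HE (e - z) ltac:(lra) (Hal (e - z) ltac:(lra))). lra. }
  apply (crossing_end n g b beta alpha u v e); try assumption. lra.
Qed.

(** If the energy vanished first, at a positive height, the slope there would be negative;
    dissipation would then make the energy negative just afterwards, which is a turn. *)
Lemma not_turns_end {n g b beta alpha u v} :
  (0 < n)%nat -> nonlin g b beta -> sol n g alpha u v -> beta < alpha -> ~ turns g u v ->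
  (forall r, 0 <= r -> alive g u v r) \/
  exists e, 0 < e /\ (forall r, 0 <= r < e -> alive g u v r) /\ u e = 0 /\ 0 <= energy g u v e.
Proof.
intros Hn Hg Hs Ha Hnt.
destruct (alive_end Hg Hs Ha) as [Hal | [e [He [Hal [He1 [He2 He3]]]]]]; [now left | right].
exists e. split; [exact He | split; [exact Hal | split; [ | exact He2]]].
apply NNPP. intros Hu. assert (HE : energy g u v e = 0) by (destruct He3; [contradiction | assumption]).
assert (Hue : 0 < u e) by lra.
assert (Hpos : forall t, 0 <= t <= e -> 0 < u t).
{ intros t Ht. destruct (Req_dec t e) as [-> | H]; [exact Hue | ].
  destruct (Hal t ltac:(lra)) as [_ H']. apply H'. lra. }
assert (Hv : v e < 0).
{ apply (v_neg e Hg Hs Ha He). intros t Ht. split; [now apply Hpos | ].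
  rewrite <- HE. apply (energy_le _ _ (nl_cont Hg) Hs); lra. }
destruct (continuous_pos_near (fun t => - v t) e) as [d1 [Hd1 Hd1']];
  [cont; apply (sol_vc Hs) | lra | ].
destruct (continuous_pos_near u e (sol_uc Hs e) Hue) as [d2 [Hd2 Hd2']].
destruct (exists_small 1 1 0 Hd1 Hd2 Rlt_0_1) as [d [Hd [Hdd1 [Hdd2 _]]]].
apply Hnt. exists (e + d). split; [lra | split].
- rewrite <- HE. apply (energy_lt n g alpha); [exact Hn | apply (nl_cont Hg) | exact Hs | lra | ].
  intros t Ht. specialize (Hd1' t). rewrite Rabs_pos_eq in Hd1' by lra. lra.
- intros t Ht. destruct (Rle_lt_dec t e) as [H | H]; [apply Hpos; lra | ].
  apply Hd2'. rewrite Rabs_pos_eq; lra.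
Qed.

Lemma not_turns_levels n g b beta alpha u v s :
  (0 < n)%nat -> nonlin g b beta -> sol n g alpha u v -> beta < alpha -> ~ turns g u v ->
  0 < s < alpha -> exists r, 0 < r /\ alive g u v r /\ u r = s.
Proof.
intros Hn Hg Hs Ha Hnt Hsa.
destruct (not_turns_end Hn Hg Hs Ha Hnt) as [Hal | [e [He [Hal [Hu _]]]]].
- destruct (alive_all_levels s Hg Hs Ha Hal Hsa) as [r [Hr Hur]].
  exists r. split; [exact Hr | split; [apply Hal; lra | exact Hur]].
- destruct (ivt_decr u 0 e s) as [c [Hc1 Hc2]].
  + lra.
  + intros; apply (sol_uc Hs).
  + rewrite (sol_u0 Hs 0); lra.
  + exists c. split; [lra | split; [ | exact Hc2]]. apply Hal.
    destruct (Req_dec c e) as [-> | H]; lra.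
Qed.

(** * Comparison of two trajectories at equal heights *)

(* Inverse of [u] along the alive part of the trajectory (junk at levels not attained there). *)
Definition radius (g u v : R -> R) (s : R) : R :=
  epsilon (inhabits 0) (fun r => 0 < r /\ alive g u v r /\ u r = s).

Lemma radius_u {n g b beta alpha u v} r :
  nonlin g b beta -> sol n g alpha u v -> beta < alpha -> 0 < r -> alive g u v r ->
  radius g u v (u r) = r.
Proof.
intros Hg Hs Ha Hr Hal.
destruct (epsilon_spec (inhabits 0) (fun r' => 0 < r' /\ alive g u v r' /\ u r' = u r)) as [H1 [H2 H3]].
- exists r. auto.
- fold (radius g u v (u r)) in H1, H2, H3. set (q := radius g u v (u r)) in *.
  destruct (Rtotal_order q r) as [H | [H | H]]; [ | exact H | ].
  + generalize (alive_decr q r Hg Hs Ha Hal ltac:(lra)). lra.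
  + generalize (alive_decr r q Hg Hs Ha H2 ltac:(lra)). lra.
Qed.

Lemma d_radius {n g b beta alpha u v} r :
  nonlin g b beta -> sol n g alpha u v -> beta < alpha -> 0 < r -> alive g u v r ->
  is_derive (radius g u v) (u r) (/ v r).
Proof.
intros Hg Hs Ha Hr Hal.
assert (Hv : v r < 0) by (apply (alive_v _ Hg Hs Ha); assumption).
apply is_derive_Reals. intros eps Heps.
assert (Hev : 0 < eps * v r ^ 2) by pos.
(* The bound [2e < -v r] keeps the difference quotient of [u] at least half as steep as [v r]; then
   [4e < eps v^2] brings its inverse within [eps] of [/ v r]. *)
destruct (exists_small 2 4 0 (Ropp_0_gt_lt_contravar _ Hv) Hev Rlt_0_1) as [e [He [He1 [He2 _]]]].
destruct (proj1 (is_derive_Reals u r (v r)) (sol_du Hs r Hr) e He) as [d1 Hd1].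
destruct (alive_open r Hg Hs Hal) as [d2 [Hd2 Hd2']].
destruct (exists_small 1 1 1 (cond_pos d1) Hd2 Hr) as [d [Hd0 [Hdd1 [Hdd2 Hdr]]]].
assert (Hlo : u (r + d) < u r).
{ apply (alive_decr _ _ Hg Hs Ha); try assumption; [apply Hd2' | ]; lra. }
assert (Hhi : u r < u (r - d)).
{ apply (alive_decr _ _ Hg Hs Ha); try assumption; lra. }
set (delta := Rmin (u r - u (r + d)) (u (r - d) - u r)).
assert (Hdelta : 0 < delta) by pos.
exists (mkposreal _ Hdelta). intros h Hh0 Hh. simpl in Hh.
assert (Hh1 : - (u r - u (r + d)) < h < u (r - d) - u r).
{ generalize (Rmin_l (u r - u (r + d)) (u (r - d) - u r)) (Rmin_r (u r - u (r + d)) (u (r - d) - u r)).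
  fold delta. apply Rabs_lt_between in Hh. lra. }
destruct (ivt_decr u (r - d) (r + d) (u r + h)) as [q [Hq1 Hq2]].
- lra.
- intros; apply (sol_uc Hs).
- lra.
- assert (Hqal : alive g u v q) by (apply Hd2'; lra).
  rewrite <- Hq2. rewrite !(radius_u _ Hg Hs Ha); try assumption; try lra.
  assert (Hqr : q <> r) by (intros ->; apply Hh0; lra).
  specialize (Hd1 (q - r) ltac:(lra)).
  replace (r + (q - r)) with q in Hd1 by ring.
  assert (Habs : Rabs (q - r) < d1).
  { apply Rabs_def1; [ | ]; lra. }
  specialize (Hd1 Habs). rewrite Hq2 in Hd1. replace (u r + h - u r) with h in Hd1 by ring.
  set (w := h / (q - r)) in *.
  assert (Hw : v r - e < w < v r + e) by (apply Rabs_def2 in Hd1; lra).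
  assert (Hkh : (q - r) / h = / w) by (unfold w; field; split; lra).
  rewrite Hkh. replace (/ w - / v r) with ((v r - w) / (w * v r)) by (field; split; lra).
  unfold Rdiv. rewrite Rabs_mult.
  assert (Hprod : v r ^ 2 / 2 <= w * v r) by nra.
  assert (Hp2 : 0 < v r ^ 2) by nra.
  rewrite (Rabs_pos_eq (/ (w * v r))) by pos.
  apply (Rmult_lt_reg_r (w * v r)); [lra | ].
  rewrite Rmult_assoc, Rinv_l, Rmult_1_r by lra.
  rewrite Rabs_minus_sym. nra.
Qed.

(** The radial equation with the height as independent variable, [d] being [N - 1]. The energy bound
    [ls_E] keeps the root in [Wfun] differentiable. *)
Record level_system (d : R) (g rho w : R -> R) (c s1 : R) : Prop := {
  ls_rho : forall s, c <= s <= s1 -> 0 < rho s;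
  ls_w : forall s, c <= s <= s1 -> 0 < w s;
  ls_E : forall s, c <= s <= s1 -> 0 < w s ^ 2 + 2 * prim g s;
  ls_drho : forall s, c <= s <= s1 -> is_derive rho s (- / w s);
  ls_dw : forall s, c <= s <= s1 -> is_derive w s (d / rho s - g s / w s) }.

Arguments ls_rho {d g rho w c s1}.
Arguments ls_w {d g rho w c s1}.
Arguments ls_E {d g rho w c s1}.
Arguments ls_drho {d g rho w c s1}.
Arguments ls_dw {d g rho w c s1}.

Definition speed (g u v : R -> R) (s : R) : R := - v (radius g u v s).

Lemma level_system_of_sol {n g b beta alpha u v} c s1 :
  nonlin g b beta -> sol n g alpha u v -> beta < alpha ->
  (forall s, c <= s <= s1 -> exists r, 0 < r /\ alive g u v r /\ u r = s) ->
  level_system (INR n) g (radius g u v) (speed g u v) c s1.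
Proof.
intros Hg Hs Ha Hlev.
assert (H : forall s, c <= s <= s1 -> let r := radius g u v s in 0 < r /\ alive g u v r /\ u r = s /\ v r < 0).
{ intros s Hs1. simpl. destruct (Hlev s Hs1) as [r [Hr [Hal Hu]]].
  assert (Hrr : radius g u v s = r) by (rewrite <- Hu; apply (radius_u _ Hg Hs Ha); assumption).
  rewrite Hrr. split; [exact Hr | split; [exact Hal | split; [exact Hu | ]]].
  now apply (alive_v _ Hg Hs Ha). }
split; intros s Hs1; destruct (H s Hs1) as [Hr [Hal [Hu Hv]]]; unfold speed.
- exact Hr.
- lra.
- destruct Hal as [_ Hal]. destruct (Hal (radius g u v s) ltac:(lra)) as [_ HE].
  unfold energy in HE. rewrite Hu in HE. nra.
- rewrite <- Hu at 1. eapply d_eq; [apply (d_radius _ Hg Hs Ha); assumption | ]. field. lra.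
- assert (Hd : is_derive (radius g u v) s (/ v (radius g u v s))).
  { rewrite <- Hu at 1. apply (d_radius _ Hg Hs Ha); assumption. }
  eapply d_eq.
  + apply d_opp. apply (d_comp v (radius g u v)); [ | exact Hd].
    apply (sol_dv Hs). exact Hr.
  + rewrite Hu. field. lra.
Qed.

(** With [Y = w^2], [k = -2F] and [d = N - 2] this expression is the height derivative of [Wfun]:
    below [beta] the steeper solution gains in [W] on the way down. Its square is the product of
    [(dY + k)/Y] and [(dY + k)/(Y - k)], both nonincreasing in [Y]. *)
Lemma W_slope_antitone (k d Y1 Y2 : R) :
  0 <= d -> 0 < k < Y1 -> Y1 <= Y2 ->
  (d * Y2 + k) / sqrt (Y2 * (Y2 - k)) <= (d * Y1 + k) / sqrt (Y1 * (Y1 - k)).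
Proof.
intros Hd Hk HY.
assert (H1 : 0 < sqrt (Y1 * (Y1 - k))) by pos.
assert (H2 : 0 < sqrt (Y2 * (Y2 - k))) by pos.
apply (Rmult_le_reg_r (sqrt (Y2 * (Y2 - k)) * sqrt (Y1 * (Y1 - k)))); [nra | ].
replace ((d * Y2 + k) / sqrt (Y2 * (Y2 - k)) * (sqrt (Y2 * (Y2 - k)) * sqrt (Y1 * (Y1 - k))))
  with ((d * Y2 + k) * sqrt (Y1 * (Y1 - k))) by (field; lra).
replace ((d * Y1 + k) / sqrt (Y1 * (Y1 - k)) * (sqrt (Y2 * (Y2 - k)) * sqrt (Y1 * (Y1 - k))))
  with ((d * Y1 + k) * sqrt (Y2 * (Y2 - k))) by (field; lra).
assert (Hp1 : 0 < d * Y1 + k) by nra. assert (Hp2 : 0 < d * Y2 + k) by nra.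
apply Rsqr_incr_0_var; [ | nra].
rewrite !Rsqr_mult, !Rsqr_sqrt by nra. unfold Rsqr.
assert (Ha : (d * Y2 + k) * Y1 <= (d * Y1 + k) * Y2) by nra.
assert (Hb : (d * Y2 + k) * (Y1 - k) <= (d * Y1 + k) * (Y2 - k)) by nra.
replace ((d * Y2 + k) * (d * Y2 + k) * (Y1 * (Y1 - k)))
  with (((d * Y2 + k) * Y1) * ((d * Y2 + k) * (Y1 - k))) by ring.
replace ((d * Y1 + k) * (d * Y1 + k) * (Y2 * (Y2 - k)))
  with (((d * Y1 + k) * Y2) * ((d * Y1 + k) * (Y2 - k))) by ring.
apply Rmult_le_compat; try assumption; apply Rmult_le_pos; lra.
Qed.

Definition Tfun (g rho w : R -> R) (s : R) : R := rho s * w s + 2 * prim g s * rho s / w s.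

(** This is [rho sqrt(2E)]: bounding it below amounts to the bound on [r^2 E] that
    [crosses_of_energy] asks for. *)
Definition Wfun (g rho w : R -> R) (s : R) : R := rho s * sqrt (w s ^ 2 + 2 * prim g s).

Lemma d_Tfun {d g rho w c s1 s} :
  (forall t, continuous g t) -> level_system d g rho w c s1 -> c <= s <= s1 ->
  is_derive (Tfun g rho w) s
    ((d - 1) + g s * Tfun g rho w s / w s ^ 2 - 2 * (d + 1) * prim g s / w s ^ 2).
Proof.
intros Hg Hl Hs. unfold Tfun.
generalize (ls_rho Hl s Hs) (ls_w Hl s Hs)
  (ls_drho Hl s Hs) (ls_dw Hl s Hs) (d_prim g s Hg).
intros H1 H2 H3 H4 H5.
eapply d_eq; [deriv; lra | ]. cbv beta. field. lra.
Qed.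

Lemma d_Wfun d g rho w c s1 s :
  (forall t, continuous g t) -> level_system d g rho w c s1 -> c <= s <= s1 ->
  is_derive (Wfun g rho w) s
    (((d - 1) * w s ^ 2 + (- (2 * prim g s))) / sqrt (w s ^ 2 * (w s ^ 2 - - (2 * prim g s)))).
Proof.
intros Hg Hl Hs. unfold Wfun.
generalize (ls_rho Hl s Hs) (ls_w Hl s Hs) (ls_E Hl s Hs)
  (ls_drho Hl s Hs) (ls_dw Hl s Hs) (d_prim g s Hg).
intros H1 H2 HE H3 H4 H5.
eapply d_eq; [deriv; lra | ]. cbv beta. simpl pred. simpl (INR 2).
replace (w s ^ 2 - - (2 * prim g s)) with (w s ^ 2 + 2 * prim g s) by ring.
rewrite sqrt_mult by nra.
replace (sqrt (w s ^ 2)) with (w s) by (rewrite sqrt_pow2; lra).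
assert (Hq : 0 < sqrt (w s ^ 2 + 2 * prim g s)) by pos.
assert (Hq2 : sqrt (w s ^ 2 + 2 * prim g s) ^ 2 = w s ^ 2 + 2 * prim g s) by (apply pow2_sqrt; lra).
set (q := sqrt (w s ^ 2 + 2 * prim g s)) in *.
replace (prim g s) with ((q ^ 2 - w s ^ 2) / 2) by lra.
field. lra.
Qed.

(* At the largest level where the two speeds would agree, [w2 - w1] vanishes from above only if
   [rho2 <= rho1], whereas the functional [T] (above [beta]) or [W] (below [beta]) forces
   [rho1 < rho2]. *)
Lemma speed_comparison n g b beta rho1 w1 rho2 w2 c s1 :
  (0 < n)%nat -> nonlin g b beta -> 0 < c < beta -> beta < s1 ->
  level_system (INR n) g rho1 w1 c s1 -> level_system (INR n) g rho2 w2 c s1 ->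
  (forall s, beta <= s <= s1 -> 2 * (INR n + 1) * prim g s < g s * Tfun g rho2 w2 s) ->
  w1 s1 < w2 s1 -> Tfun g rho1 w1 s1 < Tfun g rho2 w2 s1 ->
  (forall s, c <= s <= s1 -> w1 s < w2 s) /\
  Wfun g rho1 w1 beta < Wfun g rho2 w2 beta /\
  Wfun g rho2 w2 beta - Wfun g rho1 w1 beta <= Wfun g rho2 w2 c - Wfun g rho1 w1 c.
Proof.
intros Hn Hg Hc Hs1 L1 L2 HP Hw1 HT1.
generalize (nl_b Hg) (nl_bbeta Hg). intros Hb Hbb.
assert (Hd : 1 <= INR n) by (apply (le_INR 1); lia).
assert (cg := nl_cont Hg).
assert (Hcont : forall x, c <= x <= s1 -> continuous (fun s => w2 s - w1 s) x).
{ intros x Hx. apply c_minus; eapply d_c; [apply (ls_dw L2 x Hx) | apply (ls_dw L1 x Hx)]. }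
assert (HT : forall s0, beta <= s0 <= s1 -> (forall s, s0 < s <= s1 -> w1 s < w2 s) ->
  Tfun g rho1 w1 s0 < Tfun g rho2 w2 s0).
{ intros s0 Hs0 Hw. destruct (Req_dec s0 s1) as [-> | Hne]; [exact HT1 | ].
  (* The flux [rho1^n w1] is an integrating factor for [T2 - T1]: its height derivative
     [- rho1^n g / w1] cancels the term [g (T2 - T1) / w1^2]. What remains has the sign of
     [1/w2^2 - 1/w1^2] by the hypothesis on [T2]. *)
  set (Z := fun s => rho1 s ^ n * w1 s * (Tfun g rho2 w2 s - Tfun g rho1 w1 s)).
  assert (HdZ : forall x, c <= x <= s1 -> is_derive Z x
     (rho1 x ^ n * w1 x * ((/ w2 x ^ 2 - / w1 x ^ 2) * (g x * Tfun g rho2 w2 x - 2 * (INR n + 1) * prim g x)))).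
  { intros x Hx. unfold Z.
    generalize (ls_rho L1 x Hx) (ls_w L1 x Hx) (ls_w L2 x Hx)
      (ls_drho L1 x Hx) (ls_dw L1 x Hx)
      (d_Tfun cg L1 Hx) (d_Tfun cg L2 Hx).
    intros R1 W1 W2 D1 D2 D3 D4.
    eapply d_eq; [deriv | ]. cbv beta.
    destruct n as [ | m]; [lia | ]. simpl pred. rewrite <- tech_pow_Rmult. field. lra. }
  assert (HZ : Z s1 < Z s0).
  { apply Ropp_lt_cancel. eapply (deriv_pos_lt (fun s => - Z s)); [lra | | | ].
    - intros x Hx. apply d_opp, HdZ. lra.
    - intros x Hx. apply c_opp. eapply d_c, HdZ. lra.
    - intros x Hx. cbv beta.
      assert (Hx' : c <= x <= s1) by lra.
      generalize (ls_rho L1 x Hx') (ls_w L1 x Hx') (Hw x ltac:(lra)) (HP x ltac:(lra)).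
      intros R1 W1 W12 P.
      assert (/ w2 x ^ 2 < / w1 x ^ 2).
      { assert (0 < w1 x ^ 2) by nra. assert (0 < w2 x ^ 2) by nra.
        apply Rinv_lt_contravar; [now apply Rmult_lt_0_compat | nra]. }
      assert (0 < rho1 x ^ n) by pos.
      assert (0 < rho1 x ^ n * w1 x) by nra.
      assert (0 < (/ w1 x ^ 2 - / w2 x ^ 2) * (g x * Tfun g rho2 w2 x - 2 * (INR n + 1) * prim g x))
        by pos.
      nra. }
  unfold Z in HZ.
  assert (Q1 : 0 < rho1 s1 ^ n * w1 s1).
  { apply Rmult_lt_0_compat; [apply pow_lt, (ls_rho L1) | apply (ls_w L1)]; lra. }
  assert (Q0 : 0 < rho1 s0 ^ n * w1 s0).
  { apply Rmult_lt_0_compat; [apply pow_lt, (ls_rho L1) | apply (ls_w L1)]; lra. }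
  apply Rnot_le_lt. intros Hle. nra. }
(* At [beta] the potential vanishes and both functionals reduce to [rho w], which hands the
   inequality over from [T] to [W]. *)
assert (HWb : (forall s, beta < s <= s1 -> w1 s < w2 s) -> Wfun g rho1 w1 beta < Wfun g rho2 w2 beta).
{ intros Hw. generalize (HT beta ltac:(lra) Hw). unfold Tfun, Wfun.
  rewrite (nl_beta Hg), !Rmult_0_r, !Rplus_0_r.
  rewrite !sqrt_pow2 by (left; first [apply (ls_w L1) | apply (ls_w L2)]; lra).
  unfold Rdiv. rewrite !Rmult_0_l. lra. }
assert (HW : forall s0, c <= s0 <= beta -> (forall s, s0 < s <= s1 -> w1 s < w2 s) ->
  Wfun g rho2 w2 beta - Wfun g rho1 w1 beta <= Wfun g rho2 w2 s0 - Wfun g rho1 w1 s0).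
{ intros s0 Hs0 Hw.
  cut (- (Wfun g rho2 w2 s0 - Wfun g rho1 w1 s0) <= - (Wfun g rho2 w2 beta - Wfun g rho1 w1 beta)); [lra | ].
  eapply (deriv_nonneg_le (fun s => - (Wfun g rho2 w2 s - Wfun g rho1 w1 s))); [lra | | | ].
  - intros x Hx. apply d_opp, d_minus; [eapply d_Wfun; [exact cg | exact L2 | lra] | eapply d_Wfun; [exact cg | exact L1 | lra]].
  - intros x Hx. apply c_opp, c_minus; eapply d_c, d_Wfun; try exact cg; [exact L2 | lra | exact L1 | lra].
  - intros x Hx. cbv beta.
    assert (Hx' : c <= x <= s1) by lra.
    generalize (nl_below Hg x ltac:(lra)) (ls_E L1 x Hx') (Hw x ltac:(lra)) (ls_w L1 x Hx').
    intros HF HE W12 W1.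
    generalize (W_slope_antitone (- (2 * prim g x)) (INR n - 1) (w1 x ^ 2) (w2 x ^ 2) ltac:(lra) ltac:(lra) ltac:(nra)).
    lra. }
assert (Hmain : forall s, c <= s <= s1 -> w1 s < w2 s).
{ intros s Hs. apply Rnot_le_lt. intros Hle.
  destruct (last_zero (fun s => w2 s - w1 s) s s1) as [s0 [H1 [H2 H3]]]; try lra.
  { intros x Hx. apply Hcont. lra. }
  assert (Hw : forall t, s0 < t <= s1 -> w1 t < w2 t) by (intros t Ht; specialize (H3 t Ht); lra).
  assert (Hs0 : c <= s0 <= s1) by lra.
  generalize (ls_rho L1 s0 Hs0) (ls_rho L2 s0 Hs0) (ls_w L1 s0 Hs0)
    (ls_E L1 s0 Hs0) (ls_dw L1 s0 Hs0) (ls_dw L2 s0 Hs0).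
  intros R1 R2 W1 E1 D1 D2. assert (Weq : w2 s0 = w1 s0) by lra.
  assert (HR : rho1 s0 < rho2 s0).
  { destruct (Rle_lt_dec beta s0) as [Hbs | Hbs].
    - generalize (HT s0 ltac:(lra) Hw). unfold Tfun. rewrite Weq.
      assert (0 <= prim g s0).
      { destruct Hbs as [Hbs | <-]; [left; now apply (prim_pos g b beta) | rewrite (nl_beta Hg); lra]. }
      set (K := w1 s0 + 2 * prim g s0 / w1 s0).
      replace (rho1 s0 * w1 s0 + 2 * prim g s0 * rho1 s0 / w1 s0) with (rho1 s0 * K) by (unfold K; field; lra).
      replace (rho2 s0 * w1 s0 + 2 * prim g s0 * rho2 s0 / w1 s0) with (rho2 s0 * K) by (unfold K; field; lra).
      assert (0 < K).
      { unfold K. assert (0 <= 2 * prim g s0 / w1 s0); [ | lra]. apply Rmult_le_pos; [lra | ].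
        left. now apply Rinv_0_lt_compat. }
      intros. nra.
    - generalize (HW s0 ltac:(lra) Hw) (HWb ltac:(intros t Ht; apply Hw; lra)). unfold Wfun at 3 4. rewrite Weq.
      assert (0 < sqrt (w1 s0 ^ 2 + 2 * prim g s0)) by pos.
      intros. nra. }
  assert (HD : is_derive (fun s => w2 s - w1 s) s0 (INR n / rho2 s0 - INR n / rho1 s0)).
  { eapply d_eq; [apply d_minus; [exact D2 | exact D1] | ]. rewrite Weq. ring. }
  assert (Hneg : INR n / rho2 s0 - INR n / rho1 s0 < 0).
  { assert (/ rho2 s0 < / rho1 s0) by (apply Rinv_lt_contravar; nra). unfold Rdiv. nra. }
  apply is_derive_Reals in HD.
  destruct (HD (- (INR n / rho2 s0 - INR n / rho1 s0)) ltac:(lra)) as [dl Hdl].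
  assert (Hs01 : 0 < s1 - s0) by lra.
  destruct (exists_small 1 1 0 (cond_pos dl) Hs01 Rlt_0_1) as [h [Hh [Hh1 [Hh2 _]]]].
  specialize (Hdl h ltac:(lra)). rewrite Rabs_pos_eq in Hdl by lra. specialize (Hdl ltac:(lra)).
  apply Rabs_def2 in Hdl. destruct Hdl as [Hdl _].
  specialize (Hw (s0 + h) ltac:(lra)).
  assert (0 < (w2 (s0 + h) - w1 (s0 + h) - (w2 s0 - w1 s0)) / h); [ | lra].
  apply Rdiv_lt_0_compat; lra. }
split; [exact Hmain | split].
- apply HWb. intros; apply Hmain; lra.
- apply HW; [lra | ]. intros; apply Hmain; lra.
Qed.

Lemma Tfun_radius {n g b beta alpha u v} r :
  nonlin g b beta -> sol n g alpha u v -> beta < alpha -> 0 < r -> alive g u v r ->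
  Tfun g (radius g u v) (speed g u v) (u r) = r * - v r + 2 * prim g (u r) * r / - v r.
Proof.
intros Hg Hs Ha Hr Hal. unfold Tfun, speed.
now rewrite !(radius_u r Hg Hs Ha Hr Hal).
Qed.

(** The bound is [(N-2)/(2N)]. It is localized below [alpha] so that it carries over to a modified
    nonlinearity that agrees with [f1] only up to that height. *)
Definition erbe_tang (n : nat) (g : R -> R) (beta alpha : R) : Prop :=
  forall s, beta < s < alpha -> exists D,
    is_derive (fun t => prim g t / g t) s D /\ (INR n - 1) / (2 * (INR n + 1)) < D.

(* The Erbe-Tang functional [P] vanishes at the center and is monotone as long as [u > beta]. *)
Lemma erbe_tang_pos {n g b beta alpha u v} r :
  nonlin g b beta -> sol n g alpha u v -> beta < alpha -> erbe_tang n g beta alpha ->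
  0 < r -> alive g u v r -> beta <= u r ->
  2 * (INR n + 1) * prim g (u r)
    < g (u r) * Tfun g (radius g u v) (speed g u v) (u r).
Proof.
intros Hg Hs Ha HD Hr Hal Hur. rewrite (Tfun_radius _ Hg Hs Ha); try assumption.
assert (cg := nl_cont Hg). generalize (nl_bbeta Hg). intros Hbb.
assert (Hu0 := sol_u0 Hs 0 (Rle_refl 0)).
assert (Hn0 : 0 <= INR n) by pos.
assert (Hvt : forall t, 0 < t <= r -> v t < 0).
{ intros t Ht. apply (alive_v t Hg Hs Ha); [ | lra].
  apply (alive_down _ Hal); lra. }
assert (Hut : forall t, 0 <= t < r -> u r < u t).
{ intros t Ht. apply (alive_decr _ _ Hg Hs Ha); assumption. }
assert (Hua : forall t, 0 < t <= r -> u t < alpha).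
{ intros t Ht. rewrite <- Hu0. apply (u_decr _ _ Hs); [lra | ].
  intros t' Ht'. apply Hvt. lra. }
set (G := fun s => prim g s / g s).
(* This equals [r^n |v| (T - 2N F/g)], and its derivative is [r^n v^2 (2N (F/g)' - (N-2))]. *)
set (P := fun t => t ^ S n * (v t ^ 2 + 2 * prim g (u t)) + 2 * (INR n + 1) * (G (u t) * (t ^ n * v t))).
assert (HP : P 0 < P r).
{ apply (deriv_pos_lt P (fun t => t ^ n * v t ^ 2 * (2 * (INR n + 1) * Derive G (u t) - (INR n - 1)))); [exact Hr | | | ].
  - intros x Hx.
    assert (H1 : beta < u x < alpha) by (split; [generalize (Hut x); lra | apply Hua; lra]).
    destruct (HD (u x) H1) as [D [HD1 HD2]].
    assert (DG : is_derive G (u x) (Derive G (u x))).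
    { apply Derive_correct. now exists D. }
    assert (Du := sol_du Hs x ltac:(lra)).
    assert (Dv := sol_dv Hs x ltac:(lra)).
    assert (Df := d_flux x Hs ltac:(lra)).
    assert (DF := d_comp (prim g) u x _ _ (d_prim g (u x) cg) Du).
    assert (DGu := d_comp G u x _ _ DG Du). cbv beta in DF, DGu.
    unfold P. eapply d_eq; [deriv | ]. cbv beta.
    assert (Hgx : 0 < g (u x)) by (apply (nl_pos Hg); lra).
    rewrite (S_INR n). simpl pred. simpl (INR 2). rewrite <- !tech_pow_Rmult.
    generalize (Derive G (u x)). intros DG0. unfold G. field. lra.
  - intros x Hx. unfold P.
    assert (cu := sol_uc Hs x). assert (cv := sol_vc Hs x).
    assert (cF := c_comp (prim g) u x (c_prim g (u x) cg) cu).
    assert (cG : continuous (fun t => G (u t)) x).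
    { apply (c_comp G u); [ | exact cu]. unfold G. apply c_div; [apply c_prim, cg | apply cg | ].
      apply Rgt_not_eq, (nl_pos Hg).
      destruct (Req_dec x r) as [-> | Hxr]; [lra | ]. generalize (Hut x). lra. }
    cont.
  - intros x Hx.
    assert (H1 : beta < u x < alpha) by (split; [generalize (Hut x); lra | apply Hua; lra]).
    destruct (HD (u x) H1) as [D [HD1 HD2]].
    assert (HDe : Derive G (u x) = D) by (apply is_derive_unique, HD1). rewrite HDe.
    specialize (Hvt x ltac:(lra)).
    apply Rmult_lt_0_compat; [apply Rmult_lt_0_compat; [pos | nra] | ].
    apply (Rmult_lt_compat_l (2 * (INR n + 1))) in HD2; [ | lra].
    replace (2 * (INR n + 1) * ((INR n - 1) / (2 * (INR n + 1)))) with (INR n - 1) in HD2 by (field; lra).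
    lra. }
assert (HP0 : P 0 = 0).
{ unfold P. rewrite (sol_v0 Hs 0) by lra. rewrite (pow_i (S n)) by lia. ring. }
rewrite HP0 in HP.
assert (Hgr : 0 < g (u r)) by (apply (nl_pos Hg); lra).
specialize (Hvt r ltac:(lra)).
assert (Heq : P r = (r ^ n * - v r / g (u r)) *
  (g (u r) * (r * - v r + 2 * prim g (u r) * r / - v r) - 2 * (INR n + 1) * prim g (u r))).
{ unfold P, G. rewrite <- tech_pow_Rmult. field. lra. }
rewrite Heq in HP.
assert (Hk : 0 < r ^ n * - v r / g (u r)) by pos.
apply Rnot_le_lt. intros Hle. nra.
Qed.

Lemma alive_between {n g b beta alpha u v} r s :
  nonlin g b beta -> sol n g alpha u v -> beta < alpha -> alive g u v r ->
  u r <= s < alpha -> exists q, 0 < q <= r /\ alive g u v q /\ u q = s.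
Proof.
intros Hg Hs Ha Hal Hsr.
destruct (ivt_decr u 0 r s) as [q [Hq1 Hq2]].
- apply Hal.
- intros; apply (sol_uc Hs).
- rewrite (sol_u0 Hs 0); lra.
- exists q. split; [exact Hq1 | split; [ | exact Hq2]]. apply (alive_down _ Hal); lra.
Qed.

(** At heights from [beta] on, [F >= 0] and [v < 0] exclude zero energy, so the alive interval
    cannot end there. *)
Lemma alive_below_beta {n g b beta alpha u v} :
  nonlin g b beta -> sol n g alpha u v -> beta < alpha ->
  exists r, 0 < r /\ alive g u v r /\ u r < beta.
Proof.
intros Hg Hs Ha. generalize (nl_b Hg) (nl_bbeta Hg). intros Hb Hbb.
assert (Hu0 := sol_u0 Hs 0 (Rle_refl 0)).
destruct (alive_end Hg Hs Ha) as [Hal | [e [He [Hal [He1 [He2 He3]]]]]].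
- destruct (alive_all_levels (beta / 2) Hg Hs Ha Hal ltac:(lra)) as [r [Hr Hur]].
  exists r. split; [exact Hr | split; [apply Hal; lra | lra]].
- assert (Hue : u e < beta).
  { destruct He3 as [He3 | He3]; [lra | ].
    apply Rnot_le_lt. intros Hbe.
    assert (v e < 0).
    { apply (v_neg e Hg Hs Ha He). intros t Ht.
      destruct (Req_dec t e) as [-> | Hte]; [lra | ].
      destruct (Hal t ltac:(lra)) as [_ H]. destruct (H t ltac:(lra)). lra. }
    unfold energy in He3.
    assert (0 <= prim g (u e)).
    { destruct Hbe as [Hbe | <-]; [left; now apply (prim_pos g b beta) | rewrite (nl_beta Hg); lra]. }
    nra. }
  destruct (ivt_decr u 0 e ((u e + beta) / 2)) as [q [Hq1 Hq2]].
  + lra.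
  + intros; apply (sol_uc Hs).
  + lra.
  + assert (q <> e) by (intros ->; lra).
    exists q. split; [lra | split; [apply Hal; lra | lra]].
Qed.

(** A trajectory that does not turn attains all heights, so the comparison reaches down to any
    height of the second one. There [W2 >= W1 + D >= D], with [D] the difference at [beta]; since
    [W2^2 = 2 r^2 E], the energy criterion for crossing applies. *)
Lemma crosses_by_comparison n g b beta alpha1 u1 v1 alpha2 u2 v2 s1 :
  (0 < n)%nat -> nonlin g b beta ->
  sol n g alpha1 u1 v1 -> beta < alpha1 -> ~ turns g u1 v1 ->
  sol n g alpha2 u2 v2 -> beta < alpha2 -> erbe_tang n g beta alpha2 ->
  beta < s1 < alpha1 -> s1 < alpha2 ->
  speed g u1 v1 s1 < speed g u2 v2 s1 ->
  Tfun g (radius g u1 v1) (speed g u1 v1) s1 < Tfun g (radius g u2 v2) (speed g u2 v2) s1 ->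
  crosses g u2 v2.
Proof.
intros Hn Hg S1 A1 Hnt S2 A2 HD Hs1 Hs12 Hw HT.
generalize (nl_b Hg) (nl_bbeta Hg). intros Hb Hbb.
destruct (alive_below_beta Hg S2 A2) as [r0 [Hr0 [Hal0 Hur0]]].
assert (Hcomp : forall r, r0 <= r -> alive g u2 v2 r ->
  let W1 := Wfun g (radius g u1 v1) (speed g u1 v1) in
  let W2 := Wfun g (radius g u2 v2) (speed g u2 v2) in
  W1 beta < W2 beta /\ W2 beta - W1 beta <= W2 (u2 r) - W1 (u2 r) /\ 0 <= W1 (u2 r)).
{ intros r Hr Hal. cbv zeta.
  assert (Hur : 0 < u2 r). { destruct Hal as [_ H]. apply H. lra. }
  assert (Hub : u2 r < beta).
  { destruct (Req_dec r r0) as [-> | Hne]; [exact Hur0 | ].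
    apply Rlt_trans with (u2 r0); [ | exact Hur0].
    apply (alive_decr _ _ Hg S2 A2); try assumption; lra. }
  assert (L1 : level_system (INR n) g (radius g u1 v1) (speed g u1 v1) (u2 r) s1).
  { apply (level_system_of_sol _ _ Hg S1 A1); try assumption. intros s Hs.
    apply (not_turns_levels n g b beta alpha1); try assumption. lra. }
  assert (L2 : level_system (INR n) g (radius g u2 v2) (speed g u2 v2) (u2 r) s1).
  { apply (level_system_of_sol _ _ Hg S2 A2); try assumption. intros s Hs.
    destruct (alive_between r s Hg S2 A2) as [q [Hq1 [Hq2 Hq3]]]; try assumption; [lra | ].
    exists q. split; [lra | split; assumption]. }
  destruct (speed_comparison n g b beta _ _ _ _ (u2 r) s1 Hn Hg ltac:(lra) ltac:(lra) L1 L2) as [_ [H2 H3]];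
    try assumption.
  - intros s Hs.
    destruct (alive_between r s Hg S2 A2) as [q [Hq1 [Hq2 Hq3]]]; try assumption; [lra | ].
    rewrite <- Hq3. apply (erbe_tang_pos _ Hg S2 A2); try assumption; lra.
  - split; [exact H2 | split; [exact H3 | ]]. unfold Wfun. apply Rmult_le_pos; [ | apply sqrt_pos].
    left. apply (ls_rho L1). lra. }
set (D := Wfun g (radius g u2 v2) (speed g u2 v2) beta - Wfun g (radius g u1 v1) (speed g u1 v1) beta).
assert (HDpos : 0 < D).
{ destruct (Hcomp r0 (Rle_refl _) Hal0) as [H _]. unfold D. lra. }
apply (crosses_of_energy (D ^ 2 / 2) r0 Hg S2 A2); try assumption; [nra | ].
intros r Hr Hal. destruct (Hcomp r Hr Hal) as [_ [H2 H3]]. fold D in H2.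
assert (HW : Wfun g (radius g u2 v2) (speed g u2 v2) (u2 r) = r * sqrt (2 * energy g u2 v2 r)).
{ unfold Wfun, speed. rewrite !(radius_u r Hg S2 A2); try assumption; [ | lra].
  f_equal. f_equal. unfold energy. field. }
assert (HE : 0 < energy g u2 v2 r). { destruct Hal as [_ H]. apply H. lra. }
rewrite HW in H2.
assert (D ^ 2 <= (r * sqrt (2 * energy g u2 v2 r)) ^ 2) by (apply pow_incr; lra).
rewrite Rpow_mult_distr, pow2_sqrt in H by lra. lra.
Qed.

(** * From trajectories to ground states and back *)

Lemma radial_sol_of_system N n f (u v : R -> R) :
  INR N - 1 = INR n ->
  (forall r, 0 < r -> is_derive u r (v r)) ->
  (forall r, 0 < r -> is_derive v r (- (INR n / r * v r) - f (u r))) ->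
  continuous u 0 -> continuous v 0 -> v 0 = 0 -> radial_sol N f (u 0) u.
Proof.
intros HN Hu Hv cu cv Hv0.
assert (HD : forall r, 0 < r -> Derive u r = v r) by (intros r Hr; apply is_derive_unique, Hu, Hr).
assert (HD2 : forall r, 0 < r -> is_derive (Derive u) r (- (INR n / r * v r) - f (u r))).
{ intros r Hr. apply (is_derive_ext_loc v); [ | now apply Hv].
  apply (near_intro r _ _ Hr). intros y Hy.
  symmetry. apply HD. lra. }
split; [reflexivity | split; [ | split]].
- intros r Hr. split; [exists (v r); now apply Hu | split; [eexists; now apply HD2 | ]].
  assert (H : Derive (Derive u) r = - (INR n / r * v r) - f (u r)) by (apply is_derive_unique, HD2, Hr).
  rewrite H, HD, HN by exact Hr. field. lra.
- intros P HP. destruct (cu P HP) as [d Hd]. exists d. intros y Hy _. now apply Hd.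
- assert (cv' : filterlim v (locally 0) (locally 0)) by (rewrite <- Hv0 at 2; exact cv).
  intros P HP. destruct (cv' P HP) as [d Hd]. exists d. intros y Hy Hy0.
  rewrite HD by exact Hy0. now apply Hd.
Qed.

Lemma d_truncate (phi : R -> R) (e : R) :
  is_derive phi e 0 -> phi e = 0 ->
  is_derive (fun r => if Rlt_dec r e then phi r else 0) e 0.
Proof.
intros H H0. apply is_derive_Reals in H. apply is_derive_Reals. intros eps Heps.
destruct (H eps Heps) as [d Hd]. exists d. intros h Hh0 Hh.
destruct (Rlt_dec e e) as [He | _]; [lra | ].
destruct (Rlt_dec (e + h) e) as [Hlt | Hlt].
- specialize (Hd h Hh0 Hh). now rewrite H0 in Hd.
- replace ((0 - 0) / h - 0) with 0 by (field; exact Hh0). now rewrite Rabs_R0.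
Qed.

Lemma d_truncate_system (phi dphi : R -> R) (e r : R) :
  is_derive phi r (dphi r) -> phi e = 0 -> dphi e = 0 ->
  is_derive (fun r => if Rlt_dec r e then phi r else 0) r (if Rlt_dec r e then dphi r else 0).
Proof.
intros H H0 H1. destruct (Rlt_dec r e) as [Hr | Hr].
- apply (is_derive_ext_loc phi); [ | exact H].
  assert (Hp : 0 < e - r) by lra. apply (near_intro r _ _ Hp). intros y Hy.
  destruct (Rlt_dec y e); [reflexivity | lra].
- destruct (Req_dec r e) as [-> | Hne].
  + apply d_truncate; try assumption. now rewrite <- H1.
  + apply (is_derive_ext_loc (fun _ => 0)); [ | apply d_const].
    assert (Hp : 0 < r - e) by lra. apply (near_intro r _ _ Hp). intros y Hy.
    destruct (Rlt_dec y e); [lra | reflexivity].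
Qed.

Lemma ground_state_of_sol N n f g b beta alpha u v :
  (0 < n)%nat -> INR N - 1 = INR n ->
  nonlin g b beta -> sol n g alpha u v -> beta < alpha -> ~ turns g u v -> ~ crosses g u v ->
  (forall s, 0 <= s <= alpha -> f s = g s) ->
  exists w, ground_state N f w /\ w 0 = alpha.
Proof.
intros Hn HN Hg Hs Ha Hnt Hnc Hfg.
generalize (nl_b Hg) (nl_bbeta Hg). intros Hb Hbb.
assert (Hu0 := sol_u0 Hs 0 (Rle_refl 0)).
assert (Hv0 := sol_v0 Hs 0 (Rle_refl 0)).
assert (Hle : forall r, 0 <= r -> alive g u v r -> u r <= alpha).
{ intros r Hr Hal. destruct (Req_dec r 0) as [-> | H0]; [lra | ]. rewrite <- Hu0. left.
  apply (alive_decr _ _ Hg Hs Ha); try assumption. lra. }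
destruct (not_turns_end Hn Hg Hs Ha Hnt) as [Hal | [e [He [Hal [Hue HEe]]]]].
- exists u. split; [ | exact Hu0].
  assert (Hpos : forall r, 0 <= r -> 0 < u r).
  { intros r Hr. destruct (Hal r Hr) as [_ H]. apply H. lra. }
  split; [ | split; [ | split]].
  + apply (radial_sol_of_system N n f u v HN).
    * apply (sol_du Hs).
    * intros r Hr. rewrite Hfg; [now apply (sol_dv Hs) | ].
      split; [left; apply Hpos; lra | apply Hle; [lra | apply Hal; lra]].
    * apply (sol_uc Hs).
    * apply (sol_vc Hs).
    * exact Hv0.
  + intros r Hr. left. now apply Hpos.
  + exists 0. lra.
  + apply filterlim_locally. intros eps. generalize (cond_pos eps). intros Heps.
    assert (Ha0 : 0 < alpha) by lra.
    destruct (exists_small 1 1 0 Heps Ha0 Rlt_0_1) as [z [Hz [Hz1 [Hz2 _]]]].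
    destruct (alive_all_levels z Hg Hs Ha Hal ltac:(lra)) as [r1 [Hr1 Hur1]].
    exists r1. intros r Hr. change (Rabs (u r - 0) < eps).
    assert (u r < u r1) by (apply (alive_decr _ _ Hg Hs Ha); try assumption; [apply Hal | ]; lra).
    specialize (Hpos r ltac:(lra)). rewrite Rabs_pos_eq; lra.
- assert (HE0 : energy g u v e = 0).
  { apply Rle_antisym; [ | exact HEe]. apply Rnot_lt_le. intros HE. apply Hnc.
    now apply (crossing_end n g b beta alpha u v e). }
  (* Zero energy at height zero means zero slope; as also [g 0 = 0], the second derivative matches
     and the extension by zero is again a solution. *)
  assert (Hve : v e = 0).
  { unfold energy in HE0. rewrite Hue, prim_0 in HE0. nra. }
  assert (Hg0 : g 0 = 0) by (apply (nl_neg Hg); lra).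
  set (w := fun r => if Rlt_dec r e then u r else 0).
  set (z := fun r => if Rlt_dec r e then v r else 0).
  assert (Hw0 : w 0 = alpha) by (unfold w; destruct (Rlt_dec 0 e); lra).
  assert (Hloc : forall h : R -> R, locally 0 (fun y => h y = (if Rlt_dec y e then h y else 0))).
  { intros h. apply (near_intro 0 _ _ He). intros y Hy.
    destruct (Rlt_dec y e); [reflexivity | lra]. }
  exists w. split; [ | exact Hw0]. split; [ | split; [ | split]].
  + apply (radial_sol_of_system N n f w z HN).
    * intros r Hr. apply d_truncate_system; [now apply (sol_du Hs) | exact Hue | exact Hve].
    * intros r Hr. eapply d_eq.
      -- apply (d_truncate_system v (fun r => - (INR n / r * v r) - g (u r)) e r).
         ++ now apply (sol_dv Hs).
         ++ exact Hve.
         ++ rewrite Hve, Hue, Hg0. ring.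
      -- unfold w, z. destruct (Rlt_dec r e) as [Hre | Hre].
         ++ rewrite Hfg; [reflexivity | ]. split; [ | apply Hle; [lra | apply Hal; lra]].
            destruct (Hal r ltac:(lra)) as [_ H]. left. apply H. lra.
         ++ rewrite Hfg by lra. rewrite Hg0. ring.
    * unfold w. apply (continuous_ext_loc _ u); [ | apply (sol_uc Hs)]. apply Hloc.
    * unfold z. apply (continuous_ext_loc _ v); [ | apply (sol_vc Hs)]. apply Hloc.
    * unfold z. destruct (Rlt_dec 0 e); lra.
  + intros r Hr. unfold w. destruct (Rlt_dec r e); [ | lra].
    destruct (Hal r ltac:(lra)) as [_ H]. left. apply H. lra.
  + exists 0. lra.
  + apply filterlim_locally. intros eps. exists e. intros r Hr. unfold w.
    destruct (Rlt_dec r e); [lra | ]. apply ball_center.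
Qed.

Lemma sol_of_radial N n f g alpha u :
  INR N - 1 = INR n -> radial_sol N f alpha u ->
  (forall r, 0 < r -> f (u r) = g (u r)) ->
  sol n g alpha (fun r => if Rle_dec r 0 then alpha else u r)
    (fun r => if Rle_dec r 0 then 0 else Derive u r).
Proof.
intros HN [Hu0 [Hode [Hlu Hlv]]] Hfg.
assert (Hpatch : forall (h : R -> R) (c : R), (forall r, 0 < r -> continuous h r) ->
  filterlim h (at_right 0) (locally c) ->
  forall r, continuous (fun r => if Rle_dec r 0 then c else h r) r).
{ intros h c Hh Hl r. destruct (Rtotal_order r 0) as [Hr | [-> | Hr]].
  - apply (continuous_ext_loc _ (fun _ => c)); [ | apply c_const].
    assert (Hp : 0 < - r) by lra. apply (near_intro r _ _ Hp). intros y Hy. destruct (Rle_dec y 0); [reflexivity | lra].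
  - apply filterlim_locally. intros eps. destruct (Rle_dec 0 0) as [_ | H]; [ | lra].
    destruct (proj1 (filterlim_locally h c) Hl eps) as [d Hd]. exists d. intros y Hy.
    destruct (Rle_dec y 0) as [Hy0 | Hy0]; [apply ball_center | ]. apply Hd; [exact Hy | lra].
  - apply (continuous_ext_loc _ h); [ | now apply Hh].
    apply (near_intro r _ _ Hr). intros y Hy. destruct (Rle_dec y 0); [lra | reflexivity]. }
assert (Hloc : forall (h : R -> R) (c r : R), 0 < r ->
  locally r (fun y => h y = (if Rle_dec y 0 then c else h y))).
{ intros h c r Hr. apply (near_intro r _ _ Hr). intros y Hy. destruct (Rle_dec y 0); [lra | reflexivity]. }
assert (Hd1 : forall r, 0 < r -> is_derive u r (Derive u r)).
{ intros r Hr. apply Derive_correct. now apply Hode. }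
assert (Hd2 : forall r, 0 < r -> is_derive (Derive u) r (Derive (Derive u) r)).
{ intros r Hr. apply Derive_correct. now apply Hode. }
split.
- intros r Hr. destruct (Rle_dec r 0); [reflexivity | lra].
- intros r Hr. destruct (Rle_dec r 0); [reflexivity | lra].
- apply Hpatch; [intros r Hr; eapply d_c, Hd1, Hr | now rewrite <- Hu0].
- apply Hpatch; [intros r Hr; eapply d_c, Hd2, Hr | exact Hlv].
- intros r Hr. apply (is_derive_ext_loc u); [now apply Hloc | ].
  destruct (Rle_dec r 0); [lra | now apply Hd1].
- intros r Hr. apply (is_derive_ext_loc (Derive u)); [now apply Hloc | ].
  eapply d_eq; [now apply Hd2 | ].
  destruct (Rle_dec r 0); [lra | ]. destruct (Hode r Hr) as [_ [_ H]].
  rewrite <- HN, <- (Hfg r Hr). lra.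
Qed.

(** The energy is nonincreasing and at least [F(u)], which tends to [0]; hence it is nonnegative. A
    start at or below [beta] would make it vanish identically, so by dissipation [u] would be a
    nonzero constant. Finally [F(u) <= E <= F(alpha)], and [F] increases above [b]. *)
Lemma ground_state_energy n g b beta alpha u v :
  (0 < n)%nat -> nonlin g b beta -> sol n g alpha u v -> (forall r, 0 <= r -> 0 <= u r) ->
  filterlim u (Rbar_locally p_infty) (locally 0) -> (exists r, 0 <= r /\ u r <> 0) ->
  beta < alpha /\ ~ turns g u v /\ ~ crosses g u v /\ forall r, 0 <= r -> u r <= alpha.
Proof.
intros Hn Hg Hs Hpos Hlim Hnz. assert (cg := nl_cont Hg).
generalize (nl_b Hg) (nl_bbeta Hg). intros Hb Hbb.
assert (Hu0 := sol_u0 Hs 0 (Rle_refl 0)).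
assert (HE : forall r, 0 <= r -> 0 <= energy g u v r).
{ intros r Hr. apply Rnot_lt_le. intros HEn.
  assert (HF : filterlim (fun t => prim g (u t)) (Rbar_locally p_infty) (locally (prim g 0))).
  { apply (filterlim_comp _ _ _ u (prim g) _ (locally 0)); [exact Hlim | apply (c_prim g 0 cg)]. }
  assert (Hp : 0 < - energy g u v r) by lra.
  destruct (proj1 (filterlim_locally _ _) HF (mkposreal _ Hp)) as [q Hq].
  set (t := Rmax r q + 1). generalize (Rmax_l r q) (Rmax_r r q). intros H1 H2.
  specialize (Hq t ltac:(unfold t; lra)). change (Rabs (prim g (u t) - prim g 0) < - energy g u v r) in Hq.
  rewrite prim_0 in Hq. apply Rabs_def2 in Hq.
  generalize (energy_le r t cg Hs ltac:(unfold t; lra)). unfold energy at 1.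
  generalize (pow2_ge_0 (v t)). lra. }
assert (Ha : beta < alpha).
{ apply Rnot_le_lt. intros Ha.
  assert (H0 : forall r, 0 <= r -> energy g u v r = 0).
  { intros r Hr. apply Rle_antisym; [ | now apply HE].
    eapply Rle_trans; [apply (energy_le 0 r cg Hs); lra | ].
    rewrite (energy_0 Hs). apply (prim_nonpos g b beta); [exact Hg | ].
    split; [rewrite <- Hu0; apply Hpos; lra | exact Ha]. }
  assert (Hv : forall r, 0 < r -> v r = 0).
  { intros r Hr.
    assert (H1 : is_derive (energy g u v) r 0).
    { apply (is_derive_ext_loc (fun _ => 0)); [ | apply d_const].
      apply (near_intro r _ _ Hr). intros y Hy.
      symmetry. apply H0. lra. }
    generalize (is_derive_unique _ _ _ H1) (is_derive_unique _ _ _ (d_energy r cg Hs Hr)).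
    intros -> H2. assert (H3 : 0 < INR n / r) by pos.
    assert (v r ^ 2 = 0) by nra. nra. }
  assert (Hconst : forall r, 0 <= r -> u r = alpha).
  { intros r Hr. rewrite <- Hu0. apply Rle_antisym.
    - generalize (u_slope 0 0 r Hs ltac:(lra)). intros H. rewrite Rmult_0_l, Rminus_0_r in H.
      apply H. intros t Ht. rewrite Hv; lra.
    - generalize (u_slope_lower 0 0 r Hs ltac:(lra)). intros H. rewrite Rmult_0_l, Rminus_0_r in H.
      apply H. intros t Ht. rewrite Hv; lra. }
  destruct Hnz as [r [Hr Hr2]]. rewrite Hconst in Hr2 by exact Hr.
  assert (Hp : 0 < Rabs alpha) by now apply Rabs_pos_lt.
  destruct (proj1 (filterlim_locally u 0) Hlim (mkposreal _ Hp)) as [q Hq].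
  specialize (Hq (Rmax q 0 + 1)). generalize (Rmax_l q 0) (Rmax_r q 0). intros H1 H2.
  specialize (Hq ltac:(lra)). change (Rabs (u (Rmax q 0 + 1) - 0) < Rabs alpha) in Hq.
  rewrite Hconst, Rminus_0_r in Hq by lra. lra. }
split; [exact Ha | split; [ | split]].
- intros [r [Hr [H _]]]. specialize (HE r Hr). lra.
- intros [r [Hr [H _]]]. specialize (Hpos r Hr). lra.
- intros r Hr. apply Rnot_lt_le. intros H.
  generalize (prim_lt g b beta alpha (u r) Hg ltac:(lra)) (energy_le 0 r cg Hs ltac:(lra)).
  rewrite (energy_0 Hs). unfold energy. generalize (pow2_ge_0 (v r)). lra.
Qed.

Lemma sol_change n g1 g2 alpha u v :
  sol n g1 alpha u v -> (forall r, 0 < r -> g1 (u r) = g2 (u r)) -> sol n g2 alpha u v.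
Proof.
intros [H1 H2 H3 H4 H5 H6] H. split; try assumption.
intros r Hr. rewrite <- H by exact Hr. now apply H6.
Qed.

(** * Solutions started above a ground state, within the range of the Erbe-Tang condition *)

Lemma continuous_pos_locally (f : R -> R) x :
  continuous f x -> 0 < f x -> locally x (fun y => 0 < f y).
Proof.
intros Hc Hp. destruct (continuous_pos_near f x Hc Hp) as [d [Hd H]].
exists (mkposreal _ Hd). intros y Hy. now apply H.
Qed.

(** The quotient [r / |v|] in [T] is of the form [0/0] at the center; the slope bound
    [|v| >= K r / N] controls it. *)
Lemma Tfun_upper n g b beta alpha u v r K :
  nonlin g b beta -> sol n g alpha u v -> beta < alpha -> 0 < r -> alive g u v r ->
  0 < K -> K * r <= (INR n + 1) * - v r -> 0 <= prim g (u r) ->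
  Tfun g (radius g u v) (speed g u v) (u r) <= r * - v r + 2 * (INR n + 1) * prim g (u r) / K.
Proof.
intros Hg Hs Ha Hr Hal HK Hv HF. rewrite (Tfun_radius _ Hg Hs Ha) by assumption.
assert (Hvr : v r < 0) by (apply (alive_v _ Hg Hs Ha); assumption).
apply Rplus_le_compat_l.
replace (2 * prim g (u r) * r / - v r) with (2 * prim g (u r) * (r / - v r)) by (field; lra).
replace (2 * (INR n + 1) * prim g (u r) / K) with (2 * prim g (u r) * ((INR n + 1) / K)) by (field; lra).
apply Rmult_le_compat_l; [lra | ].
apply (Rmult_le_reg_r (- v r * K)); [nra | ].
replace (r / - v r * (- v r * K)) with (K * r) by (field; lra).
replace ((INR n + 1) / K * (- v r * K)) with ((INR n + 1) * - v r) by (field; lra). exact Hv.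
Qed.

(** Just below the height [alpha1] the lower solution is near its center, with small speed and [T1]
    close to [2N F/g], while the higher one already has positive speed and [T2 > 2N F/g]. The
    comparison starts there. *)
Lemma crosses_above n g b beta alpha1 u1 v1 alpha2 u2 v2 :
  (0 < n)%nat -> nonlin g b beta ->
  sol n g alpha1 u1 v1 -> beta < alpha1 -> ~ turns g u1 v1 ->
  sol n g alpha2 u2 v2 -> alpha1 < alpha2 -> erbe_tang n g beta alpha2 -> crosses g u2 v2.
Proof.
intros Hn Hg S1 A1 Hnt S2 A12 HD. assert (A2 : beta < alpha2) by lra.
assert (cg := nl_cont Hg). generalize (nl_b Hg) (nl_bbeta Hg). intros Hb Hbb.
destruct (alive_below_beta Hg S2 A2) as [r0 [Hr0 [Hal0 Hur0]]].
assert (L2 : level_system (INR n) g (radius g u2 v2) (speed g u2 v2) (u2 r0) alpha1).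
{ apply (level_system_of_sol _ _ Hg S2 A2); try assumption. intros s Hs.
  destruct (alive_between r0 s Hg S2 A2) as [q [Hq1 [Hq2 Hq3]]]; try assumption; [lra | ].
  exists q. split; [lra | split; assumption]. }
set (T2 := Tfun g (radius g u2 v2) (speed g u2 v2)).
set (w2 := speed g u2 v2).
assert (HP : 2 * (INR n + 1) * prim g alpha1 < g alpha1 * T2 alpha1).
{ destruct (alive_between r0 alpha1 Hg S2 A2) as [q [Hq1 [Hq2 Hq3]]]; try assumption; [lra | ].
  unfold T2. rewrite <- Hq3. apply (erbe_tang_pos _ Hg S2 A2); try assumption; lra. }
assert (Hg1 : 0 < g alpha1) by (apply (nl_pos Hg); lra).
assert (HF1 : 0 < prim g alpha1) by (apply (prim_pos g b beta); assumption).
assert (Hn0 : 0 < INR n) by pos.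
assert (HT0 : 0 < T2 alpha1) by pos.
(* A value strictly between [2N F / T2] and [g] at height [alpha1]: it bounds [g(u1)] from below
   near the center and still leaves [2N F / gl < T2]. *)
set (gl := (2 * (INR n + 1) * prim g alpha1 / T2 alpha1 + g alpha1) / 2).
assert (Hq : 0 < 2 * (INR n + 1) * prim g alpha1 / T2 alpha1 < g alpha1).
{ split; [apply Rdiv_lt_0_compat; [pos | exact HT0] | ].
  apply (Rmult_lt_reg_r (T2 alpha1)); [exact HT0 | ]. rewrite div_mult; lra. }
assert (Hgl : 0 < gl < g alpha1) by (unfold gl; lra).
assert (Hmu : 0 < T2 alpha1 - 2 * (INR n + 1) * prim g alpha1 / gl).
{ assert (2 * (INR n + 1) * prim g alpha1 / T2 alpha1 < gl) by (unfold gl; lra).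
  apply (Rmult_lt_compat_r (T2 alpha1)) in H; [ | exact HT0].
  replace (2 * (INR n + 1) * prim g alpha1 / T2 alpha1 * T2 alpha1) with (2 * (INR n + 1) * prim g alpha1) in H by (field; lra).
  apply (Rmult_lt_reg_r gl); [lra | ]. rewrite Rmult_0_l, Rmult_minus_distr_r.
  replace (2 * (INR n + 1) * prim g alpha1 / gl * gl) with (2 * (INR n + 1) * prim g alpha1) by (field; lra). lra. }
assert (Hu0 := sol_u0 S1 0 (Rle_refl 0)).
assert (Hv0 := sol_v0 S1 0 (Rle_refl 0)).
assert (cu := sol_uc S1 0). assert (cv := sol_vc S1 0).
assert (cT : continuous (fun r => T2 (u1 r)) 0).
{ apply (c_comp T2 u1); [ | exact cu]. rewrite Hu0. eapply d_c, (d_Tfun cg L2). lra. }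
assert (cw : continuous (fun r => w2 (u1 r)) 0).
{ apply (c_comp w2 u1); [ | exact cu]. rewrite Hu0. eapply d_c, (ls_dw L2). lra. }
assert (cF : continuous (fun r => prim g (u1 r)) 0) by (apply (c_comp (prim g) u1); [apply c_prim, cg | exact cu]).
assert (Hw2 : 0 < w2 alpha1) by (apply (ls_w L2); lra).
assert (E1 : locally 0 (fun r => 0 < g (u1 r) - gl)).
{ apply (continuous_pos_locally (fun r => g (u1 r) - gl)); [ | rewrite Hu0; lra].
  apply c_minus; [ | apply c_const]. apply c_comp; [apply cg | exact cu]. }
assert (E2 : locally 0 (fun r => 0 < T2 (u1 r) - 2 * (INR n + 1) * prim g (u1 r) / gl - r * - v1 r)).
{ apply (continuous_pos_locally (fun r => T2 (u1 r) - 2 * (INR n + 1) * prim g (u1 r) / gl - r * - v1 r)).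
  - cont. lra.
  - rewrite Hu0, Hv0. lra. }
assert (E3 : locally 0 (fun r => 0 < w2 (u1 r) - - v1 r)).
{ apply (continuous_pos_locally (fun r => w2 (u1 r) - - v1 r)); [cont | rewrite Hu0, Hv0; lra]. }
assert (E4 : locally 0 (fun r => 0 < u1 r - beta)).
{ apply (continuous_pos_locally (fun r => u1 r - beta)); [cont | rewrite Hu0; lra]. }
destruct (filter_and _ _ (filter_and _ _ E1 E2) (filter_and _ _ E3 E4)) as [d Hd].
destruct (alive_open 0 Hg S1 (alive_0 Hg S1 A1)) as [d' [Hd' Hal]].
generalize (cond_pos d). intros Hdp.
destruct (exists_small 1 1 0 Hdp Hd' Rlt_0_1) as [r [Hr [Hrd [Hrd' _]]]].
assert (Hdr : forall t, 0 <= t <= r -> (0 < g (u1 t) - gl /\ 0 < T2 (u1 t) - 2 * (INR n + 1) * prim g (u1 t) / gl - t * - v1 t)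
    /\ 0 < w2 (u1 t) - - v1 t /\ 0 < u1 t - beta).
{ intros t Ht. apply Hd. change (Rabs (t - 0) < d). rewrite Rabs_pos_eq; lra. }
specialize (Hal r ltac:(lra)).
destruct (Hdr r ltac:(lra)) as [[_ H2] [H3 H4]].
apply (crosses_by_comparison n g b beta alpha1 u1 v1 alpha2 u2 v2 (u1 r)); try assumption.
- split; [lra | ]. rewrite <- Hu0. apply (alive_decr _ _ Hg S1 A1); try assumption. lra.
- apply Rlt_trans with alpha1; [ | exact A12]. rewrite <- Hu0.
  apply (alive_decr _ _ Hg S1 A1); try assumption. lra.
- unfold speed at 1. rewrite (radius_u r Hg S1 A1) by (try assumption; lra). fold w2. lra.
- apply Rle_lt_trans with (r * - v1 r + 2 * (INR n + 1) * prim g (u1 r) / gl); [ | fold T2; lra].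
  apply (Tfun_upper n g b beta alpha1); try assumption; try lra.
  + assert (H : v1 r <= - (gl * r / INR (S n))).
    { apply (slope_upper _ _ S1); [lra | ]. intros t Ht. destruct (Hdr t ltac:(lra)) as [[H _] _]. lra. }
    rewrite S_INR in H.
    apply (Rmult_le_compat_l (INR n + 1)) in H; [ | lra].
    replace ((INR n + 1) * - (gl * r / (INR n + 1))) with (- (gl * r)) in H by (field; lra). lra.
  + left. apply (prim_pos g b beta); [exact Hg | lra].
Qed.

(** * Concentrated solutions turn *)

Lemma prim_agree g1 g2 a s :
  (forall t, 0 <= t <= a -> g1 t = g2 t) -> 0 <= s <= a -> prim g1 s = prim g2 s.
Proof.
intros H Hs. apply RInt_ext. rewrite Rmin_left, Rmax_right by lra. intros t Ht. apply H. lra.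
Qed.

Lemma erbe_tang_agree n g1 g2 beta a :
  0 <= beta -> (forall t, 0 <= t <= a -> g1 t = g2 t) ->
  erbe_tang n g1 beta a -> erbe_tang n g2 beta a.
Proof.
intros Hb H HD s Hs. destruct (HD s Hs) as [D [H1 H2]]. exists D. split; [ | exact H2].
apply (is_derive_ext_loc (fun t => prim g1 t / g1 t)); [ | exact H1].
assert (Hp : 0 < Rmin (s - beta) (a - s)) by pos.
apply (near_intro s _ _ Hp). intros y Hy. generalize (Rmin_l (s - beta) (a - s)) (Rmin_r (s - beta) (a - s)). intros H3 H4.
now rewrite (prim_agree g1 g2 a), H by (try assumption; lra).
Qed.

Lemma alive_agree g1 g2 a u v r :
  (forall t, 0 <= t <= a -> g1 t = g2 t) -> (forall t, 0 <= t -> u t <= a) ->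
  alive g1 u v r -> alive g2 u v r.
Proof.
intros H Hu [Hr Hal]. split; [exact Hr | ]. intros t Ht. destruct (Hal t Ht) as [H1 H2].
split; [exact H1 | ]. unfold energy in *.
rewrite <- (prim_agree g1 g2 a) by (try assumption; generalize (Hu t); lra). exact H2.
Qed.

(** Compactness of a range of heights away from the center turns the strict inequalities for the
    speed and for [T] into a margin, available before [eps] and [A] are chosen. *)
Lemma comparison_margin n phi b beta alpha u v slo shi :
  (0 < n)%nat -> nonlin phi b beta -> sol n phi alpha u v -> beta < alpha ->
  erbe_tang n phi beta alpha -> beta < slo -> shi < alpha ->
  exists m, 0 < m /\ forall r, 0 < r -> alive phi u v r -> slo <= u r <= shi ->
    m <= - v r /\
    2 * (INR n + 1) * prim phi (u r) / phi (u r) + m <= r * - v r + 2 * prim phi (u r) * r / - v r.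
Proof.
intros Hn Hg Hs Ha HD Hlo Hhi. assert (cg := nl_cont Hg).
generalize (nl_b Hg) (nl_bbeta Hg). intros Hb Hbb.
destruct (alive_below_beta Hg Hs Ha) as [r0 [Hr0 [Hal0 Hur0]]].
assert (Hlev : forall s, slo <= s <= shi -> exists r, 0 < r /\ alive phi u v r /\ u r = s).
{ intros s Hss. destruct (alive_between r0 s Hg Hs Ha) as [q [Hq1 [Hq2 Hq3]]]; try assumption; [lra | ].
  exists q. split; [lra | split; assumption]. }
assert (L := level_system_of_sol slo shi Hg Hs Ha Hlev).
destruct (compact_pos_min (speed phi u v) slo shi) as [m1 [Hm1 Hm1']].
{ intros s Hss. eapply d_c, (ls_dw L s Hss). }
{ intros s Hss. apply (ls_w L s Hss). }
assert (Hphi : forall s, slo <= s <= shi -> 0 < phi s) by (intros s Hss; apply (nl_pos Hg); lra).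
destruct (compact_pos_min (fun s => Tfun phi (radius phi u v) (speed phi u v) s - 2 * (INR n + 1) * prim phi s / phi s) slo shi)
  as [m2 [Hm2 Hm2']].
{ intros s Hss. apply c_minus; [eapply d_c, (d_Tfun cg L Hss) | ].
  apply c_div; [apply c_mult; [apply c_const | apply c_prim, cg] | apply cg | apply Rgt_not_eq, Hphi, Hss]. }
{ intros s Hss. destruct (Hlev s Hss) as [r [Hr [Hal Hur]]].
  assert (H := erbe_tang_pos r Hg Hs Ha HD Hr Hal ltac:(lra)). rewrite Hur in H.
  specialize (Hphi s Hss). apply (Rmult_lt_reg_r (phi s)); [exact Hphi | ].
  rewrite Rmult_0_l, Rmult_minus_distr_r.
  replace (2 * (INR n + 1) * prim phi s / phi s * phi s) with (2 * (INR n + 1) * prim phi s) by (field; lra). lra. }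
exists (Rmin m1 m2). split; [now apply Rmin_glb_lt | ]. intros r Hr Hal Hur.
generalize (Rmin_l m1 m2) (Rmin_r m1 m2) (Hm1' (u r) Hur) (Hm2' (u r) Hur).
rewrite (Tfun_radius _ Hg Hs Ha) by assumption.
unfold speed at 1. rewrite (radius_u _ Hg Hs Ha) by assumption. lra.
Qed.

(** The flux acquired inside radius [r0] is not lost as long as [u > b]; up to radius [2 r0] the
    slope it represents shrinks at most by the factor [2^n]. *)
Lemma flux_concentrated n g b beta alpha u v K r0 q :
  nonlin g b beta -> sol n g alpha u v -> 0 < r0 -> r0 <= q <= 2 * r0 ->
  (forall t, 0 < t < q -> b < u t) -> (forall t, 0 < t < r0 -> K <= g (u t)) -> 0 <= K ->
  u q <= u r0 - K * r0 / (INR (S n) * 2 ^ n) * (q - r0).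
Proof.
intros Hg Hs Hr0 Hq Hub HK HK0.
assert (HN : 0 < INR (S n)) by pos.
assert (H2n : 0 < 2 ^ n) by pos.
apply (u_slope _ r0 q Hs ltac:(lra)). intros t Ht.
assert (H1 := slope_upper K r0 Hs Hr0 HK).
assert (H2 := flux_upper 0 r0 t Hs ltac:(lra)).
rewrite Rmult_0_l in H2. unfold Rdiv in H2 at 1. rewrite Rmult_0_l, Rminus_0_r in H2.
assert (H3 : t ^ n * v t <= r0 ^ n * v r0).
{ apply H2. intros x Hx. left. apply (nl_pos Hg), Hub. lra. }
assert (Htn : 0 < t ^ n) by pos.
assert (Htr : t ^ n <= 2 ^ n * r0 ^ n).
{ rewrite <- Rpow_mult_distr. apply pow_incr. lra. }
set (X := K * r0 / (INR (S n) * 2 ^ n)).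
assert (HX : 0 <= X) by pos.
assert (HX2 : K * r0 / INR (S n) = X * 2 ^ n) by (unfold X; field; lra).
rewrite HX2 in H1.
apply (Rmult_le_reg_l (t ^ n)); [exact Htn | ].
assert (r0 ^ n * v r0 <= - (X * (2 ^ n * r0 ^ n))) by nra.
assert (X * t ^ n <= X * (2 ^ n * r0 ^ n)) by (apply Rmult_le_compat_l; assumption).
lra.
Qed.

(** The flux [pa] from inside [ra] contributes a slope [pa / x^n], whose tail integral is at most
    [pa / ra^(n-1)] because [n >= 2]; the nonlinearity outside adds a slope of at most [M1 x]. *)
Lemma drop_bound n g alpha u v ra t pa M1 :
  (2 <= n)%nat -> sol n g alpha u v -> 0 < ra <= t ->
  - (ra ^ n * v ra) <= pa -> 0 <= M1 -> 0 <= pa ->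
  (forall x, ra < x < t -> g (u x) <= M1) ->
  (forall x, ra <= x <= t -> - v x <= pa / x ^ n + M1 * x) /\
  u ra - pa / ra ^ pred n - M1 * t ^ 2 <= u t.
Proof.
intros Hn Hs Hrt Hpa HM Hpa0 Hg.
assert (HN : 1 <= INR (S n)) by (apply (le_INR 1); lia).
assert (Hv : forall x, ra <= x <= t -> - v x <= pa / x ^ n + M1 * x).
{ intros x Hx.
  assert (H := flux_lower M1 ra x Hs ltac:(lra)).
  assert (Hxn : 0 < x ^ n) by pos.
  assert (H1 : ra ^ n * v ra - M1 * (x ^ S n - ra ^ S n) / INR (S n) <= x ^ n * v x).
  { apply H. intros y Hy. apply Hg. lra. }
  assert (H2 : M1 * (x ^ S n - ra ^ S n) / INR (S n) <= M1 * x ^ S n).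
  { apply (Rmult_le_reg_r (INR (S n))); [lra | ]. rewrite div_mult by lra.
    assert (0 <= M1 * x ^ S n) by pos.
    assert (0 <= M1 * ra ^ S n) by pos. nra. }
  apply (Rmult_le_reg_l (x ^ n)); [exact Hxn | ].
  replace (x ^ n * (pa / x ^ n + M1 * x)) with (pa + M1 * x ^ S n) by (simpl; field; lra). lra. }
split; [exact Hv | ].
destruct n as [ | m]; [lia | ]. simpl pred.
assert (Hm : 1 <= INR m) by (apply (le_INR 1); lia).
assert (H : u ra - pa / INR m / ra ^ m + M1 * ra ^ 2 <= u t - pa / INR m / t ^ m + M1 * t ^ 2).
{ apply (deriv_nonneg_le (fun x => u x - pa / INR m / x ^ m + M1 * x ^ 2)
     (fun x => v x + pa / x ^ S m + 2 * M1 * x)); [lra | | | ].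
  - intros x Hx. assert (Hu := sol_du Hs x ltac:(lra)).
    assert (Hxm : 0 < x ^ m) by pos.
    eapply d_eq; [deriv; lra | ]. cbv beta. destruct m as [ | k]; [simpl in Hm; lra | ].
    simpl pred. simpl (INR 2). rewrite <- !tech_pow_Rmult in *.
    assert (x ^ k <> 0) by (apply pow_nonzero; lra). field. repeat split; lra.
  - intros x Hx. assert (Hxm : 0 < x ^ m) by pos.
    cont; try lra. apply (sol_uc Hs).
  - intros x Hx. specialize (Hv x ltac:(lra)). assert (0 <= M1 * x) by pos. lra. }
assert (H1 : 0 <= pa / INR m / t ^ m) by pos.
assert (H2 : pa / INR m / ra ^ m <= pa / ra ^ m).
{ apply Rmult_le_compat_r; [pos | ].
  apply (Rmult_le_reg_r (INR m)); [lra | ]. rewrite div_mult by lra. nra. }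
assert (0 <= M1 * ra ^ 2) by pos.
lra.
Qed.

Lemma level_at_most {n g b beta alpha u v p q} :
  nonlin g b beta -> sol n g alpha u v -> beta < alpha -> alive g u v p -> alive g u v q ->
  u q <= u p -> p <= q.
Proof.
intros Hg Hs Ha Hp Hq Hu. apply Rnot_lt_le. intros H.
generalize (alive_decr q p Hg Hs Ha Hp). destruct Hq. lra.
Qed.

(** Lowering the denominator by [y <= phi/2] raises the quotient by at most [4 d F y / phi^2], hence
    by at most [4 d F y / f0^2]. *)
Lemma inverse_gap (F phi gam y m d f0 : R) :
  0 <= F -> 0 < f0 <= phi -> 0 < d -> 0 <= y -> y <= f0 / 2 -> gam = phi - y ->
  16 * d * F * y <= m * f0 ^ 2 ->
  2 * d * F / gam <= 2 * d * F / phi + m / 4.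
Proof.
intros HF Hf Hd Hy Hy2 -> Hm.
apply (Rmult_le_reg_r ((phi - y) * phi)); [nra | ].
replace (2 * d * F / (phi - y) * ((phi - y) * phi)) with (2 * d * F * phi) by (field; lra).
replace ((2 * d * F / phi + m / 4) * ((phi - y) * phi))
  with (2 * d * F * (phi - y) + m / 4 * ((phi - y) * phi)) by (field; lra).
assert (Hsq : f0 ^ 2 <= phi ^ 2) by nra.
assert (0 <= 16 * d * F * y) by pos.
assert (Hm0 : 0 <= m).
{ apply Rnot_lt_le. intros Hneg.   assert (0 < - m * f0 ^ 2) by pos. lra. }
assert (phi * phi / 2 <= (phi - y) * phi) by nra.
nra.
Qed.

(** The comparison is made at a fixed small radius [eta] of the concentrated solution. Its height
    [s1] lies in a window [[slo, shi]] below [alpha] that is independent of [eps] and [A], its speed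
    is small and its [T] close to [2N F/phi]; at that height the ground state is off its center by
    the margin [m]. *)
Lemma turns_above n phi b beta alpha us vs D0 K1 K2 :
  (2 <= n)%nat -> nonlin phi b beta -> sol n phi alpha us vs -> beta < alpha ->
  (forall r, 0 <= r -> 0 <= us r <= alpha) -> erbe_tang n phi beta alpha ->
  0 < D0 -> 0 < K1 <= K2 ->
  exists D epsbar Abar, 0 < D <= D0 /\ 0 < epsbar <= D / 4 /\ 0 < Abar /\
    forall eps A g, 0 < eps < epsbar -> Abar < A -> nonlin g b beta ->
      (forall s, 0 <= s <= alpha + eps -> g s = phi s) ->
      (forall s, alpha + eps <= s <= alpha + D -> g s <= K2 * A ^ 2) ->
      (forall s, alpha + 2 * eps <= s <= alpha + D -> K1 * A ^ 2 <= g s) ->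
      forall u v, sol n g (alpha + D) u v -> turns g u v.
Proof.
intros Hn Hphi Hus Ha Hus01 HD HD0 HK.
assert (Hn1 : (0 < n)%nat) by lia.
generalize (nl_b Hphi) (nl_bbeta Hphi). intros Hb Hbb.
assert (cphi := nl_cont Hphi).
assert (Hd1 : 1 <= INR (S n)) by (apply (le_INR 1); lia).
set (d1 := INR (S n)) in *.
assert (H2n : 1 <= 2 ^ n) by (apply pow_R1_Rle; lra).
set (gap := alpha - beta). assert (Hgap : 0 < gap) by pos.
assert (Hgap4 : 0 < gap / 4) by lra.
(* [16 K2 D / K1] will bound [pa / ra^(n-1)], the descent due to the flux of the layer; a quarter of
   the gap is granted to it. *)
destruct (exists_small 1 (16 * K2 / K1) 0 HD0 Hgap4 Rlt_0_1) as [D [HDpos [HD1 [HD2' _]]]].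
assert (HD2 : 16 * K2 * D / K1 <= gap / 4).
{ replace (16 * K2 * D / K1) with (16 * K2 / K1 * D) by (field; lra). lra. }
assert (HDgap : D <= gap / 64).
{ assert (16 * D <= 16 * K2 * D / K1); [ | lra].
  apply (Rmult_le_reg_r K1); [lra | ].
  replace (16 * K2 * D / K1 * K1) with (16 * K2 * D) by (field; lra). nra. }
(* The descent guaranteed between [r0] and [2 r0]. As [eps < drop/4], it brings the solution from
   [alpha + 2 eps] below [shi = alpha - drop/2]. *)
set (drop := K1 * D / (2 * K2 * 2 ^ n)).
assert (Hdrop : 0 < drop) by pos.
assert (HdropD : drop <= D).
{ apply (Rmult_le_reg_r (2 * K2 * 2 ^ n)); [nra | ].
  replace (drop * (2 * K2 * 2 ^ n)) with (K1 * D) by (unfold drop; field; split; nra).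
  replace (D * (2 * K2 * 2 ^ n)) with (D * K2 * (2 * 2 ^ n)) by ring.
 assert (0 <= D * K2) by nra. nra. }
set (shi := alpha - drop / 2). set (slo := alpha - gap / 2).
assert (Hslo : beta < slo) by (unfold slo, gap; lra).
assert (Hshi : slo < shi < alpha) by (unfold slo, shi; lra).
destruct (comparison_margin n phi b beta alpha us vs slo shi Hn1 Hphi Hus Ha HD Hslo ltac:(lra)) as [m [Hm Hmargin]].
destruct (compact_pos_min phi slo alpha) as [f0 [Hf0 Hf0']].
{ intros s _. apply cphi. }
{ intros s Hss. apply (nl_pos Hphi). lra. }
destruct (compact_max phi 0 (alpha + D0)) as [x1 [_ Hx1]]; [lra | intros s _; apply cphi | ].
set (M1 := phi x1) in *.
assert (HM1 : 0 < M1).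
{ eapply Rlt_le_trans; [ | apply (Hx1 alpha); lra]. apply (nl_pos Hphi). lra. }
set (Fm := prim phi alpha).
assert (HFm : 0 < Fm) by (apply (prim_pos phi b beta); assumption).
assert (Hmf : 0 < m * f0 ^ 2) by pos.
destruct (exists_small 2 (16 * d1 * Fm) 0 Hf0 Hmf Rlt_0_1) as [y0 [Hy0 [Hy1 [Hy2 _]]]].
assert (Hy0h : 0 < y0 / 2) by lra.
(* The ratio [k / eta]: a ball of radius [k] holds at most the fraction [kap] of the integral that
   makes up the flux at [eta]. *)
destruct (exists_small 2 M1 0 Rlt_0_1 Hy0h Rlt_0_1) as [kap [Hkap [Hkap1 [Hkap2 _]]]].
destruct (@Heine_cor2 phi slo alpha (fun s _ => proj2 (continuity_pt_filterlim phi s) (cphi s))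
  (mkposreal _ Hy0h)) as [del Hdel].
simpl in Hdel. generalize (cond_pos del). intros Hdelp.
destruct (exists_small 12 3 0 Hm Hdelp Rlt_0_1) as [sg [Hsg [Hsg1 [Hsg2 _]]]].
destruct (exists_small 1 M1 M1 Rlt_0_1 Hsg Hgap4) as [eta [Heta [Heta1 [Heta2 Heta3]]]].
set (k := kap * eta).
assert (Hk : 0 < k < eta) by (unfold k; nra).
assert (Hkn : 0 < k ^ n) by pos.
(* [C0 / A] will bound [2 r0] and [C1 / A] the flux [pa]; [A] is then taken so large that the layer
   fits into radius [k] and [pa / x^n <= sg] from [k] on. *)
set (C0 := 2 * sqrt (4 * d1 * D / K1)).
assert (HX : 0 < 4 * d1 * D / K1) by pos.
assert (HC0 : 0 < C0) by pos.
set (C1 := gap / 4 * C0). assert (HC1 : 0 < C1) by pos.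
destruct (exists_small C0 (C1 / k ^ n) 0 (proj1 Hk) Hsg Rlt_0_1) as [Ainv [HAi [HAi1 [HAi2 _]]]].
destruct (exists_small 4 4 0 HDpos Hdrop Rlt_0_1) as [eb [Heb [Heb1 [Heb2 _]]]].
exists D, eb, (/ Ainv).
split; [lra | split; [lra | split; [pos | ]]].
intros eps A g Heps HA Hg Hgphi HgK2 HgK1 u v Hs.
assert (HeD : eps < D / 4) by lra.
assert (Hed : eps < drop / 4) by lra.
assert (HA0 : 0 < A) by (apply Rlt_trans with (/ Ainv); [pos | exact HA]).
assert (HAA : / A < Ainv).
{ rewrite <- (Rinv_inv Ainv). apply Rinv_lt_contravar; [ | exact HA]. apply Rmult_lt_0_compat; pos. }
assert (HAsq : 0 < A ^ 2) by pos.
assert (HAk : C0 / A <= k) by (unfold Rdiv; nra).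
assert (HAs : C1 / A / k ^ n <= sg).
{ replace (C1 / A / k ^ n) with (C1 / k ^ n * / A) by (field; lra).
  assert (0 < C1 / k ^ n) by pos. nra. }
apply NNPP. intros Hnt.
set (a1 := alpha + D) in *. assert (Ha1 : beta < a1) by (unfold a1; lra).
assert (Hu0 := sol_u0 Hs 0 (Rle_refl 0)).
assert (Hlev : forall s, 0 < s < a1 -> exists r, 0 < r /\ alive g u v r /\ u r = s)
  by (intros s Hss; now apply (not_turns_levels n g b beta a1)).
destruct (Hlev (alpha + 2 * eps)) as [r0 [Hr0 [Hal0 Hur0]]]; [unfold a1; lra | ].
destruct (Hlev (alpha + eps)) as [ra [Hra [Hala Hura]]]; [unfold a1; lra | ].
destruct (Hlev shi) as [rh [Hrh [Halh Hurh]]]; [unfold a1; lra | ].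
destruct (Hlev beta) as [rb [Hrb [Halb Hurb]]]; [lra | ].
assert (Hdecr : forall p q, 0 <= p < q -> alive g u v q -> u q < u p).
{ intros p q Hpq Hq. apply (alive_decr _ _ Hg Hs Ha1); assumption. }
assert (Hmid : forall x q, 0 < x < q -> alive g u v q -> u q < u x < a1).
{ intros x q Hx Hq. split; [apply Hdecr; [lra | exact Hq] | ]. rewrite <- Hu0.
  apply Hdecr; [lra | ]. apply (alive_down _ Hq); lra. }
assert (Hr0u : K1 * A ^ 2 * r0 ^ 2 <= 4 * d1 * D).
{ assert (H : u r0 <= u (r0 / 2) - K1 * A ^ 2 * (r0 / 2) / d1 * (r0 - r0 / 2)).
  { apply (u_slope _ _ _ Hs); [lra | ]. intros t Ht.
    assert (H : v t <= - (K1 * A ^ 2 * t / d1)).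
    { apply (slope_upper _ _ Hs); [lra | ]. intros x Hx. apply HgK1.
      generalize (Hmid x r0 ltac:(lra) Hal0). lra. }
    eapply Rle_trans; [exact H | ]. apply Ropp_le_contravar.
    apply Rmult_le_compat_r; [pos | ].
    apply Rmult_le_compat_l; [nra | lra]. }
  assert (H3 := Hmid (r0 / 2) r0 ltac:(lra) Hal0). unfold a1 in H3.
  assert (H4 : K1 * A ^ 2 * (r0 / 2) / d1 * (r0 - r0 / 2) <= D) by lra.
  apply (Rmult_le_compat_l (4 * d1)) in H4; [ | lra].
  replace (4 * d1 * (K1 * A ^ 2 * (r0 / 2) / d1 * (r0 - r0 / 2))) with (K1 * A ^ 2 * r0 ^ 2) in H4 by (field; lra).
  exact H4. }
assert (Hr0l : d1 * D <= 2 * (K2 * A ^ 2 * r0 ^ 2)).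
{ assert (H : u 0 - K2 * A ^ 2 * r0 / d1 * (r0 - 0) <= u r0).
  { apply (u_slope_lower _ _ _ Hs); [lra | ]. intros t Ht.
    assert (H : - (K2 * A ^ 2 * t / d1) <= v t).
    { apply (slope_lower _ _ Hs); [lra | ]. intros x Hx. apply HgK2.
      generalize (Hmid x r0 ltac:(lra) Hal0). lra. }
    eapply Rle_trans; [ | exact H]. apply Ropp_le_contravar.
    apply Rmult_le_compat_r; [pos | ].
    apply Rmult_le_compat_l; [nra | lra]. }
  rewrite Hu0, Hur0 in H. unfold a1 in H.
  assert (H4 : D / 2 <= K2 * A ^ 2 * r0 / d1 * (r0 - 0)) by lra.
  apply (Rmult_le_compat_l (2 * d1)) in H4; [ | lra].
  replace (2 * d1 * (K2 * A ^ 2 * r0 / d1 * (r0 - 0))) with (2 * (K2 * A ^ 2 * r0 ^ 2)) in H4 by (field; lra).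
  lra. }
assert (Hrh2 : rh <= 2 * r0).
{ apply Rnot_lt_le. intros Hlt.
  assert (Hal2 := alive_down (2 * r0) Halh ltac:(lra)).
  assert (H := flux_concentrated n g b beta a1 u v (K1 * A ^ 2) r0 (2 * r0) Hg Hs Hr0 ltac:(lra)).
  fold d1 in H.
  assert (H1 : u (2 * r0) <= u r0 - K1 * A ^ 2 * r0 / (d1 * 2 ^ n) * (2 * r0 - r0)).
  { apply H; [ | | nra].
    - intros t Ht. generalize (Hdecr t rh ltac:(lra) Halh). lra.
    - intros x Hx. apply HgK1.
      generalize (Hmid x r0 ltac:(lra) Hal0). lra. }
  assert (H2 : drop <= K1 * A ^ 2 * r0 / (d1 * 2 ^ n) * (2 * r0 - r0)).
  { replace (K1 * A ^ 2 * r0 / (d1 * 2 ^ n) * (2 * r0 - r0))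
      with (K1 / (d1 * 2 ^ n * (2 * K2)) * (2 * (K2 * A ^ 2 * r0 ^ 2))) by (field; repeat split; lra).
    replace drop with (K1 / (d1 * 2 ^ n * (2 * K2)) * (d1 * D)) by (unfold drop; field; repeat split; lra).
    apply Rmult_le_compat_l; [ | exact Hr0l].
    left. apply Rdiv_lt_0_compat; [lra | ]. repeat apply Rmult_lt_0_compat; lra. }
  generalize (Hdecr (2 * r0) rh ltac:(lra) Halh). unfold shi in *. lra. }
assert (Hra2 : ra <= rh) by (apply (level_at_most Hg Hs Ha1); try assumption; lra).
assert (Hr0C : 2 * r0 <= C0 / A).
{ apply (Rmult_le_reg_r A); [exact HA0 | ]. replace (C0 / A * A) with C0 by (field; lra).
  unfold C0. rewrite Rmult_assoc. apply Rmult_le_compat_l; [lra | ].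
  apply Rsqr_incr_0_var; [ | apply sqrt_pos]. rewrite Rsqr_sqrt by lra. unfold Rsqr.
  apply (Rmult_le_reg_r K1); [lra | ]. replace (4 * d1 * D / K1 * K1) with (4 * d1 * D) by (field; lra). lra. }
set (pa := K2 * A ^ 2 * ra ^ S n / d1).
assert (Hran : 0 < ra ^ n) by pos.
assert (Hran1 : 0 < ra ^ S n) by pos.
assert (Hpa0 : 0 <= pa) by pos.
assert (Hpa : - (ra ^ n * v ra) <= pa).
{ assert (H : - (K2 * A ^ 2 * ra / d1) <= v ra).
  { apply (slope_lower _ _ Hs); [exact Hra | ]. intros x Hx. apply HgK2.
    generalize (Hmid x ra ltac:(lra) Hala). lra. }
  apply (Rmult_le_compat_l (ra ^ n)) in H; [ | lra].
  unfold pa. replace (K2 * A ^ 2 * ra ^ S n / d1) with (- (ra ^ n * - (K2 * A ^ 2 * ra / d1))) by (simpl; field; lra).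
  lra. }
assert (Hram : 0 < ra ^ pred n) by pos.
assert (Hpam : pa / ra ^ pred n <= gap / 4).
{ eapply Rle_trans; [ | exact HD2].
  assert (Hpow : ra ^ S n = ra ^ 2 * ra ^ pred n) by (rewrite <- pow_add; f_equal; lia).
  unfold pa. rewrite Hpow.
  replace (K2 * A ^ 2 * (ra ^ 2 * ra ^ pred n) / d1 / ra ^ pred n) with (K2 / (d1 * K1) * (K1 * A ^ 2 * ra ^ 2)) by (field; repeat split; lra).
  replace (16 * K2 * D / K1) with (K2 / (d1 * K1) * (16 * d1 * D)) by (field; lra).
  apply Rmult_le_compat_l; [left; apply Rdiv_lt_0_compat; nra | ].
  apply Rle_trans with (K1 * A ^ 2 * (2 * r0) ^ 2); [ | nra].
  apply Rmult_le_compat_l; [nra | ]. apply pow_incr. lra. }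
assert (HgM : forall x q, ra < x < q -> alive g u v q -> g (u x) <= M1).
{ intros x q Hx Hq.
  assert (Hx' := alive_down x Hq ltac:(lra)).
  generalize (Hdecr ra x ltac:(lra) Hx'). intros H1.
  assert (0 < u x) by (apply Hx'; lra).
  rewrite Hgphi by lra. apply Hx1. lra. }
(* Up to radius [eta] the layer flux and the nonlinearity below [alpha + eps] cost at most a quarter
   of the gap each, so [beta] is not reached. *)
assert (Hetab : eta < rb).
{ apply Rnot_le_lt. intros Hle.
  assert (Hrab : ra <= rb) by (apply (level_at_most Hg Hs Ha1); try assumption; lra).
  destruct (drop_bound n g a1 u v ra rb pa M1 Hn Hs ltac:(lra) Hpa ltac:(lra) Hpa0) as [_ H].
  { intros x Hx. apply (HgM x rb Hx Halb). }
  assert (M1 * rb ^ 2 <= gap / 4).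
  { apply Rle_trans with (M1 * eta); [ | lra]. apply Rmult_le_compat_l; [lra | nra]. }
  unfold gap in *. lra. }
assert (Hale := alive_down eta Halb ltac:(lra)).
assert (Hrhk : rh <= k) by lra.
destruct (drop_bound n g a1 u v ra eta pa M1 Hn Hs ltac:(lra) Hpa ltac:(lra) Hpa0) as [Hslope Hdropb].
{ intros x Hx. apply (HgM x eta Hx Hale). }
set (s1 := u eta) in *.
assert (Hs1lo : slo <= s1).
{ assert (M1 * eta ^ 2 <= gap / 4).
  { apply Rle_trans with (M1 * eta); [ | lra]. apply Rmult_le_compat_l; [lra | nra]. }
  unfold slo. lra. }
assert (Hs1hi : s1 < shi) by (rewrite <- Hurh; apply Hdecr; [lra | exact Hale]).
assert (Hpa1 : pa <= C1 / A).
{ assert (H : ra ^ pred n <= C0 / A).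
  {  assert (ra <= 1) by lra.
    destruct n as [ | [ | j]]; [lia | lia | ]. simpl pred. simpl pow.
    assert (0 <= ra ^ j <= 1).
    { split; [pos | ]. rewrite <- (pow1 j). apply pow_incr. lra. }
    nra. }
  replace pa with (pa / ra ^ pred n * ra ^ pred n) by (field; lra).
  unfold C1. replace (gap / 4 * C0 / A) with (gap / 4 * (C0 / A)) by (field; lra).
  apply Rmult_le_compat; [ | lra | exact Hpam | exact H].
  apply Rmult_le_pos; [exact Hpa0 | pos]. }
assert (Hv2 : forall x, k <= x <= eta -> - v x <= 2 * sg).
{ intros x Hx. eapply Rle_trans; [apply Hslope; lra | ].
  assert (M1 * x <= sg) by nra.
  assert (pa / x ^ n <= sg); [ | lra].
  eapply Rle_trans; [ | exact HAs]. unfold Rdiv at 1.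
  assert (Hxn : k ^ n <= x ^ n) by (apply pow_incr; lra).
  unfold Rdiv at 1. apply Rmult_le_compat; [exact Hpa0 | left; apply Rinv_0_lt_compat; lra | exact Hpa1 | ].
  apply Rinv_le_contravar; assumption. }
assert (Huk : u k - s1 <= 2 * sg).
{ assert (H : u k - 2 * sg * (eta - k) <= s1).
  { apply (u_slope_lower _ _ _ Hs); [lra | ]. intros t Ht. specialize (Hv2 t ltac:(lra)). lra. }
  assert (2 * sg * (eta - k) <= 2 * sg * 1) by (apply Rmult_le_compat_l; lra). lra. }
assert (Hs1f : f0 <= phi s1) by (apply Hf0'; lra).
(* On [[k, eta]] the height varies by at most [2 sg < del], so [g(u)] loses at most [y0/2] against
   [phi s1]; leaving out the ball of radius [k] costs the other [y0/2]. *)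
assert (Hflux : (phi s1 - y0) * eta <= (INR n + 1) * - v eta).
{ assert (Hfu := flux_upper (phi s1 - y0 / 2) k eta Hs ltac:(lra)).
  assert (H1 : eta ^ n * v eta <= k ^ n * v k - (phi s1 - y0 / 2) * (eta ^ S n - k ^ S n) / INR (S n)).
  { apply Hfu. intros t Ht.
    assert (Hta := alive_down t Hale ltac:(lra)).
    assert (H1 : s1 < u t) by (apply Hdecr; [lra | exact Hale]).
    assert (H2 : u t < u k) by (apply Hdecr; [lra | exact Hta]).
    assert (H3 : u t < shi) by (rewrite <- Hurh; apply Hdecr; [lra | exact Hta]).
    rewrite Hgphi by lra.
    specialize (Hdel (u t) s1 ltac:(lra) ltac:(lra)).
    rewrite Rabs_pos_eq in Hdel by lra. specialize (Hdel ltac:(lra)). apply Rabs_def2 in Hdel. lra. }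
  fold d1 in H1.
  assert (Hvk : v k < 0).
  { apply (alive_v k Hg Hs Ha1); [ | lra]. apply (alive_down _ Hale); lra. }
  assert (Hen : 0 < eta ^ n) by pos.
  assert (Hkk : k ^ S n <= kap * eta ^ S n).
  { unfold k. rewrite Rpow_mult_distr. apply Rmult_le_compat_r; [pos | ].
    rewrite <- tech_pow_Rmult. apply Rle_trans with (kap * 1); [ | lra]. apply Rmult_le_compat_l; [lra | ].
    rewrite <- (pow1 n). apply pow_incr. lra. }
  assert (H2 : (phi s1 - y0 / 2) * (eta ^ S n - k ^ S n) <= d1 * (eta ^ n * - v eta)).
  { apply (Rmult_le_compat_l d1) in H1; [ | lra].
    replace (d1 * (k ^ n * v k - (phi s1 - y0 / 2) * (eta ^ S n - k ^ S n) / d1))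
      with (d1 * (k ^ n * v k) - (phi s1 - y0 / 2) * (eta ^ S n - k ^ S n)) in H1 by (field; lra).
    assert (0 < d1 * (k ^ n * - v k)) by pos. lra. }
  assert (H3 : (phi s1 - y0 / 2) * (eta ^ S n * (1 - kap)) <= (phi s1 - y0 / 2) * (eta ^ S n - k ^ S n)).
  { apply Rmult_le_compat_l; lra. }
  assert (Hphile : phi s1 <= M1) by (apply Hx1; lra).
  assert (H4 : phi s1 - y0 <= (phi s1 - y0 / 2) * (1 - kap)).
  {     assert (0 <= kap * y0) by nra. nra. }
  apply (Rmult_le_reg_l (eta ^ n)); [exact Hen | ].
  replace (INR n + 1) with d1 by (unfold d1; rewrite S_INR; ring).
  assert (H5 : (phi s1 - y0) * eta ^ S n <= (phi s1 - y0 / 2) * (1 - kap) * eta ^ S n).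
  { apply Rmult_le_compat_r; [pos | exact H4]. }
  replace (eta ^ n * ((phi s1 - y0) * eta)) with ((phi s1 - y0) * eta ^ S n) by (simpl; ring). lra. }
assert (Husg : sol n g alpha us vs).
{ apply (sol_change n phi g); [exact Hus | ]. intros r Hr. symmetry. apply Hgphi.
  generalize (Hus01 r ltac:(lra)). lra. }
assert (Hgphi' : forall t, 0 <= t <= alpha -> g t = phi t) by (intros t Ht; apply Hgphi; lra).
assert (HDg : erbe_tang n g beta alpha).
{ apply (erbe_tang_agree n phi g); [lra | | exact HD]. intros t Ht. symmetry. now apply Hgphi'. }
destruct (alive_below_beta Hg Husg Ha) as [q0 [Hq0 [Halq0 Huq0]]].
destruct (alive_between q0 s1 Hg Husg Ha) as [q [Hq1 [Hq2 Hq3]]]; try assumption; [lra | ].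
destruct (Hmargin q) as [Hm1 Hm2]; [lra | | lra | ].
{ apply (alive_agree g phi alpha); [exact Hgphi' | | exact Hq2]. intros t Ht. apply Hus01, Ht. }
assert (HF : prim g s1 = prim phi s1) by (apply (prim_agree g phi alpha); [exact Hgphi' | lra]).
assert (HFs : 0 < prim phi s1) by (apply (prim_pos phi b beta); [exact Hphi | lra]).
assert (HFle : prim phi s1 <= Fm) by (left; apply (prim_lt phi b beta); [exact Hphi | lra]).
(* The solution assumed not to turn is the slower one and the ground state the steeper one; a
   crossing contradicts the nonnegativity of the latter. *)
assert (Hcr : crosses g us vs).
{ apply (crosses_by_comparison n g b beta a1 u v alpha us vs s1); try assumption.
  - unfold a1. lra.
  - lra.
  - unfold speed. rewrite <- Hq3 at 2. rewrite (radius_u q Hg Husg Ha) by (try assumption; lra).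
    unfold s1. rewrite (radius_u eta Hg Hs Ha1) by assumption.
    specialize (Hv2 eta ltac:(lra)). lra.
  - assert (HTs : Tfun g (radius g us vs) (speed g us vs) s1 = q * - vs q + 2 * prim g (us q) * q / - vs q).
    { rewrite <- Hq3. apply (Tfun_radius _ Hg Husg Ha); try assumption; lra. }
    rewrite HTs, Hq3, HF. rewrite Hq3 in Hm2.
    assert (HT1 : Tfun g (radius g u v) (speed g u v) s1 <=
      eta * - v eta + 2 * (INR n + 1) * prim g s1 / (phi s1 - y0)).
    { apply (Tfun_upper n g b beta a1); try assumption; [lra | ]. fold s1. lra. }
    rewrite HF in HT1.
    assert (Hi : 2 * (INR n + 1) * prim phi s1 / (phi s1 - y0) <= 2 * (INR n + 1) * prim phi s1 / phi s1 + m / 4).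
    { apply (inverse_gap _ _ _ y0 m _ f0); try lra.
      - unfold d1 in Hd1. rewrite S_INR in Hd1. lra.
      - replace (INR n + 1) with d1 by (unfold d1; rewrite S_INR; ring).
        eapply Rle_trans; [ | left; exact Hy2]. apply Rmult_le_compat_r; [lra | ]. apply Rmult_le_compat_l; lra. }
    specialize (Hv2 eta ltac:(lra)).
    assert (eta * - v eta <= 1 * (2 * sg)).
    { apply Rmult_le_compat; try lra. left. generalize (alive_v eta Hg Hs Ha1 Hale Heta). lra. }
    lra. }
destruct Hcr as [r [Hr [Hneg _]]]. generalize (Hus01 r Hr). lra.
Qed.

(** * Pohozaev identity and large heights *)

Definition pohozaev (n : nat) (g u v : R -> R) (r : R) : R :=
  2 * (r ^ S n * energy g u v r) + (INR n - 1) * (u r * (r ^ n * v r)).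

(** The derivative of [pohozaev] is [r^n Q(u)]. *)
Lemma pohozaev_lower {n g alpha u v} K r1 r2 :
  (forall s, continuous g s) -> sol n g alpha u v -> 0 <= r1 <= r2 ->
  (forall t, r1 < t < r2 -> K <= Qfun (S n) g (u t)) ->
  pohozaev n g u v r1 + K * (r2 ^ S n - r1 ^ S n) / INR (S n) <= pohozaev n g u v r2.
Proof.
intros cg Hs Hr HK. assert (HN : 0 < INR (S n)) by pos.
assert (H : pohozaev n g u v r1 - K * r1 ^ S n / INR (S n) <= pohozaev n g u v r2 - K * r2 ^ S n / INR (S n)).
{ apply (deriv_nonneg_le (fun t => pohozaev n g u v t - K * t ^ S n / INR (S n))
    (fun t => t ^ n * (Qfun (S n) g (u t) - K))); [lra | | | ].
  - intros x Hx. unfold pohozaev.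
    assert (Du := sol_du Hs x ltac:(lra)).
    assert (DE := d_energy x cg Hs ltac:(lra)).
    assert (Df := d_flux x Hs ltac:(lra)).
    eapply d_eq; [deriv; lra | ]. cbv beta. unfold Qfun, energy. rewrite (S_INR n) in *.
    simpl pred. rewrite <- !tech_pow_Rmult. field. lra.
  - intros x Hx. unfold pohozaev.
    assert (cu := sol_uc Hs x). assert (cv := sol_vc Hs x).
    assert (cE := c_energy x cg Hs). cont. lra.
  - intros x Hx. specialize (HK x Hx). apply Rmult_le_pos; [pos | lra]. }
unfold Rdiv in *. nra.
Qed.

Lemma pow_S_Rpower n r : 0 < r -> r ^ S n = Rpower (r ^ 2) (INR (S n) / 2).
Proof.
intros Hr. rewrite <- Rpower_pow by exact Hr. rewrite <- (Rpower_pow 2 r Hr), Rpower_mult.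
f_equal. simpl (INR 2). field.
Qed.

(** Let [rb] be the radius at which [bbar] is reached. If [rb <= rho/2], the Pohozaev value gained
    above [theta alpha] outweighs all losses up to [rho]; the energy left forces a slope of at least
    one, and positivity ends before [rho]. If [rb > rho/2], friction is so weak that the last
    descent consumes at most half of the energy at [rb]. The conclusion covers every [g] agreeing
    with [h] up to [alpha], since the cut-off depends on that height. *)
Lemma crosses_large n h b beta bbar theta S0 :
  (2 <= n)%nat -> nonlin h b beta -> beta < bbar -> 0 < theta < 1 ->
  (forall s, bbar < s -> 0 < Qfun (S n) h s) ->
  (forall M s0, exists s, s0 < s /\
     forall s1 s2, theta * s <= s1 <= s -> theta * s <= s2 <= s ->
       M <= Qfun (S n) h s2 * Rpower (s / h s1) (INR (S n) / 2)) ->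
  exists alpha, S0 < alpha /\ forall g, nonlin g b beta -> (forall s, 0 <= s <= alpha -> g s = h s) ->
    forall u v, sol n g alpha u v -> crosses g u v.
Proof.
intros Hn Hh Hbbar Hth HQ Hcond.
generalize (nl_b Hh) (nl_bbeta Hh). intros Hb Hbb.
assert (ch := nl_cont Hh).
assert (Hd : 1 <= INR n) by (apply (le_INR 1); lia).
assert (Hnn : INR (S n) = INR n + 1) by apply S_INR.
set (nn := INR (S n)) in *.
destruct (compact_bound (prim h) 0 bbar) as [C [HC Hx1]]; [lra | intros; apply c_prim, ch | ].
assert (HCF : forall s, 0 <= s <= bbar -> - C <= prim h s <= C).
{ intros s Hs. apply Rabs_le_between. apply (Hx1 s Hs). }
destruct (compact_bound (Qfun (S n) h) 0 bbar) as [K0 [HK0 Hx2]]; [lra | | ].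
{ intros s _. unfold Qfun.
  assert (continuous (prim h) s) by apply c_prim, ch.  cont. }
(* Besides bounding [-Q] on [[0, bbar]], [K] satisfies [K / (2N) >= C + 1], so that an energy of
   that size exceeds [F] by at least one. *)
set (K := K0 + 2 * nn * (C + 1)) in *.
assert (HKnn : 2 * nn * (C + 1) <= K) by (unfold K; lra).
assert (HK : 0 < K) by nra.
assert (HQK : forall s, 0 <= s <= bbar -> - K <= Qfun (S n) h s).
{ intros s Hs. specialize (Hx2 s Hs).
  assert (Rabs (Qfun (S n) h s) <= K) by (unfold K; nra). apply Rabs_le_between in H. lra. }
set (Fb := prim h bbar). assert (HFb : 0 < Fb) by (apply (prim_pos h b beta); assumption).
set (Z := 2 + (2 * C + 1) / Fb).
assert (HZ : 0 < Z). { assert (0 < (2 * C + 1) / Fb) by pos. unfold Z; lra. }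
(* The summand [2 bbar + 1] leaves room for a descent from [bbar] at unit slope between [rho/2] and
   [rho]; the last one tames the friction beyond [rho/2], [Z] being a bound for the later quotient
   [V / Eb]. *)
set (rho := 2 * bbar + 1 + 4 * (INR n * bbar * Z)).
assert (Hnb : 0 < INR n * bbar * Z) by pos.
assert (Hthn : 0 < nn * (1 - theta)) by pos.
(* Falling from [alpha] to [theta alpha] takes [rt^2 >= N (1 - theta) alpha / gm], so that the
   Pohozaev value at [rt] is at least [c M]; [M] makes this twice the possible loss
   [K rho^N / N]. *)
set (c := Rpower (nn * (1 - theta)) (nn / 2) / nn).
assert (Hc : 0 < c) by pos.
set (M := 2 * K * rho ^ S n / nn / c).
destruct (Hcond M (Rmax (Rmax S0 beta) (bbar / theta))) as [alpha [Halpha HMQ]].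
assert (Ha0 : S0 < alpha) by (eapply Rle_lt_trans; [ | exact Halpha]; eapply Rle_trans; [apply Rmax_l | apply Rmax_l]).
assert (Ha1 : beta < alpha) by (eapply Rle_lt_trans; [ | exact Halpha]; eapply Rle_trans; [apply Rmax_r | apply Rmax_l]).
assert (Ha2 : bbar < theta * alpha).
{ assert (H : bbar / theta < alpha) by (eapply Rle_lt_trans; [apply Rmax_r | exact Halpha]).
  apply (Rmult_lt_compat_l theta) in H; [ | lra].
  replace (theta * (bbar / theta)) with bbar in H by (field; lra). exact H. }
exists alpha. split; [exact Ha0 | ]. intros g Hg Hgh u v Hs.
assert (cg := nl_cont Hg).
assert (Hprim : forall s, 0 <= s <= alpha -> prim g s = prim h s) by (intros s Hss; now apply (prim_agree g h alpha)).
assert (HQg : forall s, 0 <= s <= alpha -> Qfun (S n) g s = Qfun (S n) h s).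
{ intros s Hss. unfold Qfun. now rewrite Hprim, Hgh. }
assert (Hu0 := sol_u0 Hs 0 (Rle_refl 0)).
assert (Hdecr : forall p q, 0 <= p < q -> alive g u v q -> u q < u p).
{ intros p q Hpq Hq. apply (alive_decr _ _ Hg Hs Ha1); assumption. }
assert (Hta : theta * alpha < alpha) by nra.
destruct (alive_below_beta Hg Hs Ha1) as [q0 [Hq0 [Halq0 Huq0]]].
destruct (alive_between q0 (theta * alpha) Hg Hs Ha1) as [rt [Hrt1 [Halt Hurt]]]; try assumption; [lra | ].
destruct (alive_between q0 bbar Hg Hs Ha1) as [rb [Hrb1 [Halb Hurb]]]; try assumption; [lra | ].
assert (Hrtb : rt < rb).
{ apply Rnot_le_lt. intros [H | H]; [generalize (Hdecr rb rt ltac:(lra) Halt); lra | subst; lra]. }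
(* (GST) is used with the maximizer [x3] as [s1] and the current height as [s2]. *)
destruct (compact_max h (theta * alpha) alpha) as [x3 [Hx3 Hx3']]; [lra | intros s _; apply ch | ].
set (gm := h x3) in *. assert (Hgm : 0 < gm) by (apply (nl_pos Hh); lra).
assert (Hrange : forall t, 0 < t < rt -> theta * alpha < u t < alpha).
{ intros t Ht. rewrite <- Hurt. split; [apply Hdecr; [lra | exact Halt] | ].
  rewrite <- Hu0. apply Hdecr; [lra | ]. apply (alive_down _ Halt); lra. }
assert (Hrt2 : nn * (1 - theta) * (alpha / gm) <= rt ^ 2).
{ assert (H : u 0 - gm * rt / nn * (rt - 0) <= u rt).
  { apply (u_slope_lower _ _ _ Hs); [lra | ]. intros t Ht.
    assert (H : - (gm * t / nn) <= v t).
    { apply (slope_lower _ _ Hs); [lra | ]. intros x Hx.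
      destruct (Hrange x ltac:(lra)). rewrite Hgh by lra. apply Hx3'. lra. }
    eapply Rle_trans; [ | exact H]. apply Ropp_le_contravar.
    apply Rmult_le_compat_r; [pos | ].
    apply Rmult_le_compat_l; lra. }
  rewrite Hu0, Hurt in H.
  assert (H4 : (1 - theta) * alpha <= gm * rt / nn * (rt - 0)) by lra.
  apply (Rmult_le_compat_l (nn / gm)) in H4; [ | left; apply Rdiv_lt_0_compat; lra].
  replace (nn / gm * (gm * rt / nn * (rt - 0))) with (rt ^ 2) in H4 by (field; lra).
  replace (nn * (1 - theta) * (alpha / gm)) with (nn / gm * ((1 - theta) * alpha)) by (field; lra). exact H4. }
assert (Hag : 0 < alpha / gm) by pos.
set (P := Rpower (alpha / gm) (nn / 2)). assert (HP : 0 < P) by pos.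
assert (Hpow : nn * c * P <= rt ^ S n).
{ rewrite pow_S_Rpower by lra. fold nn.
  replace (nn * c * P) with (Rpower (nn * (1 - theta)) (nn / 2) * P) by (unfold c; field; lra).
  unfold P. rewrite Rpower_mult_distr by assumption. apply Rle_Rpower_l; [lra | ].
  split; [now apply Rmult_lt_0_compat | exact Hrt2]. }
assert (HY0 : pohozaev n g u v 0 = 0).
{ unfold pohozaev. rewrite (sol_v0 Hs 0) by lra. rewrite (pow_i (S n)) by lia. ring. }
assert (HYt : c * M <= pohozaev n g u v rt).
{ assert (H := pohozaev_lower (M / P) 0 rt cg Hs ltac:(lra)).
  rewrite HY0, (pow_i (S n)) in H by lia. fold nn in H.
  eapply Rle_trans; [ | apply H].
  - rewrite Rplus_0_l, Rminus_0_r.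
    replace (c * M) with (M / P / nn * (nn * c * P)) by (field; lra).
    replace (M / P * rt ^ S n / nn) with (M / P / nn * rt ^ S n) by (field; lra).
    apply Rmult_le_compat_l; [ | exact Hpow]. left. apply Rdiv_lt_0_compat; [pos | lra].
  - intros t Ht. destruct (Hrange t Ht) as [Ht1 Ht2]. rewrite HQg by lra.
    assert (H1 := HMQ x3 (u t) Hx3 ltac:(lra)). fold gm P nn in H1.
    apply (Rmult_le_reg_r P); [exact HP | ]. rewrite div_mult by lra. exact H1. }
assert (HYb : c * M <= pohozaev n g u v rb).
{ assert (H := pohozaev_lower 0 rt rb cg Hs ltac:(lra)).
  unfold Rdiv in H. rewrite !Rmult_0_l, Rplus_0_r in H.
  eapply Rle_trans; [exact HYt | ]. apply H. intros t Ht.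
  assert (Hat := alive_down t Halb ltac:(lra)).
  generalize (Hdecr t rb ltac:(lra) Halb) (Hdecr rt t ltac:(lra) Hat). intros H1 H2.
  rewrite HQg by lra. left. apply HQ. lra. }
assert (Hbelow : forall r, rb <= r -> alive g u v r -> 0 < u r <= bbar).
{ intros r Hr Hal. split; [apply Hal; lra | ]. destruct Hr as [Hr | <-]; [ | lra].
  generalize (Hdecr rb r ltac:(lra) Hal). lra. }
assert (HvE : forall r, rb <= r -> alive g u v r -> v r < 0 /\ v r ^ 2 / 2 = energy g u v r - prim h (u r)).
{ intros r Hr Hal. split; [apply (alive_v _ Hg Hs Ha1); try assumption; lra | ].
  unfold energy. rewrite Hprim; [ring | ]. generalize (Hbelow r Hr Hal). lra. }
assert (HcM : c * M = 2 * K * rho ^ S n / nn) by (unfold M; field; lra).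
assert (HYr : forall r, rb <= r <= rho -> alive g u v r -> K / (2 * nn) <= energy g u v r).
{ intros r Hr Hal.
  assert (Hrn : 0 < r ^ S n) by pos.
  assert (H := pohozaev_lower (- K) rb r cg Hs ltac:(lra)). fold nn in H.
  assert (H1 : c * M - K * r ^ S n / nn <= pohozaev n g u v r).
  { eapply Rle_trans; [ | apply H].
    - assert (0 <= K * rb ^ S n / nn) by pos.
      unfold Rdiv in *. lra.
    - intros t Ht. assert (Hat := alive_down t Hal ltac:(lra)).
      generalize (Hbelow t ltac:(lra) Hat). intros. rewrite HQg by lra. apply HQK. lra. }
  assert (Hrr : r ^ S n <= rho ^ S n) by (apply pow_incr; lra).
  assert (H2 : pohozaev n g u v r <= 2 * (r ^ S n * energy g u v r)).
  { unfold pohozaev. destruct (HvE r ltac:(lra) Hal) as [Hv _]. generalize (Hbelow r ltac:(lra) Hal). intros Hu.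
    assert (0 <= (INR n - 1) * (u r * (r ^ n * - v r))) by pos.
    lra. }
  assert (H3 : K * r ^ S n / nn <= K * rho ^ S n / nn).
  { apply Rmult_le_compat_r; [pos | ]. apply Rmult_le_compat_l; lra. }
  apply (Rmult_le_reg_l (2 * r ^ S n)); [lra | ].
  replace (2 * r ^ S n * (K / (2 * nn))) with (K * r ^ S n / nn) by (field; lra).
  rewrite HcM in H1. unfold Rdiv in *. lra. }
destruct (Rle_lt_dec rb (rho / 2)) as [Hcase | Hcase].
- assert (Hmax : forall r, rb <= r -> alive g u v r -> r <= rho).
  { intros r Hr Hal. apply Rnot_lt_le. intros Hlt.
    assert (Hal' := alive_down rho Hal ltac:(lra)).
    assert (H : u rho <= u rb - 1 * (rho - rb)).
    { apply (u_slope _ _ _ Hs); [lra | ]. intros t Ht.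
      assert (Hat := alive_down t Hal ltac:(lra)).
      destruct (HvE t ltac:(lra) Hat) as [Hv Hv2].
      generalize (HYr t ltac:(lra) Hat) (HCF (u t)) (Hbelow t ltac:(lra) Hat). intros H1 H2 H3.
      specialize (H2 ltac:(lra)).
      assert (C + 1 <= K / (2 * nn)).
      { apply (Rmult_le_reg_r (2 * nn)); [lra | ]. rewrite div_mult by lra. lra. }
      nra. }
    generalize (Hbelow rho ltac:(lra) Hal'). unfold rho in *. lra. }
  assert (HKn : 0 < K / (2 * nn)) by pos.
  apply (crosses_of_energy (rb ^ 2 * (K / (2 * nn))) rb Hg Hs Ha1); try assumption; try lra.
  + apply Rmult_lt_0_compat; [pos | exact HKn].
  + intros r Hr Hal. specialize (HYr r (conj Hr (Hmax r Hr Hal)) Hal).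
    apply Rmult_le_compat; [apply pow2_ge_0 | lra | apply pow_incr; lra | exact HYr].
- set (Eb := energy g u v rb).
  assert (HEb : Fb <= Eb).
  { destruct (HvE rb ltac:(lra) Halb) as [_ H]. rewrite Hurb in H. fold Fb Eb in H.
    generalize (pow2_ge_0 (v rb)). lra. }
  set (V := 2 * Eb + 2 * C + 1).
  assert (HVE : INR n * V * bbar <= rb * (Eb / 2)).
  { assert (HV : V <= Z * Eb).
    { unfold V, Z. assert (2 * C + 1 <= (2 * C + 1) / Fb * Eb); [ | lra].
      apply (Rmult_le_reg_r Fb); [exact HFb | ].
      replace ((2 * C + 1) / Fb * Eb * Fb) with ((2 * C + 1) * Eb) by (field; lra).
      apply Rmult_le_compat_l; lra. }
    apply Rle_trans with (INR n * bbar * Z * Eb).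
    - replace (INR n * V * bbar) with (INR n * bbar * V) by ring.
      rewrite (Rmult_assoc (INR n * bbar) Z Eb). apply Rmult_le_compat_l; [ | exact HV]. apply Rmult_le_pos; lra.
    - assert (2 * (INR n * bbar * Z) <= rb) by (unfold rho in Hcase; lra). nra. }
  assert (HEr : forall r, rb <= r -> alive g u v r -> Eb / 2 <= energy g u v r).
  { intros r Hr Hal.
    (* Per unit of height descended, friction takes [n |v| / r <= n V / rb]; the whole descent from
       [bbar] thus costs at most [n V bbar / rb <= Eb / 2]. *)
    assert (H : energy g u v rb - INR n * V / rb * u rb <= energy g u v r - INR n * V / rb * u r).
    { apply (deriv_nonneg_le (fun t => energy g u v t - INR n * V / rb * u t)
        (fun t => INR n * - v t * (V / rb - - v t / t))); [exact Hr | | | ].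
      - intros x Hx. assert (Du := sol_du Hs x ltac:(lra)).
        assert (DE := d_energy x cg Hs ltac:(lra)).
        eapply d_eq; [deriv | ]. cbv beta. field. lra.
      - intros x Hx. assert (cE := c_energy x cg Hs). cont. apply (sol_uc Hs).
      - intros x Hx. assert (Hax := alive_down x Hal ltac:(lra)).
        destruct (HvE x ltac:(lra) Hax) as [Hv Hv2].
        assert (Hx0 : 0 <= u x <= bbar) by (generalize (Hbelow x ltac:(lra) Hax); lra).
        generalize (HCF (u x) Hx0) (energy_le rb x cg Hs ltac:(lra)). fold Eb. intros H1 H2.
        assert (HvV : - v x <= V) by (unfold V; nra).
        apply Rmult_le_pos; [pos | ].
        assert (- v x / x <= V / rb); [ | lra].
        apply Rmult_le_compat; [lra | left; apply Rinv_0_lt_compat; lra | exact HvV | ].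
        apply Rinv_le_contravar; lra. }
    fold Eb in H. rewrite Hurb in H.
    assert (HV0 : 0 <= INR n * V / rb * u r).
    { apply Rmult_le_pos; [ | left; apply (Hbelow r Hr Hal)].
      apply Rmult_le_pos; [ | pos]. apply Rmult_le_pos; [lra | unfold V; lra]. }
    assert (INR n * V / rb * bbar <= Eb / 2); [ | lra].
    apply (Rmult_le_reg_l rb); [lra | ].
    replace (rb * (INR n * V / rb * bbar)) with (INR n * V * bbar) by (field; lra). exact HVE. }
  apply (crosses_of_energy (rb ^ 2 * (Eb / 2)) rb Hg Hs Ha1); try assumption; try lra.
  + apply Rmult_lt_0_compat; [pos | lra].
  + intros r Hr Hal. specialize (HEr r Hr Hal).
    apply Rmult_le_compat; [apply pow2_ge_0 | lra | apply pow_incr; lra | exact HEr].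
Qed.

(** * Shooting without uniqueness *)

(** Along one ultrafilter bounded sequences converge at all radii at once, which replaces a diagonal
    extraction, and every alternative on the indices is decided. *)
Lemma ultrafilter_nat :
  exists U : (nat -> Prop) -> Prop,
    ProperFilter U /\ (forall P : nat -> Prop, U P \/ U (fun n => ~ P n)) /\
    forall n0, U (fun n => (n0 <= n)%nat).
Proof.
assert (FF : filter.ProperFilter (eventually : (nat -> Prop) -> Prop)).
{ split.
  - intros [m Hm]. exact (Hm m (le_n m)).
  - split.
    + exists 0%nat. intros n _. exact I.
    + intros P Q [m Hm] [k Hk]. exists (Nat.max m k). intros n Hn.
      split; [apply Hm | apply Hk]; lia.
    + intros P Q PQ [m Hm]. exists m. intros n Hn. apply PQ, Hm, Hn. }
destruct (filter.ultraFilterLemma FF) as [U [UU EU]].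
destruct (@filter.ultra_proper _ _ UU) as [U0 [UT UI US]].
exists U. split; [ | split].
- split.
  + intros P HP. apply NNPP. intros Hn. apply U0.
    apply (US P); [ | exact HP]. intros x Hx. apply Hn. now exists x.
  + split; [exact UT | exact UI | ].
    intros P Q PQ. exact (US P Q PQ).
- intros P. destruct (filter.in_ultra_setVsetC P UU) as [H | H]; [now left | now right].
- intros n0. apply EU. exists n0. auto.
Qed.

(** * Integrated form of the radial equation *)

Lemma ex_RInt_c (h : R -> R) a b : (forall s, continuous h s) -> ex_RInt h a b.
Proof. intros Hh. apply (@ex_RInt_continuous R_CompleteNormedModule). intros; apply Hh. Qed.

Lemma d_RInt (h : R -> R) (r : R) :
  (forall s, continuous h s) -> is_derive (fun t => RInt h 0 t) r (h r).
Proof. exact (d_prim h r). Qed.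

Lemma bound_nonneg (g : R -> R) M : (forall s, Rabs (g s) <= M) -> 0 <= M.
Proof. intros H. eapply Rle_trans; [apply Rabs_pos | apply (H 0)]. Qed.

Lemma RInt_abs_le (h : R -> R) a b K :
  (forall s, continuous h s) -> a <= b -> (forall s, a <= s <= b -> Rabs (h s) <= K) ->
  Rabs (RInt h a b) <= K * (b - a).
Proof.
intros Hh Hab HK. rewrite Rmult_comm. apply abs_RInt_le_const; [exact Hab | | exact HK].
now apply ex_RInt_c.
Qed.

Lemma RInt_minus_c (h1 h2 : R -> R) a b :
  (forall s, continuous h1 s) -> (forall s, continuous h2 s) ->
  RInt h1 a b - RInt h2 a b = RInt (fun s => h1 s - h2 s) a b.
Proof.
intros H1 H2. symmetry. apply (@RInt_minus R_CompleteNormedModule); now apply ex_RInt_c.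
Qed.

(** With [h = g(u)] this is [- u']. The value [0] for [t <= 0] is the limit at the center and makes
    the function continuous on the whole line. *)
Definition avg (n : nat) (h : R -> R) (t : R) : R :=
  if Rle_dec t 0 then 0 else RInt (fun s => s ^ n * h s) 0 t / t ^ n.

Lemma avg_neg n h t : t <= 0 -> avg n h t = 0.
Proof. intros H. unfold avg. destruct (Rle_dec t 0); [reflexivity | lra]. Qed.

Lemma RInt_avg_neg n h r : r <= 0 -> RInt (avg n h) 0 r = 0.
Proof.
intros Hr. rewrite (RInt_ext _ (fun _ => 0)).
- rewrite RInt_const. apply Rmult_0_r.
- rewrite Rmin_right, Rmax_left by lra. intros x Hx. apply avg_neg. lra.
Qed.

Lemma c_weight n (h : R -> R) : (forall s, continuous h s) -> forall s, continuous (fun s => s ^ n * h s) s.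
Proof. intros Hh s. cont. Qed.

Lemma avg_bound n h K t :
  (forall s, continuous h s) -> 0 <= t -> (forall s, 0 <= s <= t -> Rabs (h s) <= K) ->
  Rabs (avg n h t) <= K * t.
Proof.
intros Hh Ht HK.
assert (HK0 : 0 <= K) by (eapply Rle_trans; [apply Rabs_pos | apply (HK 0); lra]).
unfold avg. destruct (Rle_dec t 0) as [H | H].
- rewrite Rabs_R0. nra.
- assert (Htn : 0 < t ^ n) by pos.
  unfold Rdiv. rewrite Rabs_mult, (Rabs_pos_eq (/ t ^ n)) by pos.
  apply (Rmult_le_reg_r (t ^ n)); [exact Htn | ].
  rewrite Rmult_assoc, Rinv_l, Rmult_1_r by lra.
  replace (K * t * t ^ n) with (t ^ n * K * (t - 0)) by ring.
  apply RInt_abs_le; [now apply c_weight | exact Ht | ].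
  intros s Hs. rewrite Rabs_mult, (Rabs_pos_eq (s ^ n)) by pos.
  apply Rmult_le_compat; [pos | apply Rabs_pos | apply pow_incr; lra | now apply HK].
Qed.

Lemma avg_minus n h1 h2 t :
  (forall s, continuous h1 s) -> (forall s, continuous h2 s) ->
  avg n h1 t - avg n h2 t = avg n (fun s => h1 s - h2 s) t.
Proof.
intros H1 H2. unfold avg. destruct (Rle_dec t 0) as [H | H]; [ring | ].
transitivity ((RInt (fun s => s ^ n * h1 s) 0 t - RInt (fun s => s ^ n * h2 s) 0 t) / t ^ n).
- field. apply pow_nonzero. lra.
- rewrite RInt_minus_c by now apply c_weight. f_equal.
  apply RInt_ext. intros. match goal with |- @eq _ ?x ?y => change (@eq R x y) end. ring.
Qed.

Lemma avg_ext n h1 h2 t :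
  (forall s, 0 < s < t -> h1 s = h2 s) -> avg n h1 t = avg n h2 t.
Proof.
intros H. unfold avg. destruct (Rle_dec t 0) as [Ht | Ht]; [reflexivity | ].
f_equal. apply RInt_ext. rewrite Rmin_left, Rmax_right by lra. intros s Hs. now rewrite H.
Qed.

Lemma d_avg n h (t : R) :
  (forall s, continuous h s) -> 0 < t ->
  is_derive (avg n h) t (- (INR n / t * avg n h t) + h t).
Proof.
intros Hh Ht.
apply (is_derive_ext_loc (fun t => RInt (fun s => s ^ n * h s) 0 t / t ^ n)).
- apply (near_intro t _ _ Ht). intros y Hy. unfold avg. destruct (Rle_dec y 0); [lra | reflexivity].
- assert (Htn : 0 < t ^ n) by pos.
  generalize (d_RInt (fun s => s ^ n * h s) t (c_weight n h Hh)). intros H.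
  eapply d_eq; [deriv; lra | ]. cbv beta. unfold avg. destruct (Rle_dec t 0); [lra | ].
  destruct n as [ | m]; [simpl; field; lra | ].
  assert (0 < t ^ m) by pos.
  simpl pred. rewrite <- !tech_pow_Rmult. field. split; lra.
Qed.

Lemma c_avg n h t : (forall s, continuous h s) -> continuous (avg n h) t.
Proof.
intros Hh. destruct (Rlt_le_dec 0 t) as [Ht | Ht]; [now eapply d_c, d_avg | ].
destruct (compact_bound h (-1) 1) as [K [HK Hm]]; [lra | intros; apply Hh | ].
apply filterlim_locally. intros eps.
destruct (exists_small 1 K 0 Rlt_0_1 (cond_pos eps) Rlt_0_1) as [d [Hd [Hd1 [Hd2 _]]]].
apply (near_intro t d _ Hd). intros y Hy. change (Rabs (avg n h y - avg n h t) < eps).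
rewrite (avg_neg n h t Ht), Rminus_0_r.
destruct (Rle_lt_dec y 0) as [Hy0 | Hy0].
- rewrite avg_neg by exact Hy0. rewrite Rabs_R0. apply cond_pos.
- apply Rle_lt_trans with (K * y).
  + apply avg_bound; [exact Hh | lra | ]. intros s Hs. apply (Hm s). lra.
  + nra.
Qed.

Definition unif_cont (g : R -> R) : Prop :=
  forall e, 0 < e -> exists d, 0 < d /\ forall x y, Rabs (x - y) < d -> Rabs (g x - g y) < e.

Lemma unif_cont_c g : unif_cont g -> forall s, continuous g s.
Proof.
intros H s. apply filterlim_locally. intros eps.
destruct (H eps (cond_pos eps)) as [d [Hd Hd2]].
exists (mkposreal _ Hd). intros y Hy. apply Hd2. exact Hy.
Qed.

Lemma sol_of_integral n g alpha u :
  (forall s, continuous g s) -> (forall s, continuous u s) ->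
  (forall r, u r = alpha - RInt (avg n (fun s => g (u s))) 0 r) ->
  sol n g alpha u (fun r => - avg n (fun s => g (u s)) r).
Proof.
intros Hg Hu Heq.
assert (Hh : forall s, continuous (fun s => g (u s)) s) by (intros s; now apply c_comp).
split.
- intros r Hr. rewrite Heq, RInt_avg_neg by exact Hr. ring.
- intros r Hr. rewrite avg_neg by exact Hr. ring.
- exact Hu.
- intros r. apply c_opp. now apply c_avg.
- intros r Hr. apply (is_derive_ext (fun r => alpha - RInt (avg n (fun s => g (u s))) 0 r)).
  { intros t. symmetry. apply Heq. }
  eapply d_eq; [apply d_minus; [apply d_const | apply d_RInt; intros; now apply c_avg] | ]. ring.
- intros r Hr. eapply d_eq; [apply d_opp; now apply d_avg | ]. cbv beta. ring.
Qed.

(* Tonelli's scheme: Picard iteration with the argument delayed by [tau]. *)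
Fixpoint tonelli (n : nat) (g : R -> R) (tau alpha : R) (k : nat) : R -> R :=
  match k with
  | O => fun _ => alpha
  | S k => fun r => alpha - RInt (avg n (fun s => g (tonelli n g tau alpha k (s - tau)))) 0 r
  end.

(** The derivative of the iterate [S k], not of the iterate [k]. *)
Definition tonelli_slope n g tau alpha k (r : R) : R :=
  - avg n (fun s => g (tonelli n g tau alpha k (s - tau))) r.

Lemma c_shift (h : R -> R) tau s : (forall s, continuous h s) -> continuous (fun s => h (s - tau)) s.
Proof. intros Hh. apply (c_comp h (fun s => s - tau)); [apply Hh | cont]. Qed.

Lemma c_tonelli n g tau alpha k :
  (forall s, continuous g s) -> forall r, continuous (tonelli n g tau alpha k) r.
Proof.
intros Hg. induction k as [ | k IH]; intros r; simpl; [apply c_const | ].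
apply c_minus; [apply c_const | ]. apply c_prim. intros t. apply c_avg.
intros s. apply c_comp; [apply Hg | now apply c_shift].
Qed.

Lemma c_tonelli_rhs n g tau alpha k :
  (forall s, continuous g s) -> forall s, continuous (fun s => g (tonelli n g tau alpha k (s - tau))) s.
Proof. intros Hg s. apply c_comp; [apply Hg | ]. apply c_shift. now apply c_tonelli. Qed.

Lemma tonelli_neg n g tau alpha k r : r <= 0 -> tonelli n g tau alpha k r = alpha.
Proof.
intros Hr. destruct k as [ | k]; simpl; [reflexivity | ]. rewrite RInt_avg_neg by exact Hr. ring.
Qed.

(** Values up to radius [(k + 1) tau] only depend on those up to [k tau], so the iterate [k] is
    already final up to radius [k tau]. *)
Lemma tonelli_stationary n g tau alpha k r :
  0 < tau -> r <= INR k * tau -> tonelli n g tau alpha (S k) r = tonelli n g tau alpha k r.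
Proof.
intros Ht. revert r. induction k as [ | k IH]; intros r Hr.
- simpl in Hr. rewrite !tonelli_neg by lra. reflexivity.
- destruct (Rle_lt_dec r 0) as [Hr0 | Hr0]; [now rewrite !tonelli_neg by lra | ].
  change (alpha - RInt (avg n (fun s => g (tonelli n g tau alpha (S k) (s - tau)))) 0 r =
          alpha - RInt (avg n (fun s => g (tonelli n g tau alpha k (s - tau)))) 0 r).
  f_equal. apply RInt_ext. rewrite Rmin_left, Rmax_right by lra. intros x Hx.
  apply avg_ext. intros s Hs. rewrite IH; [reflexivity | ]. rewrite S_INR in Hr. lra.
Qed.

Lemma RInt_abs_le_swap (h : R -> R) a b K :
  (forall s, continuous h s) -> 0 <= K ->
  (forall s, s <= Rmax a b -> Rabs (h s) <= K) -> Rabs (RInt h a b) <= K * Rabs (b - a).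
Proof.
intros Hh HK0 HK. destruct (Rle_dec a b) as [Hab | Hab].
- rewrite (Rabs_pos_eq (b - a)) by lra. apply RInt_abs_le; [exact Hh | exact Hab | ].
  intros s Hs. apply HK. rewrite Rmax_right; lra.
- rewrite (Rabs_left (b - a)) by lra.
  rewrite <- (opp_RInt_swap h b a) by now apply ex_RInt_c.
  change (Rabs (- RInt h b a) <= K * - (b - a)). rewrite Rabs_Ropp.
  replace (- (b - a)) with (a - b) by ring. apply RInt_abs_le; [exact Hh | lra | ].
  intros s Hs. apply HK. rewrite Rmax_left; lra.
Qed.

(** The Lipschitz constant is the same for all delays, iterates and heights: this is the
    equicontinuity behind the compactness. *)
Lemma tonelli_lip n g tau alpha k M R0 r r' :
  (forall s, continuous g s) -> (forall s, Rabs (g s) <= M) -> 0 <= R0 -> r <= R0 -> r' <= R0 ->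
  Rabs (tonelli n g tau alpha k r - tonelli n g tau alpha k r') <= M * R0 * Rabs (r - r').
Proof.
intros Hg HM HR Hr Hr'.
assert (HM0 := bound_nonneg g M HM).
destruct k as [ | k]; simpl.
- rewrite Rminus_diag, Rabs_R0. apply Rmult_le_pos; [nra | apply Rabs_pos].
- set (J := avg n (fun s => g (tonelli n g tau alpha k (s - tau)))).
  assert (HJ : forall s, continuous J s) by (intros s; apply c_avg; now apply c_tonelli_rhs).
  assert (Hch : RInt J 0 r' + RInt J r' r = RInt J 0 r).
  { apply (@RInt_Chasles R_CompleteNormedModule); now apply ex_RInt_c. }
  replace (alpha - RInt J 0 r - (alpha - RInt J 0 r')) with (- RInt J r' r) by lra.
  rewrite Rabs_Ropp. apply RInt_abs_le_swap; [exact HJ | nra | ].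
  intros s Hs. assert (s <= R0) by (eapply Rle_trans; [exact Hs | now apply Rmax_lub]).
  destruct (Rle_lt_dec s 0) as [Hs0 | Hs0].
  + unfold J. rewrite avg_neg by exact Hs0. rewrite Rabs_R0. nra.
  + apply Rle_trans with (M * s); [ | apply Rmult_le_compat_l; lra].
    apply avg_bound; [now apply c_tonelli_rhs | lra | ]. intros; apply HM.
Qed.

Lemma tonelli_bound n g tau alpha k M R0 r :
  (forall s, continuous g s) -> (forall s, Rabs (g s) <= M) -> 0 <= r <= R0 ->
  Rabs (tonelli n g tau alpha k r) <= Rabs alpha + M * R0 * R0.
Proof.
intros Hg HM Hr.
assert (HM0 := bound_nonneg g M HM).
generalize (tonelli_lip n g tau alpha k M R0 r 0 Hg HM ltac:(lra) ltac:(lra) ltac:(lra)).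
rewrite (tonelli_neg n g tau alpha k 0) by lra. rewrite Rminus_0_r, (Rabs_pos_eq r) by lra.
intros H. generalize (Rabs_triang_inv (tonelli n g tau alpha k r) alpha). intros H1.
assert (M * R0 * r <= M * R0 * R0) by (apply Rmult_le_compat_l; nra). lra.
Qed.

(** The filter is left open because two are used: [locally t] for the dependence on the height and
    the ultrafilter for the limit of the approximations. *)
Definition uconv {I : Type} (F : (I -> Prop) -> Prop) (u : I -> R -> R) (l : R -> R) : Prop :=
  forall R0 e, 0 <= R0 -> 0 < e -> F (fun i => forall r, 0 <= r <= R0 -> Rabs (u i r - l r) < e).

Lemma avg_close n h1 h2 eta t :
  (forall s, continuous h1 s) -> (forall s, continuous h2 s) -> 0 <= t ->
  (forall s, 0 <= s <= t -> Rabs (h1 s - h2 s) <= eta) ->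
  Rabs (avg n h1 t - avg n h2 t) <= eta * t.
Proof.
intros H1 H2 Ht H. rewrite avg_minus by assumption. apply avg_bound; [ | exact Ht | exact H].
intros s. now apply c_minus.
Qed.

Lemma avg_RInt_close n h1 h2 eta R0 r :
  (forall s, continuous h1 s) -> (forall s, continuous h2 s) -> 0 <= r <= R0 ->
  (forall s, 0 <= s <= R0 -> Rabs (h1 s - h2 s) <= eta) ->
  Rabs (RInt (avg n h1) 0 r - RInt (avg n h2) 0 r) <= eta * R0 * R0.
Proof.
intros H1 H2 Hr H.
assert (0 <= eta) by (eapply Rle_trans; [apply Rabs_pos | apply (H 0); lra]).
rewrite RInt_minus_c by (intros; now apply c_avg).
apply Rle_trans with (eta * R0 * (r - 0)).
- apply RInt_abs_le; [ | lra | ].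
  + intros s. apply c_minus; now apply c_avg.
  + intros s Hs. apply Rle_trans with (eta * s); [ | apply Rmult_le_compat_l; lra].
    apply avg_close; try assumption; [lra | ]. intros x Hx. apply H. lra.
- apply Rmult_le_compat_l; [ | lra]. apply Rmult_le_pos; lra.
Qed.

(** For a fixed number of iterations uniform continuity of [g] suffices, one modulus per iteration.
    Negative radii are included for the sake of the delayed argument. *)
Lemma tonelli_continuity n g tau k :
  0 <= tau -> unif_cont g -> forall R0 e, 0 <= R0 -> 0 < e ->
  exists d, 0 < d /\ forall a a', Rabs (a' - a) < d -> forall r, r <= R0 ->
    Rabs (tonelli n g tau a' k r - tonelli n g tau a k r) < e.
Proof.
intros Htau Hg R0 e HR. revert e. assert (cg := unif_cont_c g Hg).
induction k as [ | k IH]; intros e He.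
- exists e. split; [exact He | ]. intros a a' Ha r Hr. exact Ha.
- set (eta := e / (2 * (R0 * R0 + 1))).
  assert (Heta : 0 < eta) by pos.
  destruct (Hg eta Heta) as [d1 [Hd1 Hd1']].
  destruct (IH d1 Hd1) as [d2 [Hd2 Hd2']].
  assert (He2 : 0 < e / 2) by lra.
  destruct (exists_small 1 1 0 Hd2 He2 Rlt_0_1) as [d [Hd [Hdd2 [Hde _]]]].
  exists d. split; [exact Hd | ]. intros a a' Ha r Hr.
  assert (Ha2 : Rabs (a' - a) < d2) by lra.
  destruct (Rle_lt_dec r 0) as [Hr0 | Hr0]; [rewrite !tonelli_neg by lra; lra | ].
  simpl.
  set (J' := RInt (avg n (fun s => g (tonelli n g tau a' k (s - tau)))) 0 r).
  set (J := RInt (avg n (fun s => g (tonelli n g tau a k (s - tau)))) 0 r).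
  assert (HJ : Rabs (J' - J) <= eta * R0 * R0).
  { apply avg_RInt_close; try (now apply c_tonelli_rhs); [lra | ].
    intros s Hs. left. apply Hd1', Hd2'; [exact Ha2 | lra]. }
  assert (eta * R0 * R0 < e / 2).
  { replace (e / 2) with (eta * (R0 * R0 + 1)) by (unfold eta; field; nra). nra. }
  replace (a' - J' - (a - J)) with ((a' - a) - (J' - J)) by ring.
  eapply Rle_lt_trans; [apply Rabs_triang | ]. rewrite Rabs_Ropp. lra.
Qed.

Lemma tonelli_slope_continuity n g tau k :
  0 <= tau -> unif_cont g -> forall R0 e, 0 <= R0 -> 0 < e ->
  exists d, 0 < d /\ forall a a', Rabs (a' - a) < d -> forall r, 0 <= r <= R0 ->
    Rabs (tonelli_slope n g tau a' k r - tonelli_slope n g tau a k r) < e.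
Proof.
intros Htau Hg R0 e HR He. assert (cg := unif_cont_c g Hg).
set (eta := e / (R0 + 1)).
assert (Heta : 0 < eta) by pos.
destruct (Hg eta Heta) as [d1 [Hd1 Hd1']].
destruct (tonelli_continuity n g tau k Htau Hg R0 d1 HR Hd1) as [d2 [Hd2 Hd2']].
exists d2. split; [exact Hd2 | ]. intros a a' Ha r Hr. unfold tonelli_slope.
set (h' := fun s => g (tonelli n g tau a' k (s - tau))).
set (h := fun s => g (tonelli n g tau a k (s - tau))).
replace (- avg n h' r - - avg n h r) with (- (avg n h' r - avg n h r)) by ring.
rewrite Rabs_Ropp. apply Rle_lt_trans with (eta * r).
- apply avg_close; try (now apply c_tonelli_rhs); [lra | ].
  intros s Hs. left. apply Hd1', Hd2'; [exact Ha | lra].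
- apply Rle_lt_trans with (eta * R0); [apply Rmult_le_compat_l; lra | ].
  replace e with (eta * (R0 + 1)) by (unfold eta; field; lra). nra.
Qed.

(** * Convergence of energies and openness of the two events *)

Lemma prim_lip g M x y :
  (forall s, continuous g s) -> (forall s, Rabs (g s) <= M) ->
  Rabs (prim g x - prim g y) <= M * Rabs (x - y).
Proof.
intros Hg HM.
assert (HM0 := bound_nonneg g M HM).
assert (Hch : RInt g 0 y + RInt g y x = RInt g 0 x).
{ apply (@RInt_Chasles R_CompleteNormedModule); now apply ex_RInt_c. }
unfold prim. replace (RInt g 0 x - RInt g 0 y) with (RInt g y x) by lra.
apply RInt_abs_le_swap; [exact Hg | exact HM0 | ]. intros; apply HM.
Qed.

Lemma uconv_energy {I : Type} (F : (I -> Prop) -> Prop) {FF : Filter F} g M ui vi u v :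
  (forall s, continuous g s) -> (forall s, Rabs (g s) <= M) ->
  (forall r, continuous v r) ->
  uconv F ui u -> uconv F vi v -> uconv F (fun i => energy g (ui i) (vi i)) (energy g u v).
Proof.
intros Hg HM Hv Hu' Hv' R0 e HR He.
assert (HM0 := bound_nonneg g M HM).
destruct (compact_bound v 0 R0 HR) as [V [HV Hm]]; [intros; apply Hv | ].
set (e1 := e / (2 * (M + 1))). assert (He1 : 0 < e1) by pos.
set (e2 := Rmin 1 (e / (2 * V + 1))).
assert (He2 : 0 < e2) by pos.
generalize (filter_and _ _ (Hu' R0 e1 HR He1) (Hv' R0 e2 HR He2)).
apply filter_imp. intros i [Hi1 Hi2] r Hr.
specialize (Hi1 r Hr). specialize (Hi2 r Hr). specialize (Hm r Hr). simpl in Hm.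
unfold energy.
assert (HF : Rabs (prim g (ui i r) - prim g (u r)) < e / 2).
{ eapply Rle_lt_trans; [now apply (prim_lip g M) | ].
  apply Rle_lt_trans with (M * e1); [apply Rmult_le_compat_l; lra | ].
  replace (e / 2) with ((M + 1) * e1) by (unfold e1; field; lra). nra. }
assert (Hvv : Rabs (vi i r ^ 2 / 2 - v r ^ 2 / 2) <= e / 2).
{ replace (vi i r ^ 2 / 2 - v r ^ 2 / 2) with ((vi i r - v r) * ((vi i r - v r) + 2 * v r) / 2) by field.
  unfold Rdiv. rewrite !Rabs_mult, (Rabs_pos_eq (/ 2)) by lra.
  assert (Rabs (vi i r - v r + 2 * v r) <= 1 + 2 * V).
  { eapply Rle_trans; [apply Rabs_triang | ]. rewrite Rabs_mult, (Rabs_pos_eq 2) by lra.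
    assert (e2 <= 1) by apply Rmin_l. lra. }
  assert (Rabs (vi i r - v r) <= e / (2 * V + 1)) by (left; eapply Rlt_le_trans; [exact Hi2 | apply Rmin_r]).
  apply Rmult_le_compat_r; [lra | ].
  apply Rle_trans with (e / (2 * V + 1) * (1 + 2 * V)).
  - apply Rmult_le_compat; try apply Rabs_pos; assumption.
  - right. field. lra. }
replace (vi i r ^ 2 / 2 + prim g (ui i r) - (v r ^ 2 / 2 + prim g (u r)))
  with ((vi i r ^ 2 / 2 - v r ^ 2 / 2) + (prim g (ui i r) - prim g (u r))) by ring.
eapply Rle_lt_trans; [apply Rabs_triang | ]. lra.
Qed.

Lemma uconv_pos {I : Type} (F : (I -> Prop) -> Prop) {FF : Filter F} (ui : I -> R -> R) u r0 :
  (forall r, continuous u r) -> uconv F ui u -> 0 <= r0 -> (forall r, 0 <= r <= r0 -> 0 < u r) ->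
  F (fun i => forall r, 0 <= r <= r0 -> 0 < ui i r).
Proof.
intros Hu Hui Hr0 Hp.
destruct (compact_pos_min u 0 r0) as [m [Hm Hm2]]; [intros; apply Hu | exact Hp | ].
generalize (Hui r0 m Hr0 Hm). apply filter_imp. intros i Hi r Hr.
specialize (Hi r Hr). specialize (Hm2 r Hr). apply Rabs_def2 in Hi. lra.
Qed.

Lemma uconv_neg_at {I : Type} (F : (I -> Prop) -> Prop) {FF : Filter F} (ui : I -> R -> R) u r0 :
  uconv F ui u -> 0 <= r0 -> u r0 < 0 -> F (fun i => ui i r0 < 0).
Proof.
intros Hui Hr0 Hn. generalize (Hui r0 (- u r0) Hr0 ltac:(lra)). apply filter_imp. intros i Hi.
specialize (Hi r0 ltac:(lra)). apply Rabs_def2 in Hi. lra.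
Qed.

Lemma turns_open {I : Type} (F : (I -> Prop) -> Prop) {FF : Filter F} g M ui vi u v :
  (forall s, continuous g s) -> (forall s, Rabs (g s) <= M) ->
  (forall r, continuous u r) -> (forall r, continuous v r) ->
  uconv F ui u -> uconv F vi v -> turns g u v -> F (fun i => turns g (ui i) (vi i)).
Proof.
intros Hg HM Hu Hv Hui Hvi [r0 [Hr0 [HE Hp]]].
generalize (uconv_energy F g M ui vi u v Hg HM Hv Hui Hvi). intros Hen.
generalize (filter_and _ _ (uconv_neg_at F _ _ r0 Hen Hr0 HE) (uconv_pos F ui u r0 Hu Hui Hr0 Hp)).
apply filter_imp. intros i [H1 H2]. exists r0. auto.
Qed.

Lemma crosses_open {I : Type} (F : (I -> Prop) -> Prop) {FF : Filter F} g M ui vi u v :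
  (forall s, continuous g s) -> (forall s, Rabs (g s) <= M) ->
  (forall r, continuous u r) -> (forall r, continuous v r) ->
  uconv F ui u -> uconv F vi v -> crosses g u v -> F (fun i => crosses g (ui i) (vi i)).
Proof.
intros Hg HM Hu Hv Hui Hvi [r0 [Hr0 [Hn HE]]].
generalize (uconv_energy F g M ui vi u v Hg HM Hv Hui Hvi). intros Hen.
assert (HcE : forall r, continuous (energy g u v) r).
{ intros r. unfold energy. cont; [lra | ]. apply (c_comp (prim g) u); [now apply c_prim | apply Hu]. }
generalize (filter_and _ _ (uconv_neg_at F ui u r0 Hui Hr0 Hn) (uconv_pos F _ _ r0 HcE Hen Hr0 HE)).
apply filter_imp. intros i [H1 H2]. exists r0. auto.
Qed.

Lemma turns_not_crosses g u v : turns g u v -> crosses g u v -> False.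
Proof.
intros [r [Hr [HE Hp]]] [q [Hq [Hn Hpe]]].
destruct (Rle_lt_dec r q) as [H | H].
- specialize (Hpe r ltac:(lra)). lra.
- specialize (Hp q ltac:(lra)). lra.
Qed.

(** * Connectedness and limits along an ultrafilter *)

Lemma connected_unit (P Q : R -> Prop) :
  (forall t, P t -> locally t P) -> (forall t, Q t -> locally t Q) ->
  (forall t, P t -> Q t -> False) -> P 0 -> Q 1 ->
  exists t, 0 <= t <= 1 /\ ~ P t /\ ~ Q t.
Proof.
intros OP OQ Hd P0 Q1.
destruct (prefix_sup P 0 1 Rle_0_1 P0) as [c [Hc01 [Hbelow Hloc]]].
exists c. split; [exact Hc01 | split].
- intros Pc. apply (Hd c Pc). now rewrite (Hloc (OP c Pc)).
- intros Qc. destruct (OQ c Qc) as [d Hd2].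
  assert (H : 0 < c). { destruct Hc01 as [[H | H] _]; [exact H | ]. subst c. exfalso. exact (Hd 0 P0 Qc). }
  destruct (exists_small 1 1 0 (cond_pos d) H Rlt_0_1) as [z [Hz [Hz1 [Hz2 _]]]].
  apply (Hd (c - z)); [apply Hbelow; lra | ].
  apply Hd2. change (Rabs (c - z - c) < d). rewrite Rabs_left; lra.
Qed.

Lemma ultralimit (U : (nat -> Prop) -> Prop) (PU : ProperFilter U) (x : nat -> R) B :
  (forall P : nat -> Prop, U P \/ U (fun n => ~ P n)) -> (forall m, Rabs (x m) <= B) ->
  exists l, forall e, 0 < e -> U (fun m => Rabs (x m - l) < e).
Proof.
intros HU HB. destruct (completeness (fun y => U (fun m => y <= x m))) as [l [Hub Hlub]].
- exists B. intros y Hy. destruct (filter_ex _ Hy) as [m Hm].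
  generalize (HB m) (Rle_abs (x m)). lra.
- exists (- B). apply filter_forall. intros m. generalize (HB m). intros H. apply Rabs_le_between in H. lra.
- exists l. intros e He.
  assert (H1 : U (fun m => ~ (l + e / 2 <= x m))).
  { destruct (HU (fun m => l + e / 2 <= x m)) as [H | H]; [ | exact H].
    specialize (Hub _ H). lra. }
  assert (H2 : U (fun m => l - e / 2 <= x m)).
  { destruct (HU (fun m => l - e / 2 <= x m)) as [H | H]; [exact H | ]. exfalso.
    assert (l <= l - e / 2); [ | lra]. apply Hlub. intros y Hy.
    apply Rnot_lt_le. intros Hly. destruct (filter_ex _ (filter_and _ _ H Hy)) as [m [Hm1 Hm2]]. lra. }
  generalize (filter_and _ _ H1 H2). apply filter_imp. intros m [Hm1 Hm2].
  apply Rnot_le_lt in Hm1. apply Rabs_def1; lra.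
Qed.

Lemma ultralimit_le (U : (nat -> Prop) -> Prop) (PU : ProperFilter U) (x y : nat -> R) lx ly C :
  (forall e, 0 < e -> U (fun m => Rabs (x m - lx) < e)) ->
  (forall e, 0 < e -> U (fun m => Rabs (y m - ly) < e)) ->
  U (fun m => Rabs (x m - y m) <= C) -> Rabs (lx - ly) <= C.
Proof.
intros Hx Hy Hxy. apply Rnot_lt_le. intros HC. set (e := (Rabs (lx - ly) - C) / 2).
assert (He : 0 < e) by pos.
destruct (filter_ex _ (filter_and _ _ Hxy (filter_and _ _ (Hx e He) (Hy e He)))) as [m [H1 [H2 H3]]].
assert (Rabs (lx - ly) <= Rabs (x m - y m) + Rabs (x m - lx) + Rabs (y m - ly)); [ | unfold e in *; lra].
replace (lx - ly) with ((x m - y m) - (x m - lx) + (y m - ly)) by ring.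
eapply Rle_trans; [apply Rabs_triang | ]. apply Rplus_le_compat_r.
eapply Rle_trans; [apply Rabs_triang | ]. rewrite Rabs_Ropp. lra.
Qed.

(** Only finitely many events can be intersected, so the interval is crossed in finitely many steps
    of length [d]; within a step each of the two functions varies by less than [e/3]. *)
Lemma equilip_uconv (U : (nat -> Prop) -> Prop) (PU : ProperFilter U) (ui : nat -> R -> R) u L R0 e :
  (forall r e, 0 < e -> U (fun m => Rabs (ui m r - u r) < e)) -> 0 <= R0 -> 0 < e -> 0 <= L ->
  (forall m r r', r <= R0 -> r' <= R0 -> Rabs (ui m r - ui m r') <= L * Rabs (r - r')) ->
  (forall r r', r <= R0 -> r' <= R0 -> Rabs (u r - u r') <= L * Rabs (r - r')) ->
  U (fun m => forall r, 0 <= r <= R0 -> Rabs (ui m r - u r) < e).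
Proof.
intros Hpt HR He HL HLi HLu. set (d := e / (3 * (L + 1))). assert (Hd : 0 < d) by pos.
assert (HLd : L * d < e / 3).
{ replace (e / 3) with ((L + 1) * d) by (unfold d; field; lra). nra. }
assert (H : forall k, U (fun m => forall r, 0 <= r <= Rmin (INR k * d) R0 -> Rabs (ui m r - u r) < e)).
{ induction k as [ | k IH].
  - apply (filter_imp (fun m => Rabs (ui m 0 - u 0) < e)); [ | now apply Hpt].
    intros m Hm r Hr. simpl in Hr. generalize (Rmin_l (0 * d) R0). intros.
    replace r with 0 by lra. exact Hm.
  - set (x := Rmin (INR k * d) R0) in *.
    generalize (filter_and _ _ IH (Hpt x (e / 3) ltac:(lra))). apply filter_imp.
    intros m [H1 H2] r Hr. destruct (Rle_lt_dec r x) as [Hrx | Hrx]; [apply H1; lra | ].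
    rewrite S_INR in Hr.
    assert (Hx : x = INR k * d).
    { unfold x in *. unfold Rmin in *. destruct (Rle_dec (INR k * d) R0); [reflexivity | ].
      destruct (Rle_dec ((INR k + 1) * d) R0); lra. }
    assert (Hr2 : r <= (INR k + 1) * d /\ r <= R0).
    { generalize (Rmin_l ((INR k + 1) * d) R0) (Rmin_r ((INR k + 1) * d) R0). lra. }
    assert (Habs : Rabs (r - x) <= d) by (rewrite Rabs_pos_eq; lra).
    assert (H3 : Rabs (ui m r - ui m x) <= L * d).
    { eapply Rle_trans; [apply HLi; lra | ]. apply Rmult_le_compat_l; lra. }
    assert (H4 : Rabs (u r - u x) <= L * d).
    { eapply Rle_trans; [apply HLu; lra | ]. apply Rmult_le_compat_l; lra. }
    replace (ui m r - u r) with ((ui m r - ui m x) + (ui m x - u x) - (u r - u x)) by ring.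
    eapply Rle_lt_trans; [apply Rabs_triang | ]. rewrite Rabs_Ropp.
    generalize (Rabs_triang (ui m r - ui m x) (ui m x - u x)). lra. }
destruct (INR_unbounded (R0 / d)) as [k Hk].
generalize (H k). apply filter_imp. intros m Hm r Hr. apply Hm. rewrite Rmin_right; [lra | ].
apply (Rmult_lt_compat_r d) in Hk; [ | exact Hd]. replace (R0 / d * d) with R0 in Hk by (field; lra). lra.
Qed.

(** With delay [1/(m+1)], [(m+1)^2] iterations are final up to radius [m+1], which exhausts the half
    line; the additional [S] makes [approx_slope] the derivative of [approx]. *)
Definition approx n g (m : nat) alpha : R -> R :=
  tonelli n g (/ INR (S m)) alpha (S (S m * S m)).

Definition approx_rhs n g (m : nat) alpha (s : R) : R :=
  g (tonelli n g (/ INR (S m)) alpha (S m * S m) (s - / INR (S m))).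

Definition approx_slope n g (m : nat) alpha : R -> R :=
  tonelli_slope n g (/ INR (S m)) alpha (S m * S m).

Lemma approx_compact (U : (nat -> Prop) -> Prop) (PU : ProperFilter U) n g M (al : nat -> R) B :
  (forall P : nat -> Prop, U P \/ U (fun n => ~ P n)) ->
  (forall n0, U (fun n => (n0 <= n)%nat)) ->
  unif_cont g -> (forall s, Rabs (g s) <= M) -> (forall m, Rabs (al m) <= B) ->
  exists alpha u v, (forall e, 0 < e -> U (fun m => Rabs (al m - alpha) < e)) /\
    sol n g alpha u v /\
    uconv U (fun m => approx n g m (al m)) u /\ uconv U (fun m => approx_slope n g m (al m)) v.
Proof.
intros HU HUinf Hg HM HB.  assert (cg := unif_cont_c g Hg).
assert (HM0 := bound_nonneg g M HM).
destruct (ultralimit U PU al B HU HB) as [alpha Halpha].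
set (um := fun m => approx n g m (al m)).
assert (Hlim : forall r, exists l, forall e, 0 < e -> U (fun m => Rabs (um m r - l) < e)).
{ intros r. destruct (Rle_lt_dec r 0) as [Hr | Hr].
  - exists alpha. intros e He. generalize (Halpha e He). apply filter_imp. intros m Hm.
    unfold um, approx. now rewrite tonelli_neg.
  - apply (ultralimit U PU (fun m => um m r) (B + M * r * r) HU). intros m.
    eapply Rle_trans; [apply (tonelli_bound n g _ _ _ M r); try assumption; lra | ].
    specialize (HB m). lra. }
set (u := fun r => epsilon (inhabits 0) (fun l => forall e, 0 < e -> U (fun m => Rabs (um m r - l) < e))).
assert (Hu : forall r e, 0 < e -> U (fun m => Rabs (um m r - u r) < e)).
{ intros r. exact (epsilon_spec (inhabits 0) _ (Hlim r)). }
assert (HLm : forall R0 m r r', 0 <= R0 -> r <= R0 -> r' <= R0 ->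
  Rabs (um m r - um m r') <= M * R0 * Rabs (r - r')).
{ intros R0 m r r' HR Hr Hr'. now apply tonelli_lip. }
assert (HLu : forall R0 r r', 0 <= R0 -> r <= R0 -> r' <= R0 ->
  Rabs (u r - u r') <= M * R0 * Rabs (r - r')).
{ intros R0 r r' HR Hr Hr'.
  apply (ultralimit_le U PU (fun m => um m r) (fun m => um m r')); [apply Hu | apply Hu | ].
  apply filter_forall. intros m. now apply HLm. }
assert (Hcu : forall r, continuous u r).
{ intros r. apply filterlim_locally. intros eps.
  set (R0 := Rabs r + 1). assert (HR : 1 <= R0) by (unfold R0; generalize (Rabs_pos r); lra).
  destruct (exists_small 1 (M * R0) 0 Rlt_0_1 (cond_pos eps) Rlt_0_1) as [d [Hd [Hd1 [Hd2 _]]]].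
  apply (near_intro r d _ Hd). intros y Hy. change (Rabs (u y - u r) < eps).
  assert (Hyr : Rabs (y - r) < d) by (apply Rabs_def1; lra).
  eapply Rle_lt_trans; [apply (HLu R0); unfold R0; generalize (Rle_abs r) (Rabs_pos r); lra | ].
  assert (0 <= M * R0) by nra. generalize (Rabs_pos (y - r)). nra. }
assert (Huu : uconv U um u).
{ intros R0 e HR He. apply (equilip_uconv U PU um u (M * R0)); try assumption.
  - nra.
  - intros m r r' Hr Hr'. now apply HLm.
  - intros r r' Hr Hr'. now apply HLu. }
(* The delay shifts the argument by [1/(m+1)], at a cost of at most [M R0 / (m+1) < d/2];
   convergence takes the other half of [d]. *)
assert (Hrhs : forall R0 eta, 0 <= R0 -> 0 < eta -> U (fun m => forall s, 0 <= s <= R0 ->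
  Rabs (approx_rhs n g m (al m) s - g (u s)) <= eta)).
{ intros R0 eta HR Heta. destruct (Hg eta Heta) as [d [Hd Hd2]].
  destruct (INR_unbounded (Rmax R0 (2 * (M * R0 + 1) / d))) as [k Hk].
  assert (Hk1 : R0 < INR k) by (eapply Rle_lt_trans; [apply Rmax_l | exact Hk]).
  assert (Hk2 : 2 * (M * R0 + 1) / d < INR k) by (eapply Rle_lt_trans; [apply Rmax_r | exact Hk]).
  generalize (filter_and _ _ (HUinf k) (Huu R0 (d / 2) HR ltac:(lra))). apply filter_imp.
  intros m [Hm1 Hm2] s Hs. left. apply Hd2.
  assert (Hkm : INR k <= INR (S m)) by (apply le_INR; lia).
  assert (Hm0 : 0 < INR (S m)) by pos.
  assert (Ht : 0 < / INR (S m)) by pos.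
  assert (Hst : tonelli n g (/ INR (S m)) (al m) (S m * S m) (s - / INR (S m)) = um m (s - / INR (S m))).
  { unfold um, approx. symmetry. apply tonelli_stationary; [exact Ht | ].
    rewrite mult_INR, Rmult_assoc, Rinv_r, Rmult_1_r by lra. lra. }
  unfold approx_rhs. rewrite Hst.
  assert (H1 : Rabs (um m (s - / INR (S m)) - um m s) < d / 2).
  { eapply Rle_lt_trans; [apply (HLm R0); lra | ].
    replace (s - / INR (S m) - s) with (- / INR (S m)) by ring. rewrite Rabs_Ropp, (Rabs_pos_eq (/ INR (S m))) by lra.
    apply (Rmult_lt_reg_r (INR (S m))); [exact Hm0 | ]. rewrite Rmult_assoc, Rinv_l, Rmult_1_r by lra.
    assert (2 * (M * R0 + 1) / d < INR (S m)) by lra.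
    apply (Rmult_lt_compat_r d) in H; [ | exact Hd].
    replace (2 * (M * R0 + 1) / d * d) with (2 * (M * R0 + 1)) in H by (field; lra). lra. }
  specialize (Hm2 s Hs).
  replace (um m (s - / INR (S m)) - u s) with ((um m (s - / INR (S m)) - um m s) + (um m s - u s)) by ring.
  eapply Rle_lt_trans; [apply Rabs_triang | ]. lra. }
assert (Hgu : forall s, continuous (fun s => g (u s)) s) by (intros s; now apply c_comp).
assert (Hu_neg : forall r, r <= 0 -> u r = alpha).
{ intros r Hr. assert (H : Rabs (u r - alpha) <= 0).
  - apply (ultralimit_le U PU (fun m => um m r) al); [apply Hu | exact Halpha | ].
    apply filter_forall. intros m.
    unfold um, approx. rewrite tonelli_neg by exact Hr. rewrite Rminus_diag, Rabs_R0. lra.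
  - generalize (Rabs_pos (u r - alpha)). intros. assert (Rabs (u r - alpha) = 0) by lra.
    apply Rabs_eq_0 in H1. lra. }
assert (Heq : forall r, u r = alpha - RInt (avg n (fun s => g (u s))) 0 r).
{ intros r. destruct (Rle_lt_dec r 0) as [Hr | Hr].
  - rewrite Hu_neg, RInt_avg_neg by exact Hr. ring.
  - set (I := RInt (avg n (fun s => g (u s))) 0 r).
    assert (H : forall e, 0 < e -> Rabs (u r - (alpha - I)) <= e).
    { intros e He.
      apply (ultralimit_le U PU (fun m => um m r) (fun m => al m - I)).
      - apply Hu.
      - intros e' He'. generalize (Halpha e' He'). apply filter_imp. intros m Hm.
        now replace (al m - I - (alpha - I)) with (al m - alpha) by ring.
      - set (eta := e / (r * r)). assert (Heta : 0 < eta) by pos.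
        generalize (Hrhs r eta ltac:(lra) Heta). apply filter_imp. intros m Hm.
        unfold um, approx.
        change (tonelli n g (/ INR (S m)) (al m) (S (S m * S m)) r) with
          (al m - RInt (avg n (approx_rhs n g m (al m))) 0 r).
        set (Jm := RInt (avg n (approx_rhs n g m (al m))) 0 r).
        replace (al m - Jm - (al m - I)) with (- (Jm - I)) by ring. rewrite Rabs_Ropp.
        replace e with (eta * r * r) by (unfold eta; field; lra).
        apply avg_RInt_close; try assumption; [ | lra]. now apply c_tonelli_rhs. }
    apply Rminus_diag_uniq. apply Rabs_eq_0. apply Rle_antisym; [ | apply Rabs_pos].
    apply Rnot_lt_le. intros Hp. specialize (H (Rabs (u r - (alpha - I)) / 2) ltac:(lra)). lra. }
exists alpha, u, (fun r => - avg n (fun s => g (u s)) r).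
split; [exact Halpha | split; [now apply sol_of_integral | split; [exact Huu | ]]].
intros R0 e HR He. set (eta := e / (R0 + 1)).
assert (Heta : 0 < eta) by pos.
generalize (Hrhs R0 eta HR Heta). apply filter_imp. intros m Hm r Hr.
unfold approx_slope, tonelli_slope.
set (hm := approx_rhs n g m (al m)).
change (Rabs (- avg n hm r - - avg n (fun s => g (u s)) r) < e).
replace (- avg n hm r - - avg n (fun s => g (u s)) r) with (- (avg n hm r - avg n (fun s => g (u s)) r)) by ring.
rewrite Rabs_Ropp. apply Rle_lt_trans with (eta * r).
- apply avg_close; try assumption; [now apply c_tonelli_rhs | lra | ]. intros s Hs. apply Hm. lra.
- apply Rle_lt_trans with (eta * R0); [apply Rmult_le_compat_l; lra | ].
  replace e with (eta * (R0 + 1)) by (unfold eta; field; lra). nra.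
Qed.

(* [g] is not assumed Lipschitz, so solutions need not be unique: the dichotomy is run on the
   delayed approximations, which depend continuously on the initial value, and passed to the limit. *)
Lemma shooting n g M a b :
  unif_cont g -> (forall s, Rabs (g s) <= M) ->
  (forall u v, sol n g a u v -> turns g u v) ->
  (forall u v, sol n g b u v -> crosses g u v) ->
  exists t u v, 0 < t < 1 /\ sol n g (a + t * (b - a)) u v /\ ~ turns g u v /\ ~ crosses g u v.
Proof.
intros Hg HM Ha Hb. assert (cg := unif_cont_c g Hg).
set (al := fun t => a + t * (b - a)).
set (P := fun m t => turns g (approx n g m (al t)) (approx_slope n g m (al t))).
set (Q := fun m t => crosses g (approx n g m (al t)) (approx_slope n g m (al t))).
assert (Hconv : forall m t, uconv (locally t) (fun t => approx n g m (al t)) (approx n g m (al t)) /\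
   uconv (locally t) (fun t => approx_slope n g m (al t)) (approx_slope n g m (al t))).
{ intros m t.
  assert (Ht : 0 <= / INR (S m)) by pos.
  assert (Hal : forall d, 0 < d -> locally t (fun t' => Rabs (al t' - al t) < d)).
  { intros d Hd.
    assert (Hp : 0 < d / (Rabs (b - a) + 1)).
    { apply Rdiv_lt_0_compat; [exact Hd | generalize (Rabs_pos (b - a)); lra]. }
    exists (mkposreal _ Hp). intros t' Ht'. change (Rabs (t' - t) < d / (Rabs (b - a) + 1)) in Ht'.
    unfold al. replace (a + t' * (b - a) - (a + t * (b - a))) with ((t' - t) * (b - a)) by ring.
    rewrite Rabs_mult. generalize (Rabs_pos (b - a)) (Rabs_pos (t' - t)). intros.
    apply Rle_lt_trans with (Rabs (t' - t) * (Rabs (b - a) + 1)); [nra | ].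
    apply (Rmult_lt_compat_r (Rabs (b - a) + 1)) in Ht'; [ | lra].
    replace (d / (Rabs (b - a) + 1) * (Rabs (b - a) + 1)) with d in Ht' by (field; lra). lra. }
  split; intros R0 e HR He.
  - destruct (tonelli_continuity n g _ (S (S m * S m)) Ht Hg R0 e HR He) as [d [Hd Hd2]].
    generalize (Hal d Hd). apply filter_imp. intros t' Ht' r Hr. apply Hd2; [exact Ht' | lra].
  - destruct (tonelli_slope_continuity n g _ (S m * S m) Ht Hg R0 e HR He) as [d [Hd Hd2]].
    generalize (Hal d Hd). apply filter_imp. intros t' Ht' r Hr. apply Hd2; [exact Ht' | lra]. }
assert (Hca : forall m alpha r, continuous (approx n g m alpha) r) by (intros; now apply c_tonelli).
assert (Hcs : forall m alpha r, continuous (approx_slope n g m alpha) r).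
{ intros. apply c_opp, c_avg. now apply c_tonelli_rhs. }
assert (HPo : forall m t, P m t -> locally t (P m)).
{ intros m t HPt. destruct (Hconv m t) as [H1 H2].
  exact (turns_open (locally t) g M _ _ _ _ cg HM (Hca m (al t)) (Hcs m (al t)) H1 H2 HPt). }
assert (HQo : forall m t, Q m t -> locally t (Q m)).
{ intros m t HQt. destruct (Hconv m t) as [H1 H2].
  exact (crosses_open (locally t) g M _ _ _ _ cg HM (Hca m (al t)) (Hcs m (al t)) H1 H2 HQt). }
(* The endpoint hypotheses concern exact solutions, so an approximation may fail to turn at [0] or
   to cross at [1]; such a failure selects that endpoint. *)
assert (Hsel : forall m, exists t, 0 <= t <= 1 /\
  ((~ P m t /\ ~ Q m t) \/ (t = 0 /\ ~ P m t) \/ (t = 1 /\ ~ Q m t))).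
{ intros m. destruct (classic (P m 0)) as [P0 | P0]; [ | exists 0; split; [lra | auto]].
  destruct (classic (Q m 1)) as [Q1 | Q1]; [ | exists 1; split; [lra | auto]].
  destruct (connected_unit (P m) (Q m) (HPo m) (HQo m)) as [t [H1 [H2 H3]]]; try assumption.
  - intros t. apply turns_not_crosses.
  - exists t. auto. }
set (tm := fun m => epsilon (inhabits 0) (fun t => 0 <= t <= 1 /\
  ((~ P m t /\ ~ Q m t) \/ (t = 0 /\ ~ P m t) \/ (t = 1 /\ ~ Q m t)))).
assert (Htm : forall m, 0 <= tm m <= 1 /\
  ((~ P m (tm m) /\ ~ Q m (tm m)) \/ (tm m = 0 /\ ~ P m (tm m)) \/ (tm m = 1 /\ ~ Q m (tm m)))).
{ intros m. exact (epsilon_spec (inhabits 0) _ (Hsel m)). }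
destruct ultrafilter_nat as [U [PU [HU HUinf]]]. assert (FU : Filter U) by apply PU.
destruct (approx_compact U PU n g M (fun m => al (tm m)) (Rabs a + Rabs (b - a)) HU HUinf Hg HM)
  as [alpha [u [v [Hal [Hs [Huu Hvv]]]]]].
{ intros m. unfold al. eapply Rle_trans; [apply Rabs_triang | ]. apply Rplus_le_compat_l.
  rewrite Rabs_mult. destruct (Htm m) as [Ht _]. rewrite Rabs_pos_eq by lra.
  generalize (Rabs_pos (b - a)). nra. }
destruct (ultralimit U PU tm 1 HU) as [t Ht].
{ intros m. destruct (Htm m) as [H _]. rewrite Rabs_pos_eq; lra. }
assert (Halpha : alpha = al t).
{ apply Rminus_diag_uniq, Rabs_eq_0, Rle_antisym; [ | apply Rabs_pos].
  apply (ultralimit_le U PU (fun m => al (tm m)) (fun m => al (tm m))); [exact Hal | | ].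
  - intros e He.
    assert (Hp : 0 < e / (Rabs (b - a) + 1)).
    { apply Rdiv_lt_0_compat; [exact He | generalize (Rabs_pos (b - a)); lra]. }
    generalize (Ht _ Hp). apply filter_imp. intros m Hm.
    unfold al. replace (a + tm m * (b - a) - (a + t * (b - a))) with ((tm m - t) * (b - a)) by ring.
    rewrite Rabs_mult. generalize (Rabs_pos (b - a)) (Rabs_pos (tm m - t)). intros.
    apply Rle_lt_trans with (Rabs (tm m - t) * (Rabs (b - a) + 1)); [nra | ].
    apply (Rmult_lt_compat_r (Rabs (b - a) + 1)) in Hm; [ | lra].
    replace (e / (Rabs (b - a) + 1) * (Rabs (b - a) + 1)) with e in Hm by (field; lra). lra.
  - apply filter_forall. intros m.
    rewrite Rminus_diag, Rabs_R0. lra. }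
assert (HnP : U (fun m => ~ P m (tm m)) -> ~ turns g u v).
{ intros H Htu.
  assert (H2 : U (fun m => P m (tm m))).
  { exact (turns_open U g M _ _ _ _ cg HM (sol_uc Hs) (sol_vc Hs) Huu Hvv Htu). }
  destruct (filter_ex _ (filter_and _ _ H H2)) as [m [H3 H4]]. contradiction. }
assert (HnQ : U (fun m => ~ Q m (tm m)) -> ~ crosses g u v).
{ intros H Htu.
  assert (H2 : U (fun m => Q m (tm m))).
  { exact (crosses_open U g M _ _ _ _ cg HM (sol_uc Hs) (sol_vc Hs) Huu Hvv Htu). }
  destruct (filter_ex _ (filter_and _ _ H H2)) as [m [H3 H4]]. contradiction. }
assert (Hconst : forall c, U (fun m => tm m = c) -> t = c).
{ intros c H. apply Rminus_diag_uniq, Rabs_eq_0, Rle_antisym; [ | apply Rabs_pos].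
  apply (ultralimit_le U PU tm (fun _ => c)); [exact Ht | | ].
  - intros e He. apply filter_forall. intros m. now rewrite Rminus_diag, Rabs_R0.
  - revert H. apply filter_imp. intros m ->. rewrite Rminus_diag, Rabs_R0. lra. }
assert (Ht01 : 0 <= t <= 1).
{ split; apply Rnot_lt_le; intros H.
  - destruct (filter_ex _ (Ht (- t) ltac:(lra))) as [m Hm]. destruct (Htm m) as [H1 _].
    apply Rabs_def2 in Hm. lra.
  - destruct (filter_ex _ (Ht (t - 1) ltac:(lra))) as [m Hm]. destruct (Htm m) as [H1 _].
    apply Rabs_def2 in Hm. lra. }
assert (Hends : ~ turns g u v -> ~ crosses g u v -> 0 < t < 1).
{ intros H1 H2. split; apply Rnot_le_lt; intros H3.
  - apply H1, Ha. replace a with alpha; [exact Hs | ]. rewrite Halpha. unfold al. replace t with 0 by lra. ring.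
  - apply H2, Hb. replace b with alpha; [exact Hs | ]. rewrite Halpha. unfold al. replace t with 1 by lra. ring. }
destruct (HU (fun m => ~ P m (tm m) /\ ~ Q m (tm m))) as [H | H].
- assert (H1 : ~ turns g u v) by (apply HnP; revert H; apply filter_imp; tauto).
  assert (H2 : ~ crosses g u v) by (apply HnQ; revert H; apply filter_imp; tauto).
  exists t, u, v. split; [now apply Hends | ]. fold (al t). rewrite <- Halpha. auto.
(* If one endpoint is selected for [U]-most indices, the limit is an exact solution from that
   endpoint which violates the hypothesis made there. *)
- exfalso. destruct (HU (fun m => tm m = 0 /\ ~ P m (tm m))) as [H0 | H0].
  + assert (H1 : ~ turns g u v) by (apply HnP; revert H0; apply filter_imp; tauto).
    apply H1, Ha. replace a with alpha; [exact Hs | ]. rewrite Halpha. unfold al.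
    rewrite (Hconst 0); [ring | ]. revert H0. apply filter_imp. tauto.
  + assert (H3 : U (fun m => tm m = 1 /\ ~ Q m (tm m))).
    { generalize (filter_and _ _ H H0). apply filter_imp. intros m. generalize (proj2 (Htm m)). tauto. }
    assert (H2 : ~ crosses g u v) by (apply HnQ; revert H3; apply filter_imp; tauto).
    apply H2, Hb. replace b with alpha; [exact Hs | ]. rewrite Halpha. unfold al.
    rewrite (Hconst 1); [ring | ]. revert H3. apply filter_imp. tauto.
Qed.

(** * The three ground states *)

Lemma Rmax_lip a x y : Rabs (Rmax x a - Rmax y a) <= Rabs (x - y).
Proof.
unfold Rmax. destruct (Rle_dec x a), (Rle_dec y a); unfold Rabs; repeat destruct Rcase_abs; lra.
Qed.

Lemma Rmin_lip a x y : Rabs (Rmin x a - Rmin y a) <= Rabs (x - y).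
Proof.
unfold Rmin. destruct (Rle_dec x a), (Rle_dec y a); unfold Rabs; repeat destruct Rcase_abs; lra.
Qed.

Lemma c_lip (k : R -> R) x : (forall y z, Rabs (k y - k z) <= Rabs (y - z)) -> continuous k x.
Proof.
intros H. apply filterlim_locally. intros eps. exists eps. intros y Hy.
change (Rabs (y - x) < eps) in Hy. change (Rabs (k y - k x) < eps). specialize (H y x). lra.
Qed.

Lemma c_extend (f : R -> R) a s : cont_on_ge a f -> continuous (fun s => f (Rmax s a)) s.
Proof.
intros Hf. apply filterlim_locally. intros eps.
destruct (proj1 (filterlim_locally _ _) (Hf (Rmax s a) (Rmax_r s a)) eps) as [d Hd].
exists d. intros y Hy. apply Hd; [ | apply Rmax_r].
change (Rabs (Rmax y a - Rmax s a) < d). change (Rabs (y - s) < d) in Hy.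
generalize (Rmax_lip a y s). lra.
Qed.

(** The strict sign near zero makes [b] positive and [F] negative on all of [(0, b]]; hence
    [b < beta], and [F] rises to zero between them. *)
Lemma nonlin_intro g b beta :
  (forall s, continuous g s) -> (forall s, s <= 0 -> g s = 0) -> 0 <= b ->
  (forall s, b < s -> 0 < g s) -> (forall s, 0 <= s <= b -> g s <= 0) ->
  (exists e, 0 < e /\ forall s, 0 < s < e -> g s < 0) -> b <= beta -> prim g beta = 0 ->
  nonlin g b beta.
Proof.
intros cg H0 Hb0 Hpos Hneg [e [He Hneg']] Hbb HF.
assert (Hb : 0 < b).
{ destruct Hb0 as [Hb | <-]; [exact Hb | ]. specialize (Hpos (e / 2)). specialize (Hneg' (e / 2)). lra. }
assert (Hlow : forall s, 0 < s <= b -> prim g s < 0).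
{ intros s Hs. set (t := Rmin s (e / 2)).
  assert (Ht : 0 < t) by pos.
  assert (Hts : t <= s) by apply Rmin_l. assert (Hte : t <= e / 2) by apply Rmin_r.
  assert (H1 : - prim g 0 < - prim g t).
  { apply (deriv_pos_lt (fun x => - prim g x) (fun x => - g x)); [exact Ht | | | ].
    - intros x Hx. apply d_opp, d_prim, cg.
    - intros x Hx. apply c_opp, c_prim, cg.
    - intros x Hx. specialize (Hneg' x). lra. }
  assert (H2 : - prim g t <= - prim g s).
  { apply (deriv_nonneg_le (fun x => - prim g x) (fun x => - g x)); [exact Hts | | | ].
    - intros x Hx. apply d_opp, d_prim, cg.
    - intros x Hx. apply c_opp, c_prim, cg.
    - intros x Hx. specialize (Hneg x). lra. }
  rewrite prim_0 in H1. lra. }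
assert (Hbb' : b < beta).
{ destruct Hbb as [H | H]; [exact H | ]. specialize (Hlow b). rewrite H, HF in Hlow. lra. }
split; try assumption.
intros s Hs. destruct (Rle_lt_dec s b) as [Hsb | Hsb]; [apply Hlow; lra | ].
rewrite <- HF. apply (deriv_pos_lt (prim g) g); [lra | | | ].
- intros x _. apply d_prim, cg.
- intros x _. apply c_prim, cg.
- intros x Hx. apply Hpos. lra.
Qed.

(** Freezing [h] above [S0] provides the bounded nonlinearity that shooting requires; ground states
    started at most at [S0] do not see the change. *)
Lemma nonlin_cut h b beta S0 :
  nonlin h b beta -> (forall s, 0 <= s <= b -> h s <= 0) ->
  (exists e, 0 < e /\ forall s, 0 < s < e -> h s < 0) -> beta < S0 ->
  nonlin (fun s => h (Rmin s S0)) b beta.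
Proof.
intros Hh Hneg [e [He Hneg']] HS.
generalize (nl_b Hh) (nl_bbeta Hh). intros Hb Hbb.
apply nonlin_intro.
- intros s. apply (c_comp h (fun s => Rmin s S0)); [apply (nl_cont Hh) | ].
  apply c_lip. apply Rmin_lip.
- intros s Hs. rewrite Rmin_left by lra. now apply (nl_neg Hh).
- lra.
- intros s Hs. apply (nl_pos Hh). apply Rmin_glb_lt; lra.
- intros s Hs. rewrite Rmin_left by lra. now apply Hneg.
- exists (Rmin e b). split; [apply Rmin_glb_lt; lra | ]. intros s Hs.
  generalize (Rmin_l e b) (Rmin_r e b). intros. rewrite Rmin_left by lra. apply Hneg'. lra.
- lra.
- rewrite <- (nl_beta Hh). apply (prim_agree _ h S0); [ | lra].
  intros t Ht. now rewrite Rmin_left.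
Qed.

Lemma cut_unif_cont h S0 :
  0 < S0 -> (forall s, continuous h s) -> (forall s, s <= 0 -> h s = 0) ->
  unif_cont (fun s => h (Rmin s S0)) /\ exists M, forall s, Rabs (h (Rmin s S0)) <= M.
Proof.
intros HS ch H0.
set (cl := fun s => Rmax (Rmin s S0) 0).
assert (Hcl : forall s, h (Rmin s S0) = h (cl s)).
{ intros s. unfold cl, Rmax. destruct (Rle_dec (Rmin s S0) 0) as [H | H]; [ | reflexivity].
  rewrite (H0 (Rmin s S0) H), (H0 0); lra. }
assert (Hrange : forall s, 0 <= cl s <= S0).
{ intros s. unfold cl. split; [apply Rmax_r | ]. apply Rmax_lub; [apply Rmin_r | lra]. }
split.
- intros e He.
  destruct (@Heine_cor2 h 0 S0 (fun s _ => proj2 (continuity_pt_filterlim h s) (ch s)) (mkposreal _ He))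
    as [d Hd].
  exists d. split; [apply cond_pos | ]. intros x y Hxy. rewrite !Hcl.
  apply Hd; try apply Hrange. unfold cl.
  generalize (Rmax_lip 0 (Rmin x S0) (Rmin y S0)) (Rmin_lip S0 x y). lra.
- destruct (compact_bound h 0 S0) as [M [_ HM]]; [lra | intros; apply ch | ].
  exists M. intros s. rewrite Hcl. apply HM, Hrange.
Qed.

(** A single expression in [Rmin] and [Rmax], from which continuity follows without matching the
    three pieces. *)
Lemma f_pos_formula f1 f2 alpha eps A s :
  0 < eps ->
  f_pos f1 f2 alpha eps A s =
    f1 (Rmin s (alpha + eps))
    + (Rmax (Rmin s (alpha + 2 * eps)) (alpha + eps) - (alpha + eps)) / eps
      * (A ^ 2 * f2 (alpha + 2 * eps) - f1 (alpha + eps))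
    + (A ^ 2 * f2 (Rmax s (alpha + 2 * eps)) - A ^ 2 * f2 (alpha + 2 * eps)).
Proof.
intros He. unfold f_pos. cbv zeta.
destruct (Rle_dec s (alpha + eps)) as [H1 | H1].
- rewrite (Rmin_left s (alpha + eps)), (Rmin_left s (alpha + 2 * eps)), (Rmax_right s (alpha + eps)),
    (Rmax_right s (alpha + 2 * eps)) by lra. field. lra.
- rewrite (Rmin_right s (alpha + eps)) by lra. destruct (Rle_dec s (alpha + 2 * eps)) as [H2 | H2].
  + rewrite (Rmin_left s (alpha + 2 * eps)), (Rmax_left s (alpha + eps)),
      (Rmax_right s (alpha + 2 * eps)) by lra. field. lra.
  + rewrite (Rmin_right s (alpha + 2 * eps)), (Rmax_left (alpha + 2 * eps) (alpha + eps)),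
      (Rmax_left s (alpha + 2 * eps)) by lra. field. lra.
Qed.

Lemma f_pos_le f1 f2 alpha eps A s :
  s <= alpha + eps -> f_pos f1 f2 alpha eps A s = f1 s.
Proof. intros H. unfold f_pos. cbv zeta. destruct (Rle_dec s (alpha + eps)); [reflexivity | lra]. Qed.

Lemma f_pos_ge f1 f2 alpha eps A s :
  0 < eps -> alpha + 2 * eps <= s -> f_pos f1 f2 alpha eps A s = A ^ 2 * f2 s.
Proof.
intros He H. unfold f_pos. cbv zeta. destruct (Rle_dec s (alpha + eps)); [lra | ].
destruct (Rle_dec s (alpha + 2 * eps)); [ | reflexivity].
replace s with (alpha + 2 * eps) by lra. field. lra.
Qed.

Lemma f_pos_mid f1 f2 alpha eps A s :
  0 < eps -> alpha + eps <= s <= alpha + 2 * eps -> exists t, 0 <= t <= 1 /\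
    f_pos f1 f2 alpha eps A s = (1 - t) * f1 (alpha + eps) + t * (A ^ 2 * f2 (alpha + 2 * eps)).
Proof.
intros He H. exists ((s - (alpha + eps)) / eps). split.
- split.
  + apply Rmult_le_pos; [lra | pos].
  + apply (Rmult_le_reg_r eps); [exact He | ]. rewrite div_mult; lra.
- unfold f_pos. cbv zeta. destruct (Rle_dec s (alpha + eps)).
  + replace s with (alpha + eps) by lra. field. lra.
  + destruct (Rle_dec s (alpha + 2 * eps)); [ring | lra].
Qed.

Lemma f_odd_nonneg f1 f2 alpha eps A s :
  0 <= s -> f_odd f1 f2 alpha eps A s = f_pos f1 f2 alpha eps A s.
Proof. intros H. unfold f_odd. destruct (Rle_dec 0 s); [reflexivity | lra]. Qed.

Theorem theorem4p2 :
  forall (N : nat) (f1 f2 : R -> R) (alpha b beta : R),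
    (2 < N)%nat ->
    H1 f1 b beta -> H2 N f1 beta -> H3 f1 b -> H4 N f1 alpha -> H5 f2 alpha ->
    exists epsbar Abar, 0 < epsbar /\ 0 < Abar /\
      forall eps A, 0 < eps < epsbar -> Abar < A ->
        GST N (f_odd f1 f2 alpha eps A) beta ->
        at_least_three_GS N (f_odd f1 f2 alpha eps A).
Proof.
intros N f1 f2 alpha b beta HN Hf1 Het _ Hgs [cf2 pf2].
destruct Hf1 as [cf1 [_ [f10 [Hb0 [f1pos [f1neg [[e0 [He0 f1neg']] [Hbbeta [Fbeta _]]]]]]]]].
destruct N as [ | n]; [lia | ]. assert (Hn : (2 <= n)%nat) by lia. assert (Hn1 : (0 < n)%nat) by lia.
assert (HINR : INR (S n) - 1 = INR n) by (rewrite S_INR; ring).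
set (phi := fun s => f1 (Rmax s 0)).
assert (phi_nn : forall s, 0 <= s -> phi s = f1 s) by (intros s Hs; unfold phi; now rewrite Rmax_left).
assert (phi_neg : forall s, s <= 0 -> phi s = 0) by (intros s Hs; unfold phi; now rewrite Rmax_right).
assert (Hphi : nonlin phi b beta).
{ apply nonlin_intro; try assumption.
  - intros s. now apply c_extend.
  - intros s Hs. rewrite phi_nn by lra. now apply f1pos.
  - intros s Hs. rewrite phi_nn by lra. now apply f1neg.
  - exists e0. split; [exact He0 | ]. intros s Hs. rewrite phi_nn by lra. now apply f1neg'.
  - rewrite <- Fbeta. apply (prim_agree phi f1 beta); [ | lra]. intros t Ht. apply phi_nn. lra. }
generalize (nl_b Hphi) (nl_bbeta Hphi). intros Hb Hbb.
assert (HET : forall a, erbe_tang n phi beta a).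
{ intros a s Hs. destruct (Het s ltac:(lra)) as [Hex HD].
  exists (Derive (fun t => prim f1 t / f1 t) s). split.
  - apply (is_derive_ext_loc (fun t => prim f1 t / f1 t)); [ | now apply Derive_correct].
    assert (Hp : 0 < s) by lra. apply (near_intro s _ _ Hp). intros y Hy.
    rewrite (prim_agree f1 phi y) by (try lra; intros t Ht; rewrite phi_nn; lra).
    now rewrite phi_nn by lra.
  - rewrite S_INR in HD. replace (INR n - 1) with (INR n + 1 - 2) by ring. exact HD. }
destruct Hgs as [u0 [Hrad [_ [u0pos [u0nz u0lim]]]]].
assert (Hu00 : u0 0 = alpha) by apply Hrad.
set (us := fun r => if Rle_dec r 0 then alpha else u0 r).
set (vs := fun r => if Rle_dec r 0 then 0 else Derive u0 r).
assert (Hus : sol n phi alpha us vs).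
{ apply (sol_of_radial (S n) n f1); try assumption. intros r Hr. symmetry. apply phi_nn, u0pos. lra. }
assert (us_eq : forall r, 0 <= r -> us r = u0 r).
{ intros r Hr. unfold us. destruct (Rle_dec r 0); [ | reflexivity]. replace r with 0 by lra. now symmetry. }
destruct (ground_state_energy n phi b beta alpha us vs Hn1 Hphi Hus) as [Ha [Hnt [Hnc Hle]]].
{ intros r Hr. rewrite us_eq by exact Hr. now apply u0pos. }
{ apply (filterlim_ext_loc u0); [ | exact u0lim]. exists 0. intros r Hr. symmetry. apply us_eq. lra. }
{ destruct u0nz as [r [Hr Hr2]]. exists r. now rewrite us_eq. }
assert (Hus01 : forall r, 0 <= r -> 0 <= us r <= alpha).
{ intros r Hr. split; [rewrite us_eq by exact Hr; now apply u0pos | now apply Hle]. }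
assert (cf2' : forall s, continuous (fun s => f2 (Rmax s alpha)) s) by (intros s; now apply c_extend).
destruct (compact_pos_min (fun s => f2 (Rmax s alpha)) alpha (alpha + 1)) as [K1 [HK1 HK1']].
{ intros s _. apply cf2'. }
{ intros s Hs. apply pf2, Rmax_r. }
destruct (compact_max (fun s => f2 (Rmax s alpha)) alpha (alpha + 1)) as [x2 [_ Hx2]]; [lra | | ].
{ intros s _. apply cf2'. }
destruct (compact_max phi 0 (alpha + 1)) as [x1 [_ Hx1]]; [lra | | ].
{ intros s _. apply (nl_cont Hphi). }
(* The summand [phi x1] lets [K2 A^2] also dominate the left end of the segment [L], as [A > 1]. The
   bounds range over [[alpha, alpha + 1]] because [D <= 1]. *)
set (K2 := f2 (Rmax x2 alpha) + phi x1).
assert (Hphix1 : 0 < phi x1).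
{ eapply Rlt_le_trans; [ | apply (Hx1 alpha); lra]. apply (nl_pos Hphi). lra. }
assert (Hf2K1 : forall s, alpha <= s <= alpha + 1 -> K1 <= f2 s).
{ intros s Hs. specialize (HK1' s Hs). cbv beta in HK1'. now rewrite Rmax_left in HK1' by lra. }
assert (Hf2K2 : forall s, alpha <= s <= alpha + 1 -> f2 s <= K2 - phi x1).
{ intros s Hs. specialize (Hx2 s Hs). cbv beta in Hx2. rewrite (Rmax_left s) in Hx2 by lra. unfold K2. lra. }
assert (HK12 : K1 <= K2).
{ generalize (Hf2K1 alpha ltac:(lra)) (Hf2K2 alpha ltac:(lra)). lra. }
destruct (turns_above n phi b beta alpha us vs 1 K1 K2 Hn Hphi Hus Ha Hus01 (HET alpha) Rlt_0_1 (conj HK1 HK12))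
  as [D [epsbar [Abar [HD [Hepsbar [HAbar Hturn]]]]]].
exists epsbar, (Rmax Abar 1).
split; [lra | split; [apply Rlt_le_trans with Abar; [exact HAbar | apply Rmax_l] | ]].
intros eps A Heps HA [_ [bbar [theta [Hbbar [Hth [HQ Hcond]]]]]].
assert (HA1 : Abar < A) by (eapply Rle_lt_trans; [apply Rmax_l | exact HA]).
assert (HA2 : 1 < A) by (eapply Rle_lt_trans; [apply Rmax_r | exact HA]).
assert (HAsq : 1 < A ^ 2) by nra.
set (f := f_odd f1 f2 alpha eps A) in *.
set (h := fun s => f (Rmax s 0)).
assert (h_nn : forall s, 0 <= s -> h s = f_pos f1 f2 alpha eps A s).
{ intros s Hs. unfold h, f. rewrite Rmax_left by exact Hs. now apply f_odd_nonneg. }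
assert (f_h : forall s, 0 <= s -> f s = h s) by (intros s Hs; unfold h; now rewrite Rmax_left).
assert (h_phi : forall s, s <= alpha + eps -> h s = phi s).
{ intros s Hs. unfold h, phi, f. rewrite f_odd_nonneg by apply Rmax_r. apply f_pos_le.
  apply Rmax_lub; lra. }
assert (h_cont : forall s, continuous h s).
{ intros s. unfold h, f.
  apply (continuous_ext (fun s => f1 (Rmax (Rmin s (alpha + eps)) 0)
    + (Rmax (Rmin s (alpha + 2 * eps)) (alpha + eps) - (alpha + eps)) / eps
      * (A ^ 2 * f2 (alpha + 2 * eps) - f1 (alpha + eps))
    + (A ^ 2 * f2 (Rmax (Rmax s (alpha + 2 * eps)) alpha) - A ^ 2 * f2 (alpha + 2 * eps)))).
  - intros x. rewrite f_odd_nonneg by apply Rmax_r. rewrite f_pos_formula by lra.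
    rewrite (Rmax_left (Rmax x (alpha + 2 * eps)) alpha) by (generalize (Rmax_r x (alpha + 2 * eps)); lra).
    destruct (Rle_dec 0 x) as [Hx | Hx].
    + rewrite (Rmax_left x 0) by exact Hx. rewrite (Rmax_left (Rmin x (alpha + eps)) 0); [reflexivity | ].
      apply Rmin_glb; lra.
    + rewrite (Rmax_right x 0) by lra.
      rewrite (Rmin_left x (alpha + eps)), (Rmin_left x (alpha + 2 * eps)),
        (Rmin_left 0 (alpha + eps)), (Rmin_left 0 (alpha + 2 * eps)), (Rmax_right x 0),
        (Rmax_right x (alpha + eps)), (Rmax_right 0 (alpha + eps)), (Rmax_right x (alpha + 2 * eps)),
        (Rmax_right 0 (alpha + 2 * eps)) by lra. reflexivity.
  - assert (C1 : continuous (fun s => f1 (Rmax (Rmin s (alpha + eps)) 0)) s).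
    { apply (c_comp phi (fun s => Rmin s (alpha + eps))); [apply (nl_cont Hphi) | ].
      apply c_lip, Rmin_lip. }
    assert (C2 : continuous (fun s => Rmax (Rmin s (alpha + 2 * eps)) (alpha + eps)) s).
    { apply c_lip. intros y z. eapply Rle_trans; [apply Rmax_lip | apply Rmin_lip]. }
    assert (C3 : continuous (fun s => f2 (Rmax (Rmax s (alpha + 2 * eps)) alpha)) s).
    { apply (c_comp (fun t => f2 (Rmax t alpha)) (fun s => Rmax s (alpha + 2 * eps))); [apply cf2' | ].
      apply c_lip, Rmax_lip. }
    apply c_plus; [apply c_plus; [exact C1 | ] | ].
    + apply c_mult; [ | apply c_const]. apply c_div; [ | apply c_const | lra].
      apply c_minus; [exact C2 | apply c_const].
    + apply c_minus; [ | apply c_const]. apply c_mult; [apply c_const | exact C3]. }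
assert (h_pos : forall s, b < s -> 0 < h s).
{ intros s Hs. destruct (Rle_lt_dec s (alpha + eps)) as [H1 | H1].
  - rewrite h_phi by exact H1. now apply (nl_pos Hphi).
  - rewrite h_nn by lra. destruct (Rle_lt_dec s (alpha + 2 * eps)) as [H2 | H2].
    + destruct (f_pos_mid f1 f2 alpha eps A s) as [t [Ht ->]]; [lra | lra | ].
      assert (Q1 : 0 < f1 (alpha + eps)) by (apply f1pos; lra).
      assert (Q2 : 0 < A ^ 2 * f2 (alpha + 2 * eps)) by (apply Rmult_lt_0_compat; [lra | apply pf2; lra]).
      destruct (Req_dec t 0) as [-> | Ht0]; [lra | ].
      assert (0 < t * (A ^ 2 * f2 (alpha + 2 * eps))) by pos.
      assert (0 <= (1 - t) * f1 (alpha + eps)) by pos. lra.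
    + rewrite f_pos_ge by lra. apply Rmult_lt_0_compat; [lra | apply pf2; lra]. }
assert (h_neg : forall s, s <= 0 -> h s = 0) by (intros s Hs; rewrite h_phi by lra; now apply phi_neg).
assert (h_npos : forall s, 0 <= s <= b -> h s <= 0).
{ intros s Hs. rewrite h_phi, phi_nn by lra. now apply f1neg. }
assert (h_start : exists e, 0 < e /\ forall s, 0 < s < e -> h s < 0).
{ exists (Rmin e0 b). split; [now apply Rmin_glb_lt | ]. intros s Hs.
  generalize (Rmin_l e0 b) (Rmin_r e0 b). intros. rewrite h_phi, phi_nn by lra. apply f1neg'. lra. }
assert (Hh : nonlin h b beta).
{ apply nonlin_intro; try assumption. rewrite <- (nl_beta Hphi).
  apply (prim_agree h phi beta); [ | lra]. intros t Ht. apply h_phi. lra. }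
assert (Qh : forall s, 0 <= s -> Qfun (S n) h s = Qfun (S n) f s).
{ intros s Hs. unfold Qfun. rewrite (prim_agree h f s) by (try lra; intros t Ht; symmetry; apply f_h; lra).
  now rewrite f_h. }
destruct (crosses_large n h b beta bbar theta (alpha + D) Hn Hh Hbbar Hth) as [alpha2 [Halpha2 Hcross2]].
{ intros s Hs. rewrite Qh by lra. now apply HQ. }
{ intros M s0. destruct (Hcond M (Rmax s0 0)) as [s [Hs Hs2]].
  generalize (Rmax_l s0 0) (Rmax_r s0 0). intros.
  exists s. split; [lra | ]. intros s1 s2 Hs1 Hs2'.
  assert (0 < theta * s) by pos.
  rewrite Qh, <- f_h by lra. now apply Hs2. }
(* The cut-off comes only now because [alpha2] depends on [eps] and [A]. *)
set (g := fun s => h (Rmin s alpha2)).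
assert (g_h : forall s, s <= alpha2 -> g s = h s) by (intros s Hs; unfold g; now rewrite Rmin_left).
assert (Hg : nonlin g b beta) by (apply nonlin_cut; try assumption; lra).
destruct (cut_unif_cont h alpha2) as [gu [M gM]]; [lra | exact h_cont | exact h_neg | ].
fold g in gu.
assert (Hturn' : forall u v, sol n g (alpha + D) u v -> turns g u v).
{ apply (Hturn eps A g Heps HA1 Hg).
  - intros s Hs. rewrite g_h, h_phi; [reflexivity | lra | lra].
  - intros s Hs. rewrite g_h, h_nn by lra.     destruct (Rle_lt_dec s (alpha + 2 * eps)) as [H2 | H2].
    + destruct (f_pos_mid f1 f2 alpha eps A s) as [t [Ht ->]]; [lra | lra | ].
      assert (Q1 : f1 (alpha + eps) <= K2 * A ^ 2).
      { rewrite <- phi_nn by lra. apply Rle_trans with (phi x1); [apply Hx1; lra | ].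
        assert (phi x1 <= K2) by (generalize (Hf2K1 alpha ltac:(lra)) (Hf2K2 alpha ltac:(lra)); lra).
        assert (K2 * 1 <= K2 * A ^ 2) by nra. lra. }
      assert (Q2 : A ^ 2 * f2 (alpha + 2 * eps) <= K2 * A ^ 2).
      { rewrite Rmult_comm. apply Rmult_le_compat_r; [lra | ]. generalize (Hf2K2 (alpha + 2 * eps) ltac:(lra)). lra. }
      assert (t * (A ^ 2 * f2 (alpha + 2 * eps)) <= t * (K2 * A ^ 2)) by nra.
      assert ((1 - t) * f1 (alpha + eps) <= (1 - t) * (K2 * A ^ 2)) by nra. lra.
    + rewrite f_pos_ge by lra. rewrite Rmult_comm. apply Rmult_le_compat_r; [lra | ].
      generalize (Hf2K2 s ltac:(lra)). lra.
  - intros s Hs. rewrite g_h, h_nn by lra. rewrite f_pos_ge by lra. rewrite (Rmult_comm (A ^ 2)).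
    apply Rmult_le_compat_r; [lra | ]. apply Hf2K1. lra. }
assert (Hcross' : forall u v, sol n g alpha2 u v -> crosses g u v).
{ apply (Hcross2 g Hg). intros s Hs. apply g_h. lra. }
assert (g_phi : forall s, s <= alpha + eps -> g s = phi s) by (intros s Hs; rewrite g_h, h_phi; lra).
assert (Husg : sol n g alpha us vs).
{ apply (sol_change n phi g); [exact Hus | ]. intros r Hr. symmetry. apply g_phi.
  generalize (Hus01 r ltac:(lra)). lra. }
assert (Hprim : forall s, 0 <= s <= alpha -> prim g s = prim phi s).
{ intros s Hs. apply (prim_agree g phi alpha); [ | exact Hs]. intros t Ht. apply g_phi. lra. }
assert (Hntg : ~ turns g us vs).
{ intros [r [Hr [HE Hp]]]. apply Hnt. exists r. split; [exact Hr | split; [ | exact Hp]].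
  unfold energy in *. now rewrite <- Hprim by now apply Hus01. }
(* Started below [alpha + eps], these solutions stay in the range where [g] is [f1] and the
   Erbe-Tang condition is at hand. *)
assert (Hcross0 : forall u v, sol n g (alpha + eps / 2) u v -> crosses g u v).
{ intros u v Hs. apply (crosses_above n g b beta alpha us vs (alpha + eps / 2)); try assumption; [lra | ].
  apply (erbe_tang_agree n phi g); [lra | | apply HET]. intros t Ht. symmetry. apply g_phi. lra. }
assert (Hgs : forall a u v, beta < a <= alpha2 -> sol n g a u v -> ~ turns g u v -> ~ crosses g u v ->
  exists w, ground_state (S n) f w /\ w 0 = a).
{ intros a u v Haa Hs Hnt' Hnc'. apply (ground_state_of_sol (S n) n f g b beta a u v); try assumption; [lra | ].
  intros s Hs'. rewrite g_h, f_h; [reflexivity | lra | lra]. }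
destruct (Hgs alpha us vs) as [w0 [Gw0 Ew0]]; [lra | exact Husg | exact Hntg | | ].
{ intros [r [Hr [Hneg _]]]. generalize (Hus01 r Hr). lra. }
(* [shooting] runs from the turning end to the crossing end, so the first call goes downwards from
   [alpha + D] and the second upwards. *)
destruct (shooting n g M (alpha + D) (alpha + eps / 2) gu gM Hturn' Hcross0) as [t1 [u1 [v1 [Ht1 [S1 [T1 C1]]]]]].
destruct (shooting n g M (alpha + D) alpha2 gu gM Hturn' Hcross') as [t2 [u2 [v2 [Ht2 [S2 [T2 C2]]]]]].
assert (B1 : alpha < alpha + D + t1 * (alpha + eps / 2 - (alpha + D)) < alpha + D) by nra.
assert (B2 : alpha + D < alpha + D + t2 * (alpha2 - (alpha + D)) < alpha2) by nra.
destruct (Hgs (alpha + D + t1 * (alpha + eps / 2 - (alpha + D))) u1 v1 ltac:(lra) S1 T1 C1) as [w1 [Gw1 Ew1]].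
destruct (Hgs (alpha + D + t2 * (alpha2 - (alpha + D))) u2 v2 ltac:(lra) S2 T2 C2) as [w2 [Gw2 Ew2]].
exists w0, w1, w2. split; [exact Gw0 | split; [exact Gw1 | split; [exact Gw2 | ]]].
split; [ | split]; exists 0; (split; [lra | ]); rewrite ?Ew0, ?Ew1, ?Ew2; lra.
Qed.
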